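(* Chromatic Sum is polynomial-time solvable for $(P_3+P_1)$-free graphs.
   Context: All graphs are finite, undirected and simple. A colouring of a graph $G=(V,E)$ is a function $c:V\to\{1,2,\ldots\}$ with $c(u)\neq c(v)$ for every edge $uv\in E$; its sum is $\sum_{v\in V}c(v)$. The decision problem Chromatic Sum takes a graph $G$ and an integer $k$ and asks whether $G$ admits a colouring with sum at most $k$; ''for'' a graph class means that input graphs are restricted to that class. $P_3+P_1$ is the disjoint union of a path on $3$ vertices and an isolated vertex. A graph is $(P_3+P_1)$-free if it has no induced subgraph isomorphic to $P_3+P_1$. *)

(* Defs.v *)
From HB Require Import structures.
From mathcomp Require Import all_boot all_order all_algebra.

Set Implicit Arguments.
Unset Strict Implicit.
Unset Printing Implicit Defensive.

(** * Graphs *)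

Record sgraph := SGraph {
  vertex :> finType;
  adj : rel vertex;
  adj_sym : symmetric adj;
  adj_irrefl : irreflexive adj
}.

Definition path_adj n : rel 'I_n :=
  fun i j => (i.+1 == j :> nat) || (j.+1 == i :> nat).

Lemma path_adj_sym n : symmetric (@path_adj n).
Proof. by move=> i j; rewrite /path_adj orbC. Qed.

Lemma path_adj_irrefl n : irreflexive (@path_adj n).
Proof. by move=> i; rewrite /path_adj orbb gtn_eqF. Qed.

(** The path on [n] vertices. *)
Definition path_graph n : sgraph :=
  SGraph (@path_adj_sym n) (@path_adj_irrefl n).

Definition union_adj (G H : sgraph) : rel (G + H)%type :=
  fun x y => match x, y with
             | inl u, inl v => adj u v
             | inr u, inr v => adj u v
             | _, _ => false
             end.

Lemma union_adj_sym G H : symmetric (@union_adj G H).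
Proof. by move=> [u|u] [v|v] //=; apply: adj_sym. Qed.

Lemma union_adj_irrefl G H : irreflexive (@union_adj G H).
Proof. by move=> [u|u] /=; apply: adj_irrefl. Qed.

Definition disjoint_union (G H : sgraph) : sgraph :=
  SGraph (@union_adj_sym G H) (@union_adj_irrefl G H).

Definition P3_P1 : sgraph := disjoint_union (path_graph 3) (path_graph 1).

(** [H] is isomorphic to an induced subgraph of [G]. *)
Definition has_induced (G H : sgraph) : Prop :=
  exists2 f : H -> G, injective f & forall x y, adj (f x) (f y) = adj x y.

Definition induced_free (H G : sgraph) : Prop := ~ has_induced G H.

(** * Chromatic Sum *)

Definition colouring (G : sgraph) (c : G -> nat) : Prop :=
  (forall v, 0 < c v) /\ (forall u v, adj u v -> c u <> c v).

Definition colouring_sum (G : sgraph) (c : G -> nat) : nat := \sum_(v : G) c v.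

Definition instance : Type := (sgraph * int)%type.

Definition chromatic_sum (I : instance) : Prop :=
  exists2 c : I.1 -> nat, colouring c & (Posz (colouring_sum c) <= I.2)%R.

(** Base 2, least significant bit first, without leading zeros; [0] is the
    empty word. *)
Definition binary (k : nat) : seq bool :=
  mkseq (fun i => odd (k %/ 2 ^ i)) (up_log 2 k.+1).

(** The number of vertices in unary, closed by [false]; the adjacency matrix
    row by row; the sign bit of [k]; then [|k|] in base 2.  As the matrix
    already has one bit per pair of vertices, the unary prefix does not affect
    the length up to a polynomial.  The order of the vertices is that of the
    enumeration of the vertex type; every symmetric 0/1 matrix with zero
    diagonal arises in this way. *)
Definition encode (I : instance) : seq bool :=
  let: (G, k) := I in
  nseq #|vertex G| true ++ false ::
  [seq adj u v | u <- enum G, v <- enum G] ++ (k < 0)%R :: binary `|k|.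

(** * Polynomial time *)

(** Deterministic random access machines.  A program addresses its registers
    by constants, and the memory through the contents of registers.  Both hold
    natural numbers.  Every instruction costs one unit of time: since the only
    arithmetic is addition and truncated subtraction, the contents and
    addresses occurring within [t] steps have [O(t + log N)] bits on an input
    of length [N], so this measure is polynomially related to the running time
    of Turing machines. *)
Inductive instr :=
| Iconst (r n : nat)    (* r := n *)
| Iadd (r a b : nat)    (* r := a + b *)
| Isub (r a b : nat)    (* r := a - b, truncated at 0 *)
| Iread (r a : nat)     (* r := mem[a] *)
| Iwrite (a r : nat)    (* mem[a] := r *)
| Ijz (r l : nat).      (* if r = 0 goto l *)

Definition program := seq instr.

Record config := Config {
  cpc : nat;
  cregs : nat -> nat;
  cmem : nat -> nat
}.

Definition exec (i : instr) (s : config) : config :=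
  let: Config p R M := s in
  match i with
  | Iconst r n => Config p.+1 [eta R with r |-> n] M
  | Iadd r a b => Config p.+1 [eta R with r |-> R a + R b] M
  | Isub r a b => Config p.+1 [eta R with r |-> R a - R b] M
  | Iread r a => Config p.+1 [eta R with r |-> M (R a)] M
  | Iwrite a r => Config p.+1 R [eta M with R a |-> R r]
  | Ijz r l => Config (if R r == 0 then l else p.+1) R M
  end.

(** The machine halts when the program counter leaves the program. *)
Definition step (P : program) (s : config) : config :=
  if onth P (cpc s) is Some i then exec i s else s.

Definition halted (P : program) (s : config) : bool := size P <= cpc s.

(** The input word is in memory, one bit per cell from address 0; its length
    is in register 0, and everything else is 0. *)
Definition init (w : seq bool) : config :=
  Config 0 (fun r => if r == 0 then size w else 0)
           (fun a => nth false w a : nat).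

Definition run (P : program) (w : seq bool) (t : nat) : config :=
  iter t (step P) (init w).

Definition accepting (s : config) : bool := cregs s 0 != 0.

(** The problem with set of instances [T], encoding [enc] and yes-instances
    [yes], with inputs restricted to the instances satisfying [C]: nothing is
    required of the program on other words. *)
Definition poly_time_solvable (T : Type) (enc : T -> seq bool)
    (yes : T -> Prop) (C : T -> Prop) : Prop :=
  exists (P : program) (c d : nat), forall x : T, C x ->
    exists t : nat,
      [/\ t <= c * size (enc x) ^ d + c,
          halted P (run P (enc x) t)
        & accepting (run P (enc x) t) <-> yes x].

(* Main.v *)
Require Import Defs.
From HB Require Import structures.
From mathcomp Require Import all_boot all_order all_algebra.
From mathcomp Require Import zify.


(** Colour classes of [G] are cliques of the complement [e] of [G], and [e] is
    paw-free.  A component of [e] with a triangle is complete multipartite, so an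
    exchange argument gives an optimal colouring whose first class is any largest
    clique, as long as there is one with at least three vertices.  Once [e] has
    no triangle, all classes have at most two vertices, and the optimum is
    determined by the size of a maximum matching of [e].

    To augment a matching, decide by growing an alternating forest whether it is
    maximum, and find the augmenting path edge by edge by self-reduction: match an
    exposed vertex [x] with a neighbour [u], expose the former mate of [u], and
    ask the same question for the graph without [x] and [u].  Only the decision is
    needed, so blossoms need not be expanded. *)

Set Implicit Arguments.
Unset Strict Implicit.
Unset Printing Implicit Defensive.

(** * Matchings *)

(** The paw is the complement of [P3_P1]. In a complete multipartite component, vertices of one part
    are twins, so the class with the smallest colour can be traded for a largest clique. For largest
    cliques with two vertices this fails: removing the middle edge of a path on four vertices
    destroys its perfect matching. In the triangle-free case the sum of a colouring is the total,
    over all [t], of the number of vertices left after [t] classes; these classes cover at most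
    [t + minn t p] vertices, [p] being the size of a maximum matching.

    The invariant of the forest speaks of all sets [W] between the roots and the set of bases: the
    roots alone yield a larger matching, all bases yield the barrier that certifies maximality, and
    shrinking a blossom relies on the sets in between.

    Since a machine program has to be verified, each fixpoint search is a sweep over all pairs,
    repeated [N] times. That is often enough because the adjacency matrix makes the input length [N]
    exceed [n * n + n + 1] for [n] vertices, while the progress measures stay below that. *)

Section PerfectMatching.

Variables (T : finType) (e : rel T).
Hypotheses (esym : symmetric e) (eirr : irreflexive e).

(** [pm K]: the subgraph induced by [K] has a perfect matching. *)
Inductive pm : {set T} -> Prop :=
| pm0 : pm set0
| pmS x y (K : {set T}) of e x y & x \notin K & y \notin K & pm K : pm (x |: (y |: K)).

Lemma pmU A B : pm A -> pm B -> [disjoint A & B] -> pm (A :|: B).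
Proof.
move=> pA pB; elim: pA => [|x y K exy xK yK _ IH]; first by rewrite set0U.
move=> dis; rewrite -!setUA; apply: pmS => //.
- by rewrite inE negb_or xK (disjointFr dis) // !inE eqxx.
- by rewrite inE negb_or yK (disjointFr dis) // !inE eqxx orbT.
by apply: IH; apply: disjointWl dis; rewrite setUA subsetUr.
Qed.

Lemma pm_odd A : pm A -> ~~ odd #|A|.
Proof.
elim=> [|x y K exy xK yK _ IH]; first by rewrite cards0.
have xy : x != y by apply: contraTneq exy => ->; rewrite eirr.
by rewrite !cardsU1 !inE negb_or xK yK xy !oddD /= negbK.
Qed.

(** [pm] carries no matching, so the partner of a given vertex is extracted by induction. *)
Lemma pm_edge A x : pm A -> x \in A ->
  exists u, [/\ e x u, u \in A & pm (A :\ x :\ u)].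
Proof.
elim=> [|a b K eab aK bK pK IH]; first by rewrite inE.
have ab : a != b by apply: contraTneq eab => ->; rewrite eirr.
rewrite !inE => /or3P[/eqP->|/eqP->|xK].
- exists b; rewrite !inE eqxx orbT; split=> //.
  by rewrite !setU1K // !inE negb_or ab.
- exists a; rewrite !inE eqxx esym; split=> //.
  by rewrite setUCA !setU1K // !inE negb_or eq_sym ab.
have [u [exu uK pu]] := IH xK.
exists u; split; rewrite ?inE ?uK ?orbT //.
have [xa xb ua ub] : [/\ x != a, x != b, u != a & u != b].
  by split; apply/eqP=> E; move: aK bK; rewrite -E ?xK ?uK.
rewrite (_ : _ :\ u = a |: (b |: (K :\ x :\ u))).
  by apply: pmS; rewrite // !inE negb_and negb_and ?aK ?bK /= ?orbT.
apply/setP=> z; rewrite !inE.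
have [->|_] := eqVneq z a; first by rewrite eq_sym ua eq_sym xa.
by have [->|_] := eqVneq z b; first by rewrite eq_sym ub eq_sym xb.
Qed.

(** A matching is represented by its mate function, unmatched vertices being
    fixed. *)
Definition mating (M : T -> T) : Prop :=
  involutive M /\ forall v, M v != v -> e v (M v).

Lemma pm_mating M (Y : {set T}) : mating M ->
  {in Y, forall v, M v \in Y /\ M v != v} -> pm Y.
Proof.
move=> [invM eM]; have [n] := ubnP #|Y|; elim: n Y => // n IH Y Yn MY.
have [->|[x xY]] := set_0Vmem Y; first exact: pm0.
have [MxY Mxx] := MY _ xY.
rewrite (_ : Y = x |: (M x |: (Y :\ x :\ M x))); last first.
  by rewrite !setD1K // !inE Mxx.
apply: pmS; rewrite ?eM //; try by rewrite !inE eqxx ?andbF.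
apply: IH => [|v].
  by rewrite (cardsD1 x) xY in Yn; apply: leq_ltn_trans (subset_leq_card (subD1set _ _)) _.
rewrite !inE => /and3P[vMx vx vY]; have [MvY Mvv] := MY _ vY.
rewrite Mvv MvY !(can2_eq invM invM) invM vMx vx; split=> //.
Qed.

(** The easy half of the Tutte-Berge formula. *)
Lemma pm_barrier (B A : {set T}) (F : T -> {set T}) (L K : {set T}) :
  {in B &, forall b c, b != c -> [disjoint F b & F c]} ->
  {in B, forall b, [disjoint F b & A]} ->
  (forall b x y, b \in B -> x \in F b -> e x y -> y \in L -> y \in F b :|: A) ->
  K \subset L -> pm K ->
  #|[set b in B | odd #|F b :&: K|]| <= #|A :&: K|.
Proof.
move=> Fdis FA Fe KL pK; elim: pK KL => [|x y {}K exy xK yK pK IH].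
  move=> _; rewrite (_ : [set _ in _ | _] = set0) ?cards0 //.
  by apply/setP=> b; rewrite !inE setI0 cards0 andbF.
rewrite !subUset !sub1set => /and3P[xL yL /IH{}IH].
have xy : x != y by apply: contraTneq exy => ->; rewrite eirr.
have cI (D X : {set T}) z : z \notin X -> #|D :&: (z |: X)| = (z \in D) + #|D :&: X|.
  move=> zX; rewrite setIUr; have [zD|zD] := boolP (z \in D).
    by rewrite (setIidPr _) ?sub1set // cardsU1 inE (negPf zX) andbF.
  rewrite (_ : D :&: [set z] = set0) ?set0U //.
  by apply/eqP; rewrite setI_eq0 disjoint_sym disjoints1.
have cU (D : {set T}) : #|D :&: (x |: (y |: K))| =
   (x \in D) + (y \in D) + #|D :&: K|.
  by rewrite !cI ?addnA // !inE negb_or xy.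
have cF b : b \in B -> odd #|F b :&: (x |: (y |: K))| =
    (x \in F b) (+) (y \in F b) (+) odd #|F b :&: K|.
  by move=> bB; rewrite cU !oddD !oddb.
rewrite cU.
(* Adding [x] and [y] to [K] changes the parity of [F b :&: K] only for [b] in [D]. It remains to
   see that [D] has at most one element, and none unless [x] or [y] lies in [A]. *)
pose D := [set b in B | (x \in F b) (+) (y \in F b)].
have sub : [set b in B | odd #|F b :&: (x |: (y |: K))|] \subset
   D :|: [set b in B | odd #|F b :&: K|].
  apply/subsetP=> b; rewrite !inE => /andP[bB]; rewrite cF // bB /=.
  by case: (_ (+) (y \in _)).
apply: leq_trans (subset_leq_card sub) _.
apply: leq_trans (leq_card_setU _ _) _; apply: leq_add => //.
(* an edge leaving a set [F b] has its other end in [A], outside all of them *)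
have uniq1 z z' b : b \in B -> z \in F b -> e z z' -> z' \in L -> z' \notin F b ->
   z' \in A /\ forall c, c \in B -> (z \in F c) (+) (z' \in F c) -> c = b.
  move=> bB zb ez z'L z'b; have := Fe _ _ _ bB zb ez z'L.
  rewrite inE (negPf z'b) /= => z'A; split=> // c cB.
  have z'c : z' \notin F c by rewrite (disjointFl (FA _ cB)).
  rewrite (negPf z'c) addbF => zc; apply/eqP; apply: contraTT zc => cb.
  by rewrite (disjointFl (Fdis _ _ cB bB cb)).
have [->|[b]] := set_0Vmem D; first by rewrite cards0.
rewrite inE => /andP[bB bD].
have : #|D| <= 1.
  apply/card_le1P => c; rewrite !inE => /andP[cB cD] d; rewrite !inE.
  apply/andP/eqP => [[dB dD]|->]; last by rewrite cB.
  have key z z' : e z z' -> z' \in L -> z \in F c -> z' \notin F c ->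
      (z \in F d) (+) (z' \in F d) -> d = c.
    by move=> ez z'L zc z'c; apply: (uniq1 z z' c cB zc ez z'L z'c).2.
  have [xc|xc] := boolP (x \in F c).
    by apply: (key x y) => //; move: cD; rewrite xc /=.
  apply: (key y x) => //; rewrite 1?esym // 1?addbC //.
  by move: cD; rewrite (negPf xc).
suff : 0 < (x \in A) + (y \in A) by move=> h1 h2; apply: leq_trans h2 h1.
have [xb|xb] := boolP (x \in F b).
  have yb : y \notin F b by move: bD; rewrite xb.
  by rewrite (uniq1 x y b bB xb exy yL yb).1 addn1.
have yb : y \in F b by move: bD; rewrite (negPf xb).
by rewrite (uniq1 y x b bB yb _ xL xb).1 // esym.
Qed.

End PerfectMatching.

(** * Alternating forests for a fixed matching *)

Section AlternatingForest.

Variables (T : finType) (e : rel T).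
Hypotheses (esym : symmetric e) (eirr : irreflexive e).
Variables (L : {set T}) (M : T -> T).
Hypotheses (mateM : mating e M) (LM : {in L, forall v, M v \in L}).

Let invM : involutive M := mateM.1.
Let eM v : M v != v -> e v (M v). Proof. exact: mateM.2. Qed.

Definition roots : {set T} := [set v in L | M v == v].

(** The inner vertices are those whose mate is a base; a root is its own mate and is outer. *)
Definition labelled (O C : {set T}) : {set T} :=
  [set v in L | (v \in O) || (M v \in C)].

Definition separating (C : {set T}) (S : T -> {set T}) x y : {set T} :=
  [set b in C | (x \in S b) != (y \in S b)].

(** For [W = C] all inner vertices are deleted and the region of an outer [v] is its blossom; for
    [W] the set of roots it is the tree of [v]. *)
Definition region (O C : {set T}) (S : T -> {set T}) (W : {set T}) v : {set T} :=
  [set t in labelled O C | ((t \in O) || (M t \notin W)) &&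
                           [forall b in W, (t \in S b) == (v \in S b)]].

(** [O] is the set of outer vertices.  A base [b] in [C] is either a root or the
    mate of the inner vertex [M b]; [S b] is the set of vertices below [M b] in
    the forest, respectively the tree with root [b].  Blossoms need no
    representation: two outer vertices are in the same blossom iff no [b] in [C]
    separates them.  Deleting the inner vertices [M b], [b] in [W], cuts the
    forest into regions, each of which can be matched perfectly after deletion
    of any outer vertex. *)
Record forest (O C : {set T}) (S : T -> {set T}) : Prop := Forest {
  forest_base : C \subset O;
  forest_alive : O \subset L;
  forest_roots : roots \subset C;
  forest_inner : {in C, forall b, M b != b -> M b \notin O};
  forest_outer : {in O, forall v, (M v \in O) || (v \in C)};
  forest_below : {in C, forall b, S b \subset labelled O C};
  forest_refl : {in C, forall b, b \in S b};
  forest_irr : {in C, forall b, M b != b -> M b \notin S b};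
  forest_mate : {in C, forall b, {in S b, forall t, t != b -> M t \in S b}};
  forest_trans : {in C &, forall b c, c \in S b -> S c \subset S b};
  forest_disj : {in C &, forall b c, c \notin S b -> b \notin S c ->
                   [disjoint S b & S c]};
  forest_anti : {in C &, forall b c, c \in S b -> b \in S c -> b = c};
  forest_top : {in C & roots, forall b r, r \in S b -> r = b};
  forest_pm : forall (W : {set T}) v, W \subset C -> roots \subset W -> v \in O ->
                pm e (region O C S W v :\ v)
}.

Lemma in_region (O C : {set T}) (S : T -> {set T}) (W : {set T}) v t :
  reflect [/\ t \in L, (t \in O) || (M t \in C), (t \in O) || (M t \notin W) &
              {in W, forall b, (t \in S b) = (v \in S b)}]
          (t \in region O C S W v).
Proof.
rewrite !inE; apply: (iffP idP).
  case/and3P=> /andP[tL tOC] tW /forall_inP eqS; split=> // b bW.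
  exact/eqP/eqS.
by case=> -> -> -> eqS; apply/forall_inP=> b bW; rewrite eqS.
Qed.

Lemma region_refl (O C : {set T}) (S : T -> {set T}) (W : {set T}) v : O \subset L -> v \in O -> v \in region O C S W v.
Proof. by move=> OL vO; apply/in_region; rewrite vO (subsetP OL). Qed.

Lemma forest_init (S : T -> {set T}) : {in roots, forall b, S b = [set b]} -> forest roots roots S.
Proof.
move=> defS.
have Rr v : v \in roots -> M v = v by rewrite inE => /andP[_ /eqP].
have SE b t : b \in roots -> (t \in S b) = (t == b) by move=> bR; rewrite defS // inE.
split=> //.
- by apply/subsetP=> v; rewrite inE => /andP[].
- by move=> b bR; rewrite (Rr b bR) eqxx.
- by move=> v vR; rewrite (Rr v vR) vR.
- move=> b bR; apply/subsetP=> v; rewrite SE // => /eqP->; apply/setIdP.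
  by rewrite bR; split=> //; case/setIdP: bR.
- by move=> b bR; rewrite SE.
- by move=> b bR; rewrite (Rr b bR) eqxx.
- by move=> b bR t; rewrite SE // => /eqP->; rewrite eqxx.
- by move=> b c bR cR; rewrite SE // => /eqP->.
- move=> b c bR cR; rewrite SE // => cb _; rewrite !defS // disjoints1 inE.
  by rewrite eq_sym.
- by move=> b c bR cR; rewrite SE // => /eqP.
- by move=> b r bR rR; rewrite SE // => /eqP.
- move=> W v WR RW vR; rewrite (_ : _ :\ v = set0); first exact: pm0.
  have {RW}WE : W = roots by apply/eqP; rewrite eqEsubset WR RW.
  apply/setP=> t; rewrite in_set0; apply/negbTE; apply/negP=> /setD1P[tv].
  case/in_region => tL tO _ /(_ v); rewrite WE vR !SE // eqxx (negPf tv).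
  by move=> /(_ isT).
Qed.

Section Grow.

Variables (O C : {set T}) (S : T -> {set T}) (p q : T).
Hypotheses (FS : forest O C S) (pO : p \in O) (qL : q \in L) (epq : e p q).
Hypotheses (qO : q \notin O) (MqC : M q \notin C).

Let m := M q.
Let CO : {subset C <= O} := subsetP (forest_base FS).
Let OL : {subset O <= L} := subsetP (forest_alive FS).
Let RC : {subset roots <= C} := subsetP (forest_roots FS).

Lemma grow_mate : M q != q.
Proof.
apply/eqP=> Mq; case/negP: qO; apply: CO; apply: RC.
by rewrite inE qL Mq eqxx.
Qed.

Lemma grow_new : M q \notin O.
Proof.
apply/negP=> mO; have := forest_outer FS mO.
by rewrite invM (negPf qO) (negPf MqC).
Qed.

Variable S' : T -> {set T}.
Hypothesis defS' : forall b t, b \in m |: C -> (t \in S' b) =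
  if b == m then t == m else
  if (t == q) || (t == m) then p \in S b else t \in S b.

Let SE b t : b \in C -> (t \in S' b) =
  if (t == q) || (t == m) then p \in S b else t \in S b.
Proof.
move=> bC; rewrite defS' ?inE ?bC ?orbT //.
by case: eqP => // bm; move: MqC; rewrite -/m -bm bC.
Qed.

Let Sm t : (t \in S' m) = (t == m).
Proof. by rewrite defS' ?inE eqxx. Qed.

Let labN b t : b \in C -> t \in S b -> (t == q) || (t == m) = false.
Proof.
move=> bC /(subsetP (forest_below FS bC)); rewrite inE => /andP[_].
apply: contraTF => /orP[]/eqP->; rewrite ?(negPf qO) ?(negPf MqC) //.
by rewrite invM (negPf grow_new); apply: contraNN qO; apply: CO.
Qed.

Let outN t : t \in O -> (t == q) || (t == m) = false.
Proof.
by apply: contraTF => /orP[]/eqP->; rewrite ?qO ?grow_new.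
Qed.

(** The new inner vertex [q] and its mate [m] hang from [p]: a base has them below it iff it has [p]
    below it, and below [m] there is only [m]. Old perfect matchings of regions are extended by the
    edge [qm], or by [pq] when [m] is the vertex left out. *)
Lemma forest_grow : forest (m |: O) (m |: C) S'.
Proof.
have SO b t : b \in C -> t \in O -> (t \in S' b) = (t \in S b).
  by move=> bC tO; rewrite SE // outN.
have SS b t : b \in C -> t \in S b -> t \in S' b.
  by move=> bC tS; rewrite SE // (labN bC).
have mq : m != q := grow_mate.
have mO : m \notin O := grow_new.
have Rm : m \notin roots by apply: contraNN MqC; apply: RC.
have Rq : q \notin roots by apply: contraNN qO => /RC/CO.
have CmF b : b \in C -> (b == m) = false.
  by move=> bC; apply/negbTE; apply: contraTneq bC => ->; apply: MqC.
have labE t : (t \in labelled (m |: O) (m |: C)) =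
    [|| t == q, t == m | t \in labelled O C].
  rewrite !inE (can2_eq invM invM) invM.
  have [->|tq] := eqVneq t q; first by rewrite qL orbT.
  have [->|tm] //= := eqVneq t m; first by rewrite LM.
split.
- by apply: setUS; apply: forest_base FS.
- by rewrite subUset sub1set LM //= (forest_alive FS).
- by apply: subset_trans (forest_roots FS) _; apply: subsetUr.
- move=> b /setU1P[->|bC] Mb.
    by rewrite invM !inE negb_or eq_sym mq.
  rewrite !inE negb_or (forest_inner FS bC Mb) andbT.
  by rewrite (can2_eq invM invM) invM; apply: contraNneq qO => <-; apply: CO.
- move=> v; rewrite !inE => /orP[/eqP->|vO]; first by rewrite eqxx orbT.
  by have /orP[->|->] := forest_outer FS vO; rewrite !orbT.
- move=> b /setU1P[->|bC]; apply/subsetP=> t; rewrite labE.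
    by rewrite Sm => /eqP->; rewrite eqxx orbT.
  rewrite SE //; case: eqP => //= _; case: eqP => //= _.
  exact: (subsetP (forest_below FS bC)).
- move=> b /setU1P[->|bC]; first by rewrite Sm.
  by rewrite SS // (forest_refl FS).
- move=> b /setU1P[->|bC] Mb.
    by rewrite invM Sm eq_sym.
  rewrite SE // (can2_eq invM invM) -/m (CmF _ bC) /=.
  rewrite (can2_eq invM invM) invM; case: eqP => [bq|_]; last exact: (forest_irr FS).
  by case/negP: qO; rewrite -bq CO.
- move=> b /setU1P[->|bC] t; first by rewrite Sm => ->.
  have [->|tq] := eqVneq t q; first by rewrite !SE // !eqxx orbT.
  have [->|tm] := eqVneq t m; first by rewrite invM !SE // !eqxx orbT.
  rewrite {1}SE // (negPf tq) (negPf tm) /= => tS tb.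
  by apply: SS => //; apply: (forest_mate FS).
- move=> b c /setU1P[->|bC] cC.
    by rewrite Sm => /eqP->; apply: subxx.
  move: cC => /setU1P[->|cC].
    move=> mS; apply/subsetP=> t; rewrite Sm => /eqP->; exact: mS.
  rewrite SO ?CO // => /(forest_trans FS bC cC)/subsetP sub.
  by apply/subsetP=> t; rewrite !SE //; case: ifP => _; apply: sub.
- move=> b c /setU1P[->|bC] cC.
    move=> _ mS; rewrite disjoint_subset; apply/subsetP=> t.
    by rewrite Sm => /eqP->; rewrite inE.
  move: cC => /setU1P[->|cC].
    move=> mS _; rewrite disjoint_sym disjoint_subset.
    by apply/subsetP=> t; rewrite Sm => /eqP->; rewrite inE.
  rewrite !SO ?CO // => cb bc; have dis := forest_disj FS bC cC cb bc.
  rewrite disjoint_subset; apply/subsetP=> t; rewrite inE !SE //.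
  by case: ifP => _ tb; rewrite (disjointFr dis tb).
- move=> b c /setU1P[->|bC] cC; first by rewrite Sm => /eqP->.
  move: cC => /setU1P[->|cC]; first by rewrite Sm => _ /eqP.
  by rewrite !SO ?CO //; apply: (forest_anti FS).
- move=> b r /setU1P[->|bC] rR; first by rewrite Sm => /eqP.
  by rewrite (SO _ _ bC (CO (RC rR))); apply: (forest_top FS).
move=> W v WC RW; rewrite !inE.
have WinC b : b \in W -> b != m -> b \in C.
  by move=> bW bm; move: (subsetP WC _ bW); rewrite !inE (negPf bm).
have eqm : e q m by apply: eM; rewrite -/m.
(* If [q] is deleted, [m] is alone in its region and the other regions are those of the old forest
   for [W :\ m]. *)
have [mW|mW] := boolP (m \in W).
  case/orP=> [/eqP->|vO].
    rewrite (_ : _ :\ m = set0); first exact: pm0.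
    apply/setP=> t; rewrite in_set0; apply/negbTE/negP=> /setD1P[tm].
    by case/in_region=> _ _ _ /(_ m mW); rewrite !Sm eqxx (negPf tm).
  pose W0 := W :\ m.
  rewrite (_ : region _ _ _ _ _ = region O C S W0 v).
    apply: (forest_pm FS) => //.
      by apply/subsetP=> b; rewrite !inE => /andP[bm bW]; apply: WinC.
    apply/subsetP=> r rR; rewrite !inE (subsetP RW _ rR) andbT.
    by apply: contraTneq rR => ->.
  have vm : (v == m) = false by have := outN vO; case: (v == m) => //; rewrite orbT.
  apply/setP=> t; apply/in_region/in_region.
    case=> tL tOC tOW eqS.
    have tm : (t == m) = false by rewrite -Sm (eqS m mW) Sm vm.
    have tq : (t == q) = false.
      by apply: contraTF tOW => /eqP->; rewrite -/m mW !inE eq_sym (negPf mq) (negPf qO).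
    split=> //.
    - by move: tOC; rewrite !inE tm (can2_eq invM invM) invM tq.
    - by move: tOW; rewrite !inE tm /=; case: (t \in O) => //= /negPf->; rewrite andbF.
    - move=> b; rewrite inE => /andP[]; rewrite inE => bm bW.
      by have := eqS b bW; rewrite !SE ?(WinC b) // tq tm outN.
  case=> tL tOC tOW eqS.
  have tm : (t == m) = false.
    by apply: contraTF tOC => /eqP->; rewrite invM (negPf mO); apply: contraNN qO; apply: CO.
  have tq : (t == q) = false.
    by apply: contraTF tOC => /eqP->; rewrite (negPf qO).
  split=> //.
  - by move: tOC; rewrite !inE tm (can2_eq invM invM) invM tq.
  - by move: tOW; rewrite !inE tm /= (can2_eq invM invM) invM tq.
  move=> b bW; have [->|bm] := eqVneq b m; first by rewrite !Sm tm vm.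
  by rewrite !SE ?(WinC b) // tq tm outN //; apply: eqS; rewrite !inE bm.
have WsubC : {subset W <= C}.
  by move=> b bW; apply: WinC => //; apply: contraNneq mW => <-.
(* If [q] is kept, the region of [p] gains [q] and [m], and every other region is unchanged. *)
have regE u w : u \in O -> (forall b, b \in W -> (w \in S' b) = (u \in S b)) ->
    region (m |: O) (m |: C) S' W w =
    if [forall b in W, (p \in S b) == (u \in S b)] then q |: (m |: region O C S W u)
    else region O C S W u.
  move=> uO wu; apply/setP=> t.
  have RE t' : t' != q -> t' != m ->
      (t' \in region (m |: O) (m |: C) S' W w) = (t' \in region O C S W u).
    move=> tq tm; apply/in_region/in_region => -[tL tOC tOW eqS]; split=> //.
    - by move: tOC; rewrite !inE (negPf tm) (can2_eq invM invM) invM (negPf tq).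
    - by move: tOW; rewrite !inE (negPf tm).
    - by move=> b bW; rewrite -wu // -eqS // SE ?WsubC // (negPf tq) (negPf tm).
    - by move: tOC; rewrite !inE (negPf tm) (can2_eq invM invM) invM (negPf tq).
    - by move: tOW; rewrite !inE (negPf tm).
    - by move=> b bW; rewrite wu // -eqS // SE ?WsubC // (negPf tq) (negPf tm).
  have RN t' : (t' == q) || (t' == m) ->
     (t' \in region (m |: O) (m |: C) S' W w) =
       [forall b in W, (p \in S b) == (u \in S b)].
    move=> t'E; apply/in_region/forall_inP=> [[_ _ _ eqS] b bW|eqS].
      by rewrite -wu // -eqS // SE ?WsubC // t'E.
    split=> [||| b bW].
    - by case/orP: t'E => /eqP->; rewrite ?qL ?LM.
    - by case/orP: t'E => /eqP->; rewrite !inE eqxx ?orbT.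
    - by case/orP: t'E => /eqP->; rewrite !inE ?eqxx // mW orbT.
    - by rewrite SE ?WsubC // t'E wu //; apply/eqP/eqS.
  have RO t' : (t' == q) || (t' == m) -> t' \in region O C S W u = false.
    move=> t'E; apply/negbTE/negP=> /in_region[_ tOC _ _]; move: tOC.
    case/orP: t'E => /eqP->; rewrite ?(negPf qO) ?(negPf MqC) //.
    by rewrite invM (negPf mO) /=; apply/negP; apply: contraNN qO; apply: CO.
  have [tE|] := boolP ((t == q) || (t == m)).
    rewrite RN //; case: ifP => _; last by rewrite RO.
    by rewrite !inE orbA tE.
  rewrite negb_or => /andP[tq tm]; rewrite RE //.
  by case: ifP => _ //; rewrite !inE (negPf tq) (negPf tm).
have qR u : q \notin region O C S W u.
  by apply/negP=> /in_region[_]; rewrite (negPf qO) (negPf MqC).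
have mR u : m \notin region O C S W u.
  apply/negP=> /in_region[_]; rewrite invM (negPf mO) /= => qC.
  by case/negP: qO; apply: CO.
have WC' : W \subset C by apply/subsetP.
case/orP=> [/eqP->|vO].
  rewrite (regE p) // => [|b bW]; last by rewrite SE ?WsubC // eqxx orbT.
  rewrite (_ : [forall b in W, _] = true); last by apply/forall_inP.
  have pp : p \in region O C S W p by apply: region_refl => //; apply: forest_alive FS.
  have pq : p != q by apply: contraNneq qO => <-.
  have pm' : p != m by apply: contraNneq mO => <-.
  (* With [m] left out, [q] is matched to [p], and the old region of [p] has a perfect matching
     without [p]. *)
  rewrite (_ : _ :\ m = p |: (q |: (region O C S W p :\ p))).
    apply: pmS => //; last exact: (forest_pm FS).
      by rewrite in_setD1 eqxx.
    by rewrite in_setD1 (negPf (qR p)) andbF.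
  apply/setP=> t; rewrite !in_setD1 !in_setU1 in_setD1.
  have [->|tm] /= := eqVneq t m.
    by rewrite eq_sym (negPf pm') (negPf mq) (negPf (mR p)).
  by have [->|tp] //= := eqVneq t p; rewrite (negPf pq) pp.
rewrite (regE v) // => [|b bW]; last by rewrite SE ?WsubC // outN.
case: ifP => _; last exact: (forest_pm FS).
have [vq vm] : v != q /\ v != m by apply/andP; rewrite -negb_or outN.
rewrite (_ : _ :\ v = q |: (m |: (region O C S W v :\ v))).
  apply: pmS => //; last exact: (forest_pm FS).
    by rewrite in_setD1 (negPf (qR v)) andbF.
  by rewrite in_setD1 (negPf (mR v)) andbF.
apply/setP=> t; rewrite !in_setD1 !in_setU1 in_setD1.
have [->|_] := eqVneq t v; last by [].
by rewrite (negPf vq) (negPf vm).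
Qed.

End Grow.

Section Shrink.

Variables (O C : {set T}) (S : T -> {set T}) (x y : T).
Hypotheses (FS : forest O C S) (xO : x \in O) (yO : y \in O) (exy : e x y).

Let Z := separating C S x y.
Let CO : {subset C <= O} := subsetP (forest_base FS).
Let OL : {subset O <= L} := subsetP (forest_alive FS).
Let RC : {subset roots <= C} := subsetP (forest_roots FS).

Let newO : {set T} := O :|: [set t | M t \in Z].

(** The inner vertices that disappear with the bases in [Z] are exactly those that become outer. *)
Lemma labelled_shrink : labelled newO (C :\: Z) = labelled O C.
Proof.
apply/setP=> t; rewrite !inE; case: (t \in L) => //=.
by case: (t \in O) => //=; case: (M t \in C); rewrite ?andbT ?andbF ?orbF ?orbN.
Qed.

(** Before the blossom is shrunk, [v] was an inner vertex and [x], [y] were on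
    different sides of it: deleting [v] leaves the two regions of [x] and [y],
    and the edge [xy] joins the perfect matchings that avoid [x] and [y]. *)
Lemma pm_shrink_inner (W : {set T}) v : W \subset C :\: Z -> roots \subset W ->
  v \notin O -> M v \in Z -> pm e (region O C S W v :\ v).
Proof.
have gen u w : u \in O -> w \in O -> e u w ->
    (forall b, b \in W -> b \in C -> (u \in S b) = (w \in S b)) ->
    W \subset C -> roots \subset W -> v \notin O -> M v \in C ->
    M v \notin W -> u \in S (M v) -> w \notin S (M v) ->
    pm e (region O C S W v :\ v).
  move=> uO wO euw uw WC RW vO cC cW uc wc; set c := M v in cC cW uc wc *.
  have vc : M c = v by rewrite /c invM.
  have vcN : v != c by apply: contraNneq vO => ->; apply: CO.
  have vSc : v \notin S c by rewrite -vc; apply: (forest_irr FS) => //; rewrite vc.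
  (* The sets [S b] are laminar: one that contains [u] but not [c] would lie inside [S c]. As [b]
     does not separate [u] from [w], it would also contain [w], which is outside [S c]. *)
  have same b : b \in W -> (u \in S b) = (v \in S b) /\ (w \in S b) = (v \in S b).
    move=> bW; have bC := subsetP WC b bW; rewrite -(uw b bW bC).
    have bc : b != c by apply: contraTneq bW => ->.
    have vcE : (v \in S b) = (c \in S b).
      apply/idP/idP => [vb|cb]; last first.
        by rewrite -vc; apply: (forest_mate FS); rewrite // eq_sym.
      rewrite /c; apply: (forest_mate FS) => //.
      by apply: contraNneq vO => ->; apply: CO.
    suff -> : (u \in S b) = (v \in S b) by [].
    rewrite vcE; apply/idP/idP=> [ub|/(forest_trans FS bC cC)/subsetP]; last exact.
    apply/negPn/negP=> cb; have [bc'|bc'] := boolP (b \in S c).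
      have /subsetP sub := forest_trans FS cC bC bc'.
      by move: wc; rewrite sub // -uw.
    have dis := forest_disj FS bC cC cb bc'.
    by rewrite (disjointFr dis ub) in uc.
  have Wc : c |: W \subset C by rewrite subUset sub1set cC WC.
  have Rc : roots \subset c |: W by apply: subset_trans RW (subsetUr _ _).
  have pu := forest_pm FS Wc Rc uO; have pw := forest_pm FS Wc Rc wO.
  have sep t : t \in region O C S (c |: W) u -> t \in region O C S (c |: W) w -> False.
    move=> /in_region[_ _ _ /(_ c (setU11 c W))] tu.
    by move=> /in_region[_ _ _ /(_ c (setU11 c W))]; rewrite tu uc (negPf wc).
  have uR : u \in region O C S (c |: W) u by apply: region_refl => //; apply: forest_alive FS.
  have wR : w \in region O C S (c |: W) w by apply: region_refl => //; apply: forest_alive FS.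
  have vR z : v \notin region O C S (c |: W) z.
    by apply/negP=> /in_region[_ _]; rewrite (negPf vO) setU11.
  have regE t : t != v -> (t \in region O C S W v) =
      (t \in region O C S (c |: W) u) || (t \in region O C S (c |: W) w).
    move=> tv; apply/in_region/orP.
      case=> tL tOC tOW eqS.
      have tOW' : (t \in O) || (M t \notin c |: W).
        case/orP: tOW => [->//|tW]; rewrite !inE negb_or tW andbT.
        by rewrite (can2_eq invM invM) vc tv orbT.
      have [tc|tc] := boolP (t \in S c); [left|right]; apply/in_region; split=> //.
        move=> b /setU1P[->|bW]; first by rewrite tc uc.
        by rewrite eqS // (same b bW).1.
      move=> b /setU1P[->|bW]; first by rewrite (negPf tc) (negPf wc).
      by rewrite eqS // (same b bW).2.
    case=> /in_region[tL tOC tOW eqS]; split=> //.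
    - by case/orP: tOW => [->//|]; rewrite !inE negb_or => /andP[_ ->]; rewrite orbT.
    - by move=> b bW; rewrite eqS ?inE ?bW ?orbT // (same b bW).1.
    - by case/orP: tOW => [->//|]; rewrite !inE negb_or => /andP[_ ->]; rewrite orbT.
    - by move=> b bW; rewrite eqS ?inE ?bW ?orbT // (same b bW).2.
  rewrite (_ : _ :\ v = u |: (w |: (region O C S (c |: W) u :\ u
                                     :|: region O C S (c |: W) w :\ w))).
    apply: pmS => //.
    - rewrite in_setU !in_setD1 eqxx /= negb_and.
      by apply/orP; right; apply/negP=> /(sep u uR).
    - rewrite in_setU !in_setD1 eqxx /= orbF negb_and.
      by apply/orP; right; apply/negP=> /(sep w)/(_ wR).
    apply: pmU => //; rewrite disjoint_subset; apply/subsetP=> t.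
    rewrite in_setD1 => /andP[_ tu]; rewrite inE /= in_setD1 negb_and.
    by apply/orP; right; apply/negP=> /(sep t tu).
  apply/setP=> t; rewrite in_setD1 !in_setU1 in_setU !in_setD1.
  have [->|tv] /= := eqVneq t v.
    rewrite !(negPf (vR _)) !andbF !orbF; symmetry; apply/negbTE.
    by rewrite negb_or; apply/andP; split; apply: contraNneq vO => ->.
  rewrite regE //; have [->|_] /= := eqVneq t u; first by rewrite uR.
  by have [->|_] //= := eqVneq t w; rewrite wR orbT.
move=> WCZ RW vO; rewrite inE => /andP[cC cZ].
have [WC WZ] : W \subset C /\ forall b, b \in W -> (x \in S b) = (y \in S b).
  split=> [|b bW]; first exact: subset_trans WCZ (subsetDl _ _).
  have := subsetP WCZ b bW; rewrite !inE negb_and => /andP[+ bC].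
  by rewrite bC /= negbK => /eqP.
have cW : M v \notin W.
  by apply: contraNN cZ => /WZ ->.
have [xc|xc] := boolP (x \in S (M v)).
  apply: (gen x y) => //; first by move=> b bW _; apply: WZ.
  by move: cZ; rewrite xc; case: (y \in _).
apply: (gen y x) => //; first by rewrite esym.
  by move=> b bW _; rewrite WZ.
by move: cZ; rewrite (negPf xc); case: (y \in _).
Qed.

Hypothesis Zroots : {in Z, forall b, M b != b}.

(** [S] stays as it is and merely has fewer bases, so all conditions but the last are inherited.
    Regions do not change either; what is new is that a former inner vertex may be left out, which
    is [pm_shrink_inner]. By [Zroots], no root separates [x] from [y]. *)
Lemma forest_shrink : forest (O :|: [set t | M t \in separating C S x y])
                        (C :\: separating C S x y) S.
Proof.
have CC b : b \in C :\: Z -> b \in C by rewrite inE => /andP[].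
have ZC b : b \in Z -> b \in C by rewrite inE => /andP[].
rewrite -/Z -/newO; split.
- by apply/subsetP=> b /CC/CO bO; rewrite inE bO.
- rewrite subUset (forest_alive FS); apply/subsetP=> t; rewrite inE => /ZC/CO/OL.
  by move/LM; rewrite invM.
- apply/subsetP=> r rR; rewrite in_setD RC // andbT.
  apply/negP=> /Zroots; move: rR; rewrite inE => /andP[_ /eqP->].
  by rewrite eqxx.
- move=> b /setDP[bC bZ] Mb.
  by rewrite in_setU inE invM negb_or (forest_inner FS bC Mb) bZ.
- move=> v /setUP[vO|]; last by rewrite inE => /ZC/CO MO; rewrite in_setU MO.
  rewrite in_setU (in_set (fun t => M t \in Z)) invM in_setD.
  case/orP: (forest_outer FS vO) => [->//|vC].
  by rewrite vC andbT -orbA orbN orbT.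
- by move=> b /CC bC; rewrite labelled_shrink; apply: (forest_below FS).
- by move=> b /CC; apply: (forest_refl FS).
- by move=> b /CC; apply: (forest_irr FS).
- by move=> b /CC; apply: (forest_mate FS).
- by move=> b c /CC bC /CC; apply: (forest_trans FS bC).
- by move=> b c /CC bC /CC; apply: (forest_disj FS bC).
- by move=> b c /CC bC /CC; apply: (forest_anti FS bC).
- by move=> b r /CC bC; apply: (forest_top FS bC).
move=> W v WC RW vO.
have -> : region newO (C :\: Z) S W v = region O C S W v.
  rewrite /region labelled_shrink; apply/setP=> t; rewrite !in_set.
  congr (_ && (_ && _)).
  case: (t \in O) => //=; case tW: (M t \in W); last by rewrite orbT.
  by have := subsetP WC _ tW; rewrite !inE => /andP[/negPf->].
have [vO'|vO'] := boolP (v \in O).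
  by apply: (forest_pm FS) => //; apply: subset_trans WC (subsetDl _ _).
apply: pm_shrink_inner => //.
by move: vO; rewrite in_setU (negPf vO') inE.
Qed.

End Shrink.

(** The root [r] puts [x] and [y] into different trees. Without [x] and [y] these trees have perfect
    matchings, the edge [xy] completes them, and all covered vertices outside keep their mates. *)
Lemma forest_found (O C : {set T}) (S : T -> {set T}) x y r :
  forest O C S -> x \in O -> y \in O -> e x y ->
  r \in separating C S x y -> M r = r ->
  exists K : {set T}, [/\ K \subset L, pm e K & #|L :\: roots| < #|K|].
Proof.
move=> FS.
have CO : {subset C <= O} := subsetP (forest_base FS).
have OL : {subset O <= L} := subsetP (forest_alive FS).
have RC : {subset roots <= C} := subsetP (forest_roots FS).
have gen u w : u \in O -> w \in O -> e u w -> r \in C -> M r = r ->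
    u \in S r -> w \notin S r ->
    exists K : {set T}, [/\ K \subset L, pm e K & #|L :\: roots| < #|K|].
  move=> uO wO euw rC Mr ur wr.
  have rR : r \in roots by rewrite inE Mr eqxx OL ?CO.
  pose A := region O C S roots u; pose B := region O C S roots w.
  have pA := forest_pm FS (forest_roots FS) (subxx _) uO.
  have pB := forest_pm FS (forest_roots FS) (subxx _) wO.
  have uA : u \in A by apply: region_refl => //; apply: forest_alive FS.
  have wB : w \in B by apply: region_refl => //; apply: forest_alive FS.
  have dAB t : t \in A -> t \in B -> False.
    move=> /in_region[_ _ _ /(_ r rR)] tu /in_region[_ _ _ /(_ r rR)].
    by rewrite tu ur (negPf wr).
  have pAB : pm e (A :|: B).
    rewrite (_ : _ :|: _ = u |: (w |: (A :\ u :|: B :\ w))).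
      apply: pmS => //.
      - by rewrite in_setU !in_setD1 eqxx /= negb_and; apply/orP; right; apply/negP=> /(dAB u uA).
      - rewrite in_setU !in_setD1 eqxx /= orbF negb_and.
        by apply/orP; right; apply/negP=> /(dAB w)/(_ wB).
      apply: pmU => //; rewrite disjoint_subset; apply/subsetP=> t.
      rewrite in_setD1 => /andP[_ tu]; rewrite inE /= in_setD1 negb_and.
      by apply/orP; right; apply/negP=> /(dAB t tu).
    apply/setP=> t; rewrite !in_setU1 !in_setU !in_setD1.
    have [->|_] /= := eqVneq t u; first by rewrite uA.
    by have [->|_] //= := eqVneq t w; rewrite wB orbT.
  have ABL t : t \in A :|: B -> t \in L by rewrite in_setU => /orP[] /in_region[].
  have AM z t : t \in L -> t \notin roots -> t \in region O C S roots z ->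
      M t \in region O C S roots z.
    move=> tL tR /in_region[_ tOC _ eqS]; have Mt : M t != t by move: tR; rewrite inE tL.
    apply/in_region; split=> [|||b bR]; first exact: LM.
    - rewrite invM; case/orP: tOC => [tO|/CO->//].
      exact: (forest_outer FS tO).
    - rewrite invM; apply/orP; right.
      by move: tR; rewrite !inE tL.
    - have Mb : M b = b by move: bR; rewrite inE => /andP[_ /eqP].
      have bC := RC b bR.
      have tb : t != b by apply: contraNneq tR => ->.
      rewrite -eqS //; apply/idP/idP=> [|/(forest_mate FS bC)->//] Mtb.
      rewrite -[t]invM; apply: (forest_mate FS) => //.
      by rewrite (can2_eq invM invM) Mb.
  pose D := L :\: roots :\: (A :|: B).
  have pD : pm e D.
    apply: (pm_mating mateM) => t /setDP[/setDP[tL tR]].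
    rewrite in_setU negb_or => /andP[tA tB].
    have Mt : M t != t by move: tR; rewrite inE tL.
    have MtR : M t \notin roots by rewrite inE invM eq_sym negb_and Mt orbT.
    split=> //; apply/setDP; split; first by apply/setDP; rewrite LM.
    rewrite in_setU negb_or; apply/andP; split.
      by apply: contraNN tA => /AM; rewrite invM; apply=> //; apply: LM.
    by apply: contraNN tB => /AM; rewrite invM; apply=> //; apply: LM.
  have dD : [disjoint A :|: B & D].
    by rewrite disjoint_subset; apply/subsetP=> t tAB; rewrite inE /= in_setD tAB.
  have rA : r \in A.
    apply/in_region; split=> [|||b bR].
    - exact/OL/CO.
    - by rewrite CO.
    - by rewrite CO.
    have [->|br] := eqVneq b r; first by rewrite ur (forest_refl FS).
    have rb : r \notin S b.
      apply/negP=> /(forest_top FS (RC b bR) rR) E; by rewrite E eqxx in br.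
    have br' : b \notin S r.
      apply/negP=> /(forest_top FS (RC r rR) bR) E; by rewrite E eqxx in br.
    have dis := forest_disj FS (RC b bR) rC rb br'.
    by rewrite (negPf rb) (disjointFl dis ur).
  exists (A :|: B :|: D); split.
  - apply/subsetP=> t; rewrite in_setU => /orP[/ABL//|/setDP[/setDP[]//]].
  - exact: pmU.
  (* The new set contains every covered vertex and, in addition, the root [r]. *)
  rewrite (cardsD1 r (L :\: roots)) in_setD rR /= add0n.
  rewrite (cardsD1 r (A :|: B :|: D)) !in_setU rA /= add1n ltnS.
  apply: subset_leq_card; apply: setSD; apply/subsetP=> t tLR.
  by rewrite in_setU /D in_setD tLR andbT orbN.
move=> xO yO exy; rewrite inE => /andP[rC sep] Mr.
have [xr|xr] := boolP (x \in S r).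
  by apply: (gen x y) => //; move: sep; rewrite xr; case: (y \in _).
by apply: (gen y x); rewrite 1?esym //; move: sep; rewrite (negPf xr); case: (y \in _).
Qed.

(** No move is left: an edge at an outer vertex ends in the same blossom or at an inner vertex. *)
Definition forest_closed (O C : {set T}) (S : T -> {set T}) : Prop :=
  forall x y, x \in O -> y \in L -> e x y ->
    if y \in O then separating C S x y = set0 else M y \in C.

(** The inner vertices form a barrier [A] and the blossoms are odd. By [pm_barrier] at most [#|A|]
    blossoms meet [K] in an odd number of vertices; each of the others has a vertex outside [K].
    There are at least as many blossoms as inner vertices and roots together, so [K] misses at least
    as many vertices as there are roots. *)
Lemma forest_max (O C : {set T}) (S : T -> {set T}) (K : {set T}) :
  forest O C S -> forest_closed O C S ->
  K \subset L -> pm e K -> #|K| <= #|L :\: roots|.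
Proof.
move=> FS cl KL pK.
have CO : {subset C <= O} := subsetP (forest_base FS).
have OL : {subset O <= L} := subsetP (forest_alive FS).
have RC : {subset roots <= C} := subsetP (forest_roots FS).
pose F b := region O C S C b.
pose A := [set t in L | (t \notin O) && (M t \in C)].
have FO b t : t \in F b -> t \in O.
  by case/in_region=> _ tOC + _; case/orP: tOC => [//|->]; rewrite orbF.
have FF b : b \in C -> b \in F b.
  by move=> bC; apply: region_refl; [exact: forest_alive FS | exact: CO].
have Fdis : {in C &, forall b c, b != c -> [disjoint F b & F c]}.
  move=> b c bC cC bc; rewrite disjoint_subset; apply/subsetP=> t.
  case/in_region=> _ _ _ tb; rewrite inE /=; apply/negP=> /in_region[_ _ _ tc].
  case/eqP: bc; apply: (forest_anti FS) => //.
    by rewrite -tc // tb // (forest_refl FS).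
  by rewrite -tb // tc // (forest_refl FS).
have FA : {in C, forall b, [disjoint F b & A]}.
  move=> b bC; rewrite disjoint_subset; apply/subsetP=> t /FO tO.
  by rewrite inE /= inE tO andbF.
have Fe b x y : b \in C -> x \in F b -> e x y -> y \in L -> y \in F b :|: A.
  move=> bC xF exy yL; have xO := FO _ _ xF; have := cl x y xO yL exy.
  rewrite in_setU [y \in A]inE yL; case: ifP => yO; last by move=> ->; rewrite orbT.
  move=> /setP eqS; rewrite orbF; case/in_region: xF => _ _ _ xb.
  apply/in_region; split=> [//|||c cC]; rewrite ?yO //.
  by rewrite -xb //; have := eqS c; rewrite !inE cC /= => /negbFE/eqP.
have cardC := pm_barrier esym eirr Fdis FA Fe KL pK.
(* [M] maps the inner vertices injectively to bases that are not roots. *)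
have cardA : #|A| + #|roots| <= #|C|.
  rewrite -(card_imset A (inv_inj invM)) -(cardsID roots C) addnC.
  rewrite (setIidPr (forest_roots FS)) leq_add2l; apply: subset_leq_card.
  apply/subsetP=> _ /imsetP[t + ->]; rewrite inE => /and3P[tL tO tC].
  rewrite in_setD tC andbT inE invM negb_and eq_sym; apply/orP; right.
  by apply: contraNneq tO => <-; apply: CO.
pose B := [set b in C | ~~ odd #|F b :&: K|].
(* A blossom is perfectly matched once its base is removed, hence odd; if it meets [K] evenly, [f]
   finds a vertex of it outside [K]. For [b] in [B] the default of [odflt] does not occur. *)
have cardB : #|B| <= #|L :\: K|.
  pose f b := odflt b [pick t in F b :\: K].
  have fP b : b \in B -> f b \in F b :\: K.
    rewrite inE /f => /andP[bC]; case: pickP => [//|F0]; case/negP.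
    rewrite (setIidPl _); last first.
      apply/subsetP=> t tF; have := F0 t; rewrite in_setD tF andbT.
      by move/negbFE.
    have := pm_odd eirr (forest_pm FS (subxx _) (forest_roots FS) (CO _ bC)).
    by rewrite (cardsD1 b (F b)) FF.
  have fI : {in B &, injective f}.
    move=> b c bB cB E; apply/eqP/idPn=> bc.
    have [bC cC] : b \in C /\ c \in C by move: bB cB; rewrite !inE => /andP[-> _] /andP[-> _].
    have /setDP[fb _] := fP b bB; have /setDP[fc _] := fP c cB.
    by have := disjointFr (Fdis _ _ bC cC bc) fb; rewrite E fc.
  rewrite -(card_in_imset fI); apply: subset_leq_card.
  apply/subsetP=> _ /imsetP[b /fP/setDP[fb fK] ->].
  by rewrite in_setD fK OL // (FO b).
have splitC : #|C| = #|[set b in C | odd #|F b :&: K|]| + #|B|.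
  rewrite -(cardsID [set b | odd #|F b :&: K|] C); congr (_ + _).
    by apply: eq_card=> b; rewrite !inE.
  by apply: eq_card=> b; rewrite !inE andbC.
have RLK : #|roots| <= #|L :\: K|.
  apply: leq_trans cardB; rewrite -(leq_add2l #|A|).
  apply: leq_trans cardA _; rewrite splitC leq_add2r.
  by apply: leq_trans cardC (subset_leq_card (subsetIl _ _)).
have RL : roots \subset L by apply/subsetP=> t; rewrite inE => /andP[].
rewrite -(leq_add2r #|roots|) [X in _ <= X]addnC -{2}(setIidPr RL) cardsID.
by rewrite -(cardsID K L) (setIidPr KL) leq_add2l.
Qed.

End AlternatingForest.

(** * Augmentation by self-reduction *)

Section Augmentation.

Variables (T : finType) (e : rel T).
Hypotheses (esym : symmetric e) (eirr : irreflexive e).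

Definition covered (L : {set T}) (M : T -> T) : {set T} :=
  [set v in L | M v != v].

Definition improvable (L : {set T}) (M : T -> T) : Prop :=
  exists K : {set T}, [/\ K \subset L, pm e K & #|covered L M| < #|K|].

Definition closed_mate (L : {set T}) (M : T -> T) : Prop :=
  mating e M /\ {in L, forall v, M v \in L}.

(** One formula for both moves: if [u] is matched, its mate becomes exposed in place of [x]; if [u]
    is exposed, the edge [xu] is added. *)
Definition rematch (M : T -> T) x u : T -> T :=
  fun v => if v == x then u else if v == u then x else if v == M u then v else M v.

Lemma coveredE L M : covered L M = L :\: roots L M.
Proof. by apply/setP=> v; rewrite !inE; case: (v \in L); rewrite ?andbF ?andbT. Qed.

Section Rematch.

Variables (L : {set T}) (M : T -> T) (x u : T).
Hypotheses (ML : closed_mate L M) (xL : x \in L) (uL : u \in L).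
Hypotheses (Mx : M x = x) (exu : e x u).

Let invM : involutive M := ML.1.1.

Let xu : x != u. Proof. by apply: contraTneq exu => ->; rewrite eirr. Qed.

Lemma rematch_mating : mating e (rematch M x u).
Proof.
have [[_ eM] _] := ML.
have Mux : M u != x by rewrite (can2_eq invM invM) Mx eq_sym.
split=> v; rewrite /rematch.
  have [->|vx] := eqVneq v x; first by rewrite eq_sym (negPf xu) eqxx.
  have [->|vu] := eqVneq v u; first by rewrite eqxx.
  have [E|vw] := eqVneq v (M u); first by rewrite (negPf vx) (negPf vu) E eqxx.
  rewrite (can2_eq invM invM) Mx (negPf vx) (can2_eq invM invM) (negPf vw).
  by rewrite (inj_eq (inv_inj invM)) (negPf vu) invM.
have [->|vx] := eqVneq v x; first by [].
have [->|vu] := eqVneq v u; first by rewrite esym.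
by have [_|vw] := eqVneq v (M u); [rewrite eqxx | apply: eM].
Qed.

Lemma rematch_closed : closed_mate (L :\ x :\ u) (rematch M x u).
Proof.
split; first exact: rematch_mating.
move=> v; rewrite !inE /rematch => /and3P[vu vx vL].
rewrite (negPf vx) (negPf vu); have [_|vw] := eqVneq v (M u); first by rewrite vu vx.
by rewrite !(can2_eq invM invM) Mx vx vw ML.2.
Qed.

Lemma rematch_same : closed_mate L (rematch M x u).
Proof.
split; first exact: rematch_mating.
move=> v vL; rewrite /rematch; case: ifP => // _; case: ifP => // _.
by case: ifP => // _; apply: ML.2.
Qed.

Lemma covered_rematch : M u != u ->
  #|covered (L :\ x :\ u) (rematch M x u)|.+2 = #|covered L M|.
Proof.
move=> Mu; rewrite (cardsD1 u (covered L M)) inE uL Mu.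
rewrite (cardsD1 (M u) (covered L M :\ u)) !inE Mu ML.2 // invM (eq_sym u) Mu /= !add1n.
congr _.+2; apply: eq_card => v; rewrite !inE /rematch.
have [->|vu] := eqVneq v u; first by rewrite !andbF.
have [->|vx] /= := eqVneq v x; first by rewrite Mx eqxx !andbF.
by have [->|vw] := eqVneq v (M u); rewrite ?eqxx ?andbF.
Qed.

(** Here the rotation is seen in the whole graph: [x] becomes covered and [M u] exposed, so
    narrowing the search costs no matching edge. *)
Lemma covered_rematch_same : M u != u ->
  #|covered L (rematch M x u)| = #|covered L M|.
Proof.
move=> Mu; rewrite -covered_rematch //.
have ux : u != x by rewrite eq_sym.
rewrite (cardsD1 x) inE xL /rematch eqxx ux /= add1n; congr _.+1.
rewrite (cardsD1 u) !inE uL ux (negPf ux) eqxx xu /= add1n; congr _.+1.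
by apply: eq_card => v; rewrite !inE -!andbA.
Qed.

Lemma covered_match : M u = u ->
  #|covered L (rematch M x u)| = #|covered L M|.+2.
Proof.
move=> Mu.
have ux : u != x by rewrite eq_sym.
rewrite (cardsD1 x) inE xL /rematch eqxx ux /= add1n; congr _.+1.
rewrite (cardsD1 u) !inE uL ux (negPf ux) eqxx xu /= add1n; congr _.+1.
apply: eq_card => v; rewrite !inE.
have [->|vu] := eqVneq v u; first by rewrite Mu eqxx !andbF.
have [->|vx] /= := eqVneq v x; first by rewrite Mx eqxx !andbF.
by rewrite Mu (negPf vu).
Qed.

End Rematch.

(** A larger set [K] contains an exposed vertex [x]; let [u] be its partner in [K]. Deleting [x] and
    [u] takes two vertices from [K], and two from the covered set, namely [u] and [M u], so the gap
    remains. *)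
Lemma improvable_step L M : closed_mate L M -> improvable L M ->
  exists x u, [/\ x \in L, u \in L, M x = x, e x u &
    M u != u -> improvable (L :\ x :\ u) (rematch M x u)].
Proof.
move=> ML [K [KL pK cK]].
have /subsetPn[x xK xC] : ~~ (K \subset covered L M).
  by apply: contraTN cK => /subset_leq_card; rewrite -leqNgt.
have xL := subsetP KL _ xK.
have Mx : M x = x by apply/eqP; move: xC; rewrite inE xL negbK.
have [u [exu uK pKxu]] := pm_edge esym eirr pK xK.
have uL := subsetP KL _ uK.
exists x, u; split=> // Mu; exists (K :\ x :\ u); split=> //.
  by do 2!apply: setSD.
rewrite -(ltn_add2l 2) !add2n covered_rematch //.
have ux : u != x by apply: contraTneq exu => ->; rewrite eirr.
by move: cK; rewrite (cardsD1 x K) xK (cardsD1 u (K :\ x)) !inE ux uK.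
Qed.

End Augmentation.

(** * Partitions into cliques *)

Section CliquePartition.

Variables (T : finType) (e : rel T).
Hypotheses (esym : symmetric e) (eirr : irreflexive e).

Definition clique (Q : {set T}) : Prop := {in Q &, forall u v, u != v -> e u v}.

(** Colour classes are cliques: [e] is the complement of the graph to be coloured. *)
Definition achievable (U : {set T}) (s : nat) : Prop :=
  exists c : T -> nat, [/\ {in U, forall v, 0 < c v},
    {in U &, forall u v, u != v -> c u = c v -> e u v} & \sum_(v in U) c v = s].

(** [Q] becomes the first class and all other colours go up by one, which costs one for every vertex
    of [U]. *)
Lemma achievable_add (U Q : {set T}) s : Q \subset U -> clique Q ->
  achievable (U :\: Q) s -> achievable U (#|U| + s).
Proof.
move=> QU clQ [c [c0 ce <-]]; exists (fun v => if v \in Q then 1 else (c v).+1).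
split=> [v _|u v uU vU uv|]; first by case: ifP.
  case: ifP => uQ; case: ifP => vQ //.
  - by move=> _; apply: clQ.
  - by case=> c_v; have := c0 v; rewrite inE vQ vU -c_v => /(_ isT).
  - by case=> c_u; have := c0 u; rewrite inE uQ uU c_u => /(_ isT).
  by case=> cuv; apply: ce; rewrite // inE ?uQ ?vQ.
rewrite (big_setID Q) /= (setIidPr QU).
rewrite (eq_bigr (fun=> 1)) => [|v ->//].
rewrite sum1_card (eq_bigr (fun v => 1 + c v)) => [|v /setDP[_ /negPf->]//].
by rewrite big_split /= sum1_card addnA cardsD (setIidPr QU) subnKC // subset_leq_card.
Qed.

Definition triangle_free (U : {set T}) : Prop :=
  forall Q : {set T}, Q \subset U -> clique Q -> #|Q| <= 2.

(** Among [m] vertices, [m - (t + minn t p)] remain after [t] classes when the first [p] classes are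
    pairs and the later ones singletons; the total over [t] is the sum of the colours. Peeling off
    the first pair gives the recursion. *)
Lemma sum_pairs_rec N m p :
  \sum_(t < N.+1) (m.+2 - (t + minn t p.+1)) =
  m.+2 + \sum_(t < N) (m - (t + minn t p)).
Proof.
rewrite big_ord_recl /= subn0; congr (_ + _); apply: eq_bigr => t _.
by rewrite /= minnSS addSn addnS !subSS.
Qed.

Lemma sum_singles_rec N m :
  \sum_(t < N.+1) (m.+1 - (t + minn t 0)) =
  m.+1 + \sum_(t < N) (m - (t + minn t 0)).
Proof.
by rewrite big_ord_recl /= subn0; congr (_ + _); apply: eq_bigr => t _; rewrite !minn0.
Qed.

(** Colour the edges of the matching first, two vertices per colour. *)
Lemma achievable_pm (K U : {set T}) N : pm e K -> K \subset U -> #|U| <= N ->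
  achievable U (\sum_(t < N) (#|U| - (t + minn t #|K|./2))).
Proof.
move=> pK; elim: pK U N => [|x y {}K exy xK yK pK IH] U N KU.
  rewrite cards0; elim: N U {KU} => [|N IH] U UN.
    rewrite big_ord0; exists (fun=> 1); split=> //.
    - by move=> u; move: UN; rewrite leqn0 cards_eq0 => /eqP->; rewrite inE.
    - by move: UN; rewrite leqn0 cards_eq0 => /eqP->; rewrite big_set0.
  have [U0|[x xU]] := set_0Vmem U.
    rewrite U0 cards0 big1 => [|t _]; last by rewrite sub0n.
    by exists (fun=> 1); split=> // [u|]; rewrite ?inE // big_set0.
  have UE : #|U| = #|U :\: [set x]|.+1 by rewrite (cardsD1 x) xU.
  rewrite {1}UE sum_singles_rec -UE; apply: (@achievable_add _ [set x]).
  - by rewrite sub1set.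
  - by move=> u v /set1P-> /set1P->; rewrite eqxx.
  by apply: IH; rewrite -ltnS -UE.
have xy : x != y by apply: contraTneq exy => ->; rewrite eirr.
move: KU; rewrite !subUset !sub1set => /and3P[xU yU KU] UN.
have UE : #|U| = #|U :\: [set x; y]|.+2.
  by rewrite -setDDl (cardsD1 x) xU (cardsD1 y (U :\ x)) !inE yU eq_sym xy.
have KE : #|x |: (y |: K)|./2 = (#|K|./2).+1.
  by rewrite !cardsU1 !inE negb_or xK yK xy.
case: N UN => [|N] UN; first by rewrite UE in UN.
rewrite UE in UN; rewrite KE {1}UE sum_pairs_rec -UE.
apply: (@achievable_add _ [set x; y]).
- by rewrite subUset !sub1set xU.
- move=> u v /set2P[]-> /set2P[]->; rewrite ?eqxx //.
  by rewrite esym.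
apply: IH; last exact: ltnW.
apply/subsetP=> v vK; rewrite !inE (subsetP KU) // andbT negb_or.
by apply/andP; split; apply: contraTneq vK => ->.
Qed.

(** A vertex of colour [k] exceeds [t] for exactly [k] values of [t], so the sum of the colours
    counts, for each [t], the vertices with a colour above [t]. At most [t + minn t p] vertices have
    a colour up to [t], and stopping at [N] only lowers the left side. *)
Lemma achievable_bound (U : {set T}) p N s : triangle_free U ->
  (forall K : {set T}, K \subset U -> pm e K -> #|K| <= p.*2) ->
  achievable U s -> \sum_(t < N) (#|U| - (t + minn t p)) <= s.
Proof.
move=> tri maxp [c [c0 ce <-]].
pose A t := [set v in U | c v <= t].
(* [K] is the union of the two-vertex classes among the first [t]; every other class has at most one
   vertex, which the inequality states in doubled form. *)
have AP t : exists K : {set T},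
    [/\ K \subset A t, pm e K, #|A t|.*2 <= t.*2 + #|K| & #|K| <= t.*2].
  elim: t => [|t [K [KA pK cA cK]]].
    exists set0; split; rewrite ?sub0set ?cards0 //; first exact: pm0.
    rewrite addn0 leqn0 double_eq0 cards_eq0; apply/eqP/setP=> v; rewrite !inE.
    by apply/negbTE/negP=> /andP[/c0 h]; rewrite leqNgt h.
  pose D := [set v in U | c v == t.+1].
  have AE : A t.+1 = A t :|: D.
    by apply/setP=> v; rewrite !inE leq_eqVlt ltnS -andb_orr orbC.
  have dAD : [disjoint A t & D].
    rewrite disjoint_subset; apply/subsetP=> v; rewrite !inE => /andP[_ cv].
    by rewrite negb_and neq_ltn ltnS cv orbT.
  have cAE : #|A t.+1| = #|A t| + #|D|.
    by have := leq_card_setU (A t) D; rewrite -AE => -[_]; rewrite dAD => /eqP.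
  have clD : clique D.
    move=> u v; rewrite !inE => /andP[uU /eqP cu] /andP[vU /eqP cv] uv.
    by apply: ce; rewrite // cu.
  have D2 : #|D| <= 2.
    by apply: tri => //; apply/subsetP=> v; rewrite inE => /andP[].
  have KA' : K \subset A t.+1 by rewrite AE; apply: subset_trans KA (subsetUl _ _).
  have [D1|D1] := leqP #|D| 1.
    exists K; split=> //; last by rewrite doubleS; do 2!apply: leqW.
    rewrite cAE doubleD doubleS -addn2 -addnA [2 + _]addnC addnA.
    by apply: leq_add cA _; rewrite -[2]/(1.*2) leq_double.
  have /cards2P[x [y [xy DE]]] : #|D| == 2 by rewrite eqn_leq D2.
  have cKD : #|D :|: K| = #|K|.+2.
    have := leq_card_setU D K => -[_]; rewrite (_ : [disjoint D & K]).
      by rewrite DE cards2 xy => /eqP->.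
    by rewrite disjoint_sym; apply: disjointWl dAD.
  exists (D :|: K); split.
  - by rewrite subUset KA' andbT AE subsetUr.
  - apply: pmU => //; last by rewrite disjoint_sym; apply: disjointWl dAD.
    rewrite DE -[[set y]]setU0; apply: pmS; rewrite ?inE //; last exact: pm0.
    by apply: clD => //; rewrite DE !inE eqxx ?orbT.
  - by rewrite cKD cAE DE cards2 xy doubleD doubleS !addnS addn0 !addSn !ltnS.
  by rewrite cKD doubleS !ltnS.
apply: (@leq_trans (\sum_(t < N) \sum_(v in U) (t < c v))).
  apply: leq_sum => t _.
  have -> : \sum_(v in U) (t < c v) = #|[set v in U | t < c v]|.
    by rewrite -sum1dep_card big_mkcondr; apply: eq_bigr => v _; case: ltnP.
  have [K [KA pK cA cK]] := AP t.
  have UE : #|U| = #|A t| + #|[set v in U | t < c v]|.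
    rewrite -(cardsID [set v | c v <= t] U); congr (_ + _).
      by apply: eq_card=> v; rewrite !inE.
    by apply: eq_card=> v; rewrite !inE -ltnNge andbC.
  rewrite UE leq_subLR leq_add2r -leq_double; apply: leq_trans cA _.
  rewrite doubleD leq_add2l.
  have -> : (minn t p).*2 = minn t.*2 p.*2 by rewrite /minn ltn_double; case: ifP.
  rewrite leq_min cK; apply: maxp => //.
  by apply: subset_trans KA _; apply/subsetP=> v; rewrite inE => /andP[].
rewrite exchange_big /=; apply: leq_sum => v vU.
suff -> : \sum_(t < N) (t < c v) = minn N (c v) by apply: geq_minr.
elim: N => [|N IH]; first by rewrite big_ord0 min0n.
by rewrite big_ord_recr /= IH; case: (leqP (c v) N) => h /=; lia.
Qed.

(** The paw consists of the triangle [a], [b], [c] and the vertex [d] hanging from [a]. *)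
Definition paw_free : Prop := forall a b c d, e a b -> e a c -> e b c -> e a d ->
  d != b -> d != c -> e d b || e d c.

(** * The component of a largest clique with at least three vertices *)

Section LargeClique.

Variables (U Q : {set T}).
Hypotheses (paw : paw_free) (QU : Q \subset U) (clQ : clique Q) (Q3 : 3 <= #|Q|).
Hypothesis maxQ : forall Q' : {set T}, Q' \subset U -> clique Q' -> #|Q'| <= #|Q|.

(** The component of [Q] in [U]; it is complete multipartite, every part
    containing one vertex of [Q]. *)
Let K : {set T} := [set v in U | (v \in Q) || [exists q in Q, e v q]].

Let KU : {subset K <= U}. Proof. by move=> v; rewrite inE => /andP[]. Qed.

Let QK : {subset Q <= K}.
Proof. by move=> q qQ; rewrite inE qQ (subsetP QU). Qed.

Let third a b : exists q, [/\ q \in Q, q != a & q != b].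
Proof.
have /card_gt0P[q] : 0 < #|Q :\ a :\ b|.
  rewrite -(ltn_add2l (b \in Q :\ a)) -cardsD1 -(ltn_add2l (a \in Q)) -cardsD1.
  by apply: leq_trans Q3; case: (a \in Q); case: (b \in _).
by rewrite !inE => /and3P[qb qa qQ]; exists q.
Qed.

(** If [v] had a neighbour [q0] in [Q] but missed both [q] and [q'], it would hang from the triangle
    [q0], [q], [q']. *)
Let part_uniq v q q' : v \in K -> q \in Q -> q' \in Q -> ~~ e v q -> ~~ e v q' ->
  q = q'.
Proof.
rewrite inE => /andP[vU /orP[vQ|/exists_inP[q0 q0Q vq0]]] qQ q'Q vq vq'.
  have -> : q = v by apply/eqP; apply: contraNT vq => qv; rewrite clQ // eq_sym.
  by apply/eqP; apply: contraNT vq' => qv; rewrite clQ.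
apply/eqP/idPn => qq'.
have q0q : q0 != q by apply: contraNneq vq => <-.
have q0q' : q0 != q' by apply: contraNneq vq' => <-.
have vNq : v != q by apply/eqP=> E; case/negP: vq'; rewrite E clQ.
have vNq' : v != q' by apply/eqP=> E; case/negP: vq; rewrite E clQ // eq_sym.
have := paw (clQ q0Q qQ q0q) (clQ q0Q q'Q q0q') (clQ qQ q'Q qq') _ vNq vNq'.
by rewrite esym vq0 (negPf vq) (negPf vq') => /(_ isT).
Qed.

(** A vertex adjacent to all of [Q] would extend [Q], which is largest. *)
Let part_ex v : v \in K -> exists2 q, q \in Q & ~~ e v q.
Proof.
move=> vK; have vU := KU vK; have [vQ|vQ] := boolP (v \in Q).
  by exists v; rewrite ?eirr.
apply/exists_inP; rewrite -negb_forall_in; apply/negP=> /forall_inP vall.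
have vQU : v |: Q \subset U by rewrite subUset sub1set vU.
suff clvQ : clique (v |: Q) by have := maxQ vQU clvQ; rewrite cardsU1 vQ add1n ltnn.
move=> a b /setU1P[->|aQ] /setU1P[->|bQ]; rewrite ?eqxx // => ab.
- exact: vall.
- by rewrite esym vall.
exact: clQ.
Qed.

(** The part of [v], named by its representative in [Q]; on [K] the search succeeds. *)
Let tau v : T := odflt v [pick q in Q | ~~ e v q].

Let tauP v : v \in K -> tau v \in Q /\ ~~ e v (tau v).
Proof.
move=> vK; rewrite /tau; case: pickP => [q /andP[]//|F].
by have [q qQ vq] := part_ex vK; have := F q; rewrite qQ vq.
Qed.

Let tauE v q : v \in K -> q \in Q -> e v q = (tau v != q).
Proof.
move=> vK qQ; have [tQ vt] := tauP vK; apply/idP/idP=> [vq|].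
  by apply: contraNneq vt => ->.
by apply: contraNT => vq; apply/eqP; apply: (part_uniq vK).
Qed.

Let tauQ q : q \in Q -> tau q = q.
Proof. by move=> qQ; apply/eqP; rewrite -[_ == _]negbK -tauE ?QK // eirr. Qed.

(** [v] forms a triangle with two vertices of [Q]; since [w] is adjacent to [v], it is adjacent to
    one of these two or equal to it. *)
Let K_closed v w : v \in K -> w \in U -> e v w -> w \in K.
Proof.
move=> vK wU vw; have [q1 [q1Q _ q1t]] := third (tau v) (tau v).
have [q2 [q2Q q2q1 q2t]] := third q1 (tau v).
have vq1 : e v q1 by rewrite tauE // eq_sym.
have vq2 : e v q2 by rewrite tauE // eq_sym.
rewrite inE wU /=; have [wQ|wQ] //= := boolP (w \in Q).
have wq1 : w != q1 by apply: contraNneq wQ => ->.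
have wq2 : w != q2 by apply: contraNneq wQ => ->.
have q12 : e q1 q2 by rewrite clQ // eq_sym.
by apply/exists_inP; have /orP[] := paw vq1 vq2 q12 vw wq1 wq2;
  [exists q1 | exists q2].
Qed.

(** If [u] and [v] were adjacent in the same part, their common representative would hang from the
    triangle they form with another vertex of [Q]. If they are in different parts, [u] is adjacent
    to some [q3] of the triangle [q3], [tau u], [v] but not to [tau u], hence to [v]. *)
Let K_adj u v : u \in K -> v \in K -> e u v = (tau u != tau v).
Proof.
move=> uK vK; have [tuQ utu] := tauP uK; have [tvQ vtv] := tauP vK.
apply/idP/idP => [uv|tuv].
  apply/eqP=> tuv; have [q [qQ qt _]] := third (tau u) (tau u).
  have qu : e q u by rewrite esym tauE // eq_sym.
  have qv : e q v by rewrite esym tauE // -tuv eq_sym.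
  have [tu|tu] := eqVneq (tau u) u; first by move: vtv; rewrite -tuv tu esym uv.
  have [tv|tv] := eqVneq (tau u) v; first by move: utu; rewrite tv uv.
  have := paw qu qv uv (clQ qQ tuQ qt) tu tv.
  by rewrite esym (negPf utu) esym tuv (negPf vtv).
have [q3 [q3Q q3u q3v]] := third (tau u) (tau v).
have u3 : e u q3 by rewrite tauE // eq_sym.
have v3 : e v q3 by rewrite tauE // eq_sym.
have vq : e v (tau u) by rewrite tauE // eq_sym.
have [<-|utu'] := eqVneq (tau u) u; first by rewrite esym.
have [uv|uv] := eqVneq u v; first by rewrite uv eqxx in tuv.
rewrite esym in u3; rewrite esym in v3; rewrite eq_sym in utu'.
have := paw v3 (clQ q3Q tuQ q3u) vq u3 uv utu'.
by rewrite (negPf utu) orbF.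
Qed.

(** [C] stays in the component of [Q]. If it were smaller than [Q], it would miss some part, and the
    representative of that part could be added. *)
Lemma card_maximal_clique (C : {set T}) v : C \subset U -> clique C -> v \in C ->
  v \in Q -> (forall u, u \in U -> u \notin C -> exists2 z, z \in C & ~~ e u z) ->
  #|Q| <= #|C|.
Proof.
move=> CU clC vC vQ maxC; rewrite leqNgt; apply/negP=> CQ.
have CK u : u \in C -> u \in K.
  move=> uC; have [->|uv] := eqVneq u v; first exact: QK.
  by apply: (@K_closed v); rewrite ?QK ?(subsetP CU) // clC // eq_sym.
have /subsetPn[q qQ qC] : ~~ (Q \subset tau @: C).
  apply/negP=> /subset_leq_card; rewrite leqNgt; case/negP.
  exact: leq_ltn_trans (leq_imset_card _ _) CQ.
have [|z zC] := maxC q (subsetP QU _ qQ).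
  by apply: contraNN qC => qC; rewrite -(tauQ qQ) imset_f.
by rewrite (K_adj (QK qQ) (CK z zC)) negbK tauQ // => /eqP E; rewrite E imset_f in qC.
Qed.

(** Two exchanges that do not raise the sum: the class [S] with the smallest colour [j] in the
    component is replaced by [Q], and the colours [1] and [j] are swapped. Removing [Q], now the
    first class, lowers each remaining colour by one. *)
Lemma achievable_del s : achievable U s ->
  exists2 s', achievable (U :\: Q) s' & #|U| + s' <= s.
Proof.
move=> [c [c0 ce <-]].
have /card_gt0P[q0 q0Q] : 0 < #|Q| by apply: ltn_trans Q3.
have [s0 s0K jmin] := arg_minnP c (QK q0Q); set j := c s0 in jmin *.
have s0U := KU s0K.
pose S := [set v in U | c v == j].
have SU : {subset S <= U} by move=> v; rewrite inE => /andP[].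
have Sc v : v \in S -> c v = j by rewrite inE => /andP[_ /eqP].
have Se : clique S by move=> u v uS vS uv; apply: ce; rewrite ?SU // !Sc.
have SK : {subset S <= K}.
  move=> v vS; have [->//|vs] := eqVneq v s0.
  apply: (K_closed s0K); rewrite ?SU // Se // ?inE ?s0U ?eqxx // eq_sym //.
have tauS : {in S &, injective tau}.
  move=> u v uS vS tuv; apply/eqP/idPn=> uv.
  by have := Se u v uS vS uv; rewrite K_adj ?SK // tuv eqxx.
(* [Q] receives colour [j], and a vertex that it expels from [S] takes the colour of its twin
   [tau v]. *)
pose c1 v := if v \in Q then j else if v \in S then c (tau v) else c v.
have tauS' v : v \in S -> v \notin Q -> tau v \notin S.
  move=> vS vQ; apply/negP=> tS; have tQ := (tauP (SK _ vS)).1.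
  by move: vQ; rewrite -(tauS _ _ tS vS) ?tQ // tauQ.
have c1Q v : v \in U -> c1 v = j -> v \in Q.
  move=> vU; rewrite /c1; case: ifP => // vQ; case: ifP => vS cj.
    have := tauS' v vS (negbT vQ); rewrite inE cj eqxx andbT.
    by rewrite (subsetP QU) // (tauP (SK _ vS)).1.
  by move: vS; rewrite inE vU cj eqxx.
have c1e : {in U &, forall u v, u != v -> c1 u = c1 v -> e u v}.
  have aux u v : u \in U -> v \in U -> u \notin Q -> v \notin Q -> u \in S ->
      v \notin S -> c (tau u) = c v -> e u v.
    move=> uU vU uQ vQ uS vS ctv; have [tQ _] := tauP (SK _ uS).
    have tv : tau u != v by apply: contraNneq vQ => <-.
    have etv : e (tau u) v by apply: ce => //; apply: (subsetP QU).
    have vK : v \in K by apply: K_closed etv => //; apply: QK.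
    by move: etv; rewrite (K_adj (QK tQ) vK) (K_adj (SK _ uS) vK) tauQ.
  move=> u v uU vU uv c1uv; have [uQ|uQ] := boolP (u \in Q).
    by apply: clQ => //; apply: c1Q => //; rewrite -c1uv /c1 uQ.
  have [vQ|vQ] := boolP (v \in Q).
    by case/negP: uQ; apply: c1Q => //; rewrite c1uv /c1 vQ.
  move: c1uv; rewrite /c1 (negPf uQ) (negPf vQ).
  case: ifP => uS; case: ifP => vS.
  - by move=> _; apply: Se.
  - by apply: aux => //; rewrite vS.
  - by move=> cuv; rewrite esym; apply: aux; rewrite // ?uS.
  exact: ce.
have c1_0 v : v \in U -> 0 < c1 v.
  move=> vU; rewrite /c1; case: ifP => _; first exact: c0.
  case: ifP => [vS|_]; last exact: c0.
  by apply: c0; apply: (subsetP QU); exact: (tauP (SK _ vS)).1.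
(* The vertices of [S :\: Q] and their representatives [P] exchange colours, the rest of [Q] comes
   down to [j], the minimum on [K], and nothing else changes. *)
have sum1 : \sum_(v in U) c1 v <= \sum_(v in U) c v.
  have QSU : Q :|: S \subset U by rewrite subUset QU; apply/subsetP.
  rewrite (big_setID (Q :|: S)) /= [leqRHS](big_setID (Q :|: S)) /=.
  rewrite (setIidPr QSU) [X in _ + X <= _](eq_bigr c); last first.
    by move=> v /setDP[_]; rewrite inE negb_or /c1 => /andP[/negPf-> /negPf->].
  rewrite leq_add2r (big_setID Q) /= [leqRHS](big_setID Q) /=.
  rewrite !(setIidPr (subsetUl _ _)) setDUl setDv set0U.
  rewrite (eq_bigr (fun=> j)) => [|v]; last by rewrite /c1 => ->.
  rewrite sum_nat_const [X in _ + X <= _](eq_bigr (fun v => c (tau v))); last first.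
    by move=> v /setDP[vS /negPf vQ]; rewrite /c1 vQ vS.
  rewrite [X in _ <= _ + X](eq_bigr (fun=> j)) => [|v /setDP[/Sc]//].
  rewrite sum_nat_const.
  pose P := tau @: (S :\: Q).
  have tauI : {in S :\: Q &, injective tau}.
    by move=> u v /setDP[uS _] /setDP[vS _]; apply: tauS.
  have PQ : P \subset Q.
    by apply/subsetP=> _ /imsetP[v /setDP[vS _] ->]; exact: (tauP (SK _ vS)).1.
  rewrite [X in _ <= X + _](big_setID P) /= (setIidPr PQ).
  rewrite big_imset //= addnC -addnA leq_add2l -(cardsID P Q) (setIidPr PQ).
  rewrite card_in_imset // addnC mulnDl leq_add2r -sum_nat_const.
  by apply: leq_sum => v /setDP[vQ _]; apply: jmin; apply: QK.
have j0 : 0 < j by apply: c0.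
(* Outside [Q] colour [j] is free after the first exchange, so the vertices of colour [1] can move
   there. This is positive after the shift: colour [1] outside [Q] forces [j] to exceed [1]. *)
pose c3 v := (if c1 v == 1 then j else c1 v).-1.
have c1j v : v \in U :\: Q -> c1 v != j.
  by move=> /setDP[vU vQ]; apply: contraNneq vQ => /c1Q->.
have c3E v : v \in U :\: Q -> 0 < c3 v /\ (c3 v).+1 = if c1 v == 1 then j else c1 v.
  move=> vUQ; rewrite /c3; case: eqP => [c11|/eqP c11].
    have := c1j v vUQ; rewrite c11; move: j0; lia.
  have := c1_0 v (subsetP (subsetDl _ _) _ vUQ); move: c11; lia.
exists (\sum_(v in U :\: Q) c3 v).
  exists c3; split=> // [v /c3E[]//|u v uU vU uv c3uv].
  apply: c1e; rewrite // ?(subsetP (subsetDl U Q)) //.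
  have [_ Eu] := c3E u uU; have [_ Ev] := c3E v vU.
  have := c1j u uU; have := c1j v vU; move: Eu Ev; rewrite c3uv => ->.
  by do 2!case: eqP => //; lia.
pose D := [set v in U :\: Q | c1 v == 1].
(* Moving [D] from [1] to [j] costs [j - 1] per vertex and moving [Q] from [j] to [1] saves as much;
   [D] is a clique, hence no larger than [Q]. *)
have DQ : (j - 1) * #|D| <= (j - 1) * #|Q|.
  have [j1|j1] := eqVneq j 1; first by rewrite j1.
  rewrite leq_mul2l; apply/orP; right; apply: maxQ.
    by apply/subsetP=> v; rewrite !inE => /andP[/andP[]].
  move=> u v; rewrite !inE => /andP[/andP[_ uU] /eqP cu] /andP[/andP[_ vU] /eqP cv] uv.
  by apply: c1e; rewrite // cu.
apply: leq_trans sum1.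
rewrite -(cardsID Q U) [leqRHS](big_setID Q) /= (setIidPr QU).
rewrite -addnA -[#|U :\: Q|]sum1_card -big_split /=.
rewrite [X in _ <= X + _](eq_bigr (fun=> j)) => [|v]; last by rewrite /c1 => ->.
rewrite sum_nat_const.
have -> : \sum_(v in U :\: Q) (1 + c3 v) =
    \sum_(v in U :\: Q) c1 v + (j - 1) * #|D|.
  rewrite mulnC -sum_nat_const /D big_mkcond /= [X in _ = _ + X]big_mkcond.
  rewrite [X in _ = X + _]big_mkcond -big_split /=; apply: eq_bigr => v _.
  rewrite inE; case: ifP => vUQ //=; rewrite add1n (c3E v vUQ).2.
  by case: eqP => [->|_]; [rewrite subnKC | rewrite addn0].
rewrite addnCA [leqRHS]addnC leq_add2l; apply: leq_trans (_ : #|Q| + (j - 1) * #|Q| <= _).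
  by rewrite leq_add2l.
by rewrite -mulSn subn1 prednK // mulnC.
Qed.

End LargeClique.

(** In a paw-free graph, greedily extending a vertex of a triangle reaches the
    maximum size of a clique through that vertex. *)
Lemma clique_bound (U : {set T}) b : paw_free -> 2 <= b ->
  {in U, forall v, exists C : {set T}, [/\ C \subset U, clique C, v \in C, #|C| <= b &
      forall u, u \in U -> u \notin C -> exists2 z, z \in C & ~~ e u z]} ->
  forall Q : {set T}, Q \subset U -> clique Q -> #|Q| <= b.
Proof.
move=> paw b2 greedy.
have [N] := ubnP #|U|; move=> UN Q0 Q0U clQ0.
pose p (Q : {set T}) := (Q \subset U) && [forall u in Q, forall v in Q, (u != v) ==> e u v].
have pP (Q : {set T}) : reflect (Q \subset U /\ clique Q) (p Q).
  apply: (iffP andP) => -[QU clQ]; split=> //.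
    by move=> u v uQ vQ uv; have /forall_inP/(_ v vQ)/implyP/(_ uv) := forall_inP clQ u uQ.
  by apply/forall_inP=> u uQ; apply/forall_inP=> v vQ; apply/implyP; apply: clQ.
have pQ0 : p Q0 by apply/pP.
case: (arg_maxnP (fun Q : {set T} => #|Q|) pQ0) => Q /pP[QU clQ] maxQ.
apply: leq_trans (maxQ _ pQ0) _; rewrite leqNgt; apply/negP=> bQ.
have Q3 : 3 <= #|Q| by apply: leq_trans bQ.
have /card_gt0P[v vQ] : 0 < #|Q| by apply: ltn_trans Q3.
have [C [CU clC vC Cb maxC]] := greedy v (subsetP QU _ vQ).
have maxQ' (Q' : {set T}) : Q' \subset U -> clique Q' -> #|Q'| <= #|Q|.
  by move=> Q'U clQ'; apply: maxQ; apply/pP.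
have := card_maximal_clique paw QU clQ Q3 maxQ' CU clC vC vQ maxC.
by rewrite leqNgt (leq_ltn_trans Cb bQ).
Qed.

End CliquePartition.

(** * A loop language *)

(** Every loop and every sum runs over [0 .. N-1], where [N] is the length of the
    input; hence running times are polynomial by construction. *)
Inductive expr :=
| EV of nat
| EC of nat
| EN
| EAdd of expr & expr
| ESub of expr & expr
| EArr of nat & expr
| EIn of expr
| EIf of expr & expr & expr
| ESum of nat & expr.

Inductive cmd :=
| CSkip
| CSet of nat & expr
| CSto of nat & expr & expr
| CSeq of cmd & cmd
| CIf of expr & cmd & cmd
| CFor of nat & cmd.

Record state := State { rg : nat -> nat; ar : nat -> nat -> nat }.

Definition setr (x v : nat) s := State (fun y => if y == x then v else rg s y) (ar s).

Definition seta (a i v : nat) s :=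
  State (rg s) (fun b => if b == a then fun j => if j == i then v else ar s b j
                         else ar s b).

Section Semantics.

Variable w : seq bool.

Fixpoint eval e s : nat :=
  match e with
  | EV x => rg s x
  | EC n => n
  | EN => size w
  | EAdd e1 e2 => eval e1 s + eval e2 s
  | ESub e1 e2 => eval e1 s - eval e2 s
  | EArr a e => ar s a (eval e s)
  | EIn e => nth false w (eval e s)
  | EIf e e1 e2 => if eval e s != 0 then eval e1 s else eval e2 s
  | ESum i e => \sum_(k < size w) eval e (setr i k s)
  end.

Fixpoint sem c s : state :=
  match c with
  | CSkip => s
  | CSet x e => setr x (eval e s) s
  | CSto a e1 e2 => seta a (eval e1 s) (eval e2 s) s
  | CSeq c1 c2 => sem c2 (sem c1 s)
  | CIf e c1 c2 => if eval e s != 0 then sem c1 s else sem c2 s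
  | CFor i c => foldl (fun s k => sem c (setr i k s)) s (iota 0 (size w))
  end.

(** Variable 0 starts with the input length because register 0 of the machine does. *)
Definition state0 := State (fun x => if x == 0 then size w else 0) (fun _ _ => 0).

End Semantics.

(** * Running times of programs *)

Section Cost.

Variable K : nat.

(** Bounds for the numbers of instructions executed by the compiled code. [K] enters through the
    address computation for arrays; for a conditional both branches are added up instead of taking
    the maximum. *)
Fixpoint ecost N e : nat :=
  match e with
  | EV _ | EC _ | EN => 1
  | EAdd e1 e2 | ESub e1 e2 => ecost N e1 + (ecost N e2 + 1)
  | EArr _ e => ecost N e + (K + 3)
  | EIn e => ecost N e + 4
  | EIf e e1 e2 => ecost N e + (1 + (ecost N e1 + ecost N e2 + 1))
  | ESum _ e => 3 + (N * (ecost N e + 7) + 3)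
  end.

Fixpoint ccost N c : nat :=
  match c with
  | CSkip => 0
  | CSet _ e => ecost N e + 1
  | CSto _ e1 e2 => ecost N e1 + (ecost N e2 + (K + 3))
  | CSeq c1 c2 => ccost N c1 + ccost N c2
  | CIf e c1 c2 => ecost N e + (1 + (ccost N c1 + ccost N c2 + 1))
  | CFor _ c => 1 + (N * (ccost N c + 6) + 2)
  end.

Definition poly_bounded (f : nat -> nat) : Prop :=
  exists c d, forall n, f n <= c * n ^ d + c.

Lemma poly_const c : poly_bounded (fun=> c).
Proof. by exists c, 0 => n; rewrite leq_addl. Qed.

Lemma poly_add f g : poly_bounded f -> poly_bounded g ->
  poly_bounded (fun n => f n + g n).
Proof.
move=> [c [d fP]] [c' [d' gP]]; exists (2 * (c + c')), (d + d') => n.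
(* The [+ 1] accounts for [n = 0], where [0 ^ 0] is [1]. *)
have mono m k : n ^ m <= n ^ (m + k) + 1.
  case: n {fP gP} => [|n]; first by case: m => [|m]; rewrite ?expn0 addn1 // exp0n.
  by rewrite addn1 leqW // leq_pexp2l // leq_addr.
have := leq_add (fP n) (gP n).
have := leq_mul (leqnn c) (mono d d'); have := leq_mul (leqnn c') (mono d' d).
rewrite [d' + d]addnC; move: (n ^ (d + d')) (n ^ d) (n ^ d') => x y z; nia.
Qed.

Lemma poly_mulN f : poly_bounded f -> poly_bounded (fun n => n * f n).
Proof.
move=> [c [d fP]]; exists (2 * c), d.+1 => n.
apply: leq_trans (leq_mul (leqnn n) (fP n)) _; rewrite expnS.
have [->|n0] := posnP n; first by rewrite mul0n.
have : n <= n * n ^ d by rewrite leq_pmulr // expn_gt0 n0.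
by move: (n ^ d) => x; nia.
Qed.

Lemma poly_ecost e : poly_bounded (ecost^~ e).
Proof.
elim: e => /= *; do ?[exact: poly_const | apply: poly_add | apply: poly_mulN] => //.
Qed.

Lemma poly_ccost c : poly_bounded (ccost^~ c).
Proof.
elim: c => /= *;
  do ?[exact: poly_const | exact: poly_ecost | apply: poly_add | apply: poly_mulN] => //.
Qed.

End Cost.

(** * Compilation *)

(** Variables below [D] live in the registers with the same number; register
    [D] stays 0, register [D.+1] holds the input length, and the registers from
    [D.+2] on form a stack.  Entry [i] of array [a] is in memory cell
    [size w + (i * K + a)]. *)
Section Compile.

Variables D K : nat.

Local Notation NN := D.+1.

(** The machine has no multiplication, so register [t] is added [K] times. *)
Definition caddr u t a : seq instr :=
  Iconst u a :: Iadd u u NN :: nseq K (Iadd u u t).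

(** Jumps are absolute, so the code depends on its own address [p]. The value ends up in register
    [t], and only registers from [t] on serve as scratch. [Ijz D] jumps unconditionally. A sum uses
    [t] as accumulator, [t.+1] for the old value of [i] and [t.+2] as counter. *)
Fixpoint cexp p t e : seq instr :=
  match e with
  | EV x => [:: Iadd t x D]
  | EC n => [:: Iconst t n]
  | EN => [:: Iadd t NN D]
  | EAdd e1 e2 =>
      let c1 := cexp p t e1 in c1 ++ cexp (p + size c1) t.+1 e2 ++ [:: Iadd t t t.+1]
  | ESub e1 e2 =>
      let c1 := cexp p t e1 in c1 ++ cexp (p + size c1) t.+1 e2 ++ [:: Isub t t t.+1]
  | EArr a e => cexp p t e ++ caddr t.+1 t a ++ [:: Iread t t.+1]
  | EIn e =>
      let c := cexp p t e in let q := p + size c in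
      c ++ [:: Isub t.+1 NN t; Ijz t.+1 q.+4; Iread t t; Ijz D q.+4.+1; Iconst t 0]
  | EIf e e1 e2 =>
      let c := cexp p t e in
      let c1 := cexp (p + size c).+1 t e1 in
      let q := ((p + size c).+1 + size c1).+1 in
      let c2 := cexp q t e2 in
      c ++ Ijz t q :: c1 ++ Ijz D (q + size c2) :: c2
  | ESum i e =>
      let c := cexp (p + 6) t.+3 e in
      [:: Iconst t 0, Iadd t.+1 i D, Iconst t.+2 0,
          Isub t.+3 NN t.+2, Ijz t.+3 (p + 6 + size c).+4, Iadd i t.+2 D &
          c ++ [:: Iadd t t t.+3; Iconst t.+3 1; Iadd t.+2 t.+2 t.+3;
                   Ijz D (p + 3); Iadd i t.+1 D]]
  end.

(** A loop counts in register [t] and reloads variable [i] from it in every round, so the body is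
    free to overwrite [i]. *)
Fixpoint ccmd p t c : seq instr :=
  match c with
  | CSkip => [::]
  | CSet x e => cexp p t e ++ [:: Iadd x t D]
  | CSto a e1 e2 =>
      let c1 := cexp p t e1 in
      c1 ++ cexp (p + size c1) t.+1 e2 ++ caddr t.+2 t a ++ [:: Iwrite t.+2 t.+1]
  | CSeq c1 c2 => let d := ccmd p t c1 in d ++ ccmd (p + size d) t c2
  | CIf e c1 c2 =>
      let d := cexp p t e in
      let d1 := ccmd (p + size d).+1 t c1 in
      let q := ((p + size d).+1 + size d1).+1 in
      let d2 := ccmd q t c2 in
      d ++ Ijz t q :: d1 ++ Ijz D (q + size d2) :: d2
  | CFor i c =>
      let d := ccmd (p + 4) t.+1 c in
      [:: Iconst t 0, Isub t.+1 NN t, Ijz t.+1 (p + 4 + size d).+3, Iadd i t D &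
          d ++ [:: Iconst t.+1 1; Iadd t t t.+1; Ijz D p.+1]]
  end.

Fixpoint wf_expr e : bool :=
  match e with
  | EV x => x < D
  | EC _ | EN => true
  | EAdd e1 e2 | ESub e1 e2 => wf_expr e1 && wf_expr e2
  | EArr a e => (a < K) && wf_expr e
  | EIn e => wf_expr e
  | EIf e e1 e2 => [&& wf_expr e, wf_expr e1 & wf_expr e2]
  | ESum i e => (i < D) && wf_expr e
  end.

Fixpoint wf_cmd c : bool :=
  match c with
  | CSkip => true
  | CSet x e => (x < D) && wf_expr e
  | CSto a e1 e2 => [&& a < K, wf_expr e1 & wf_expr e2]
  | CSeq c1 c2 => wf_cmd c1 && wf_cmd c2
  | CIf e c1 c2 => [&& wf_expr e, wf_cmd c1 & wf_cmd c2]
  | CFor i c => (i < D) && wf_cmd c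
  end.

Variables (w : seq bool) (P : program).

Definition code_at p (c : seq instr) : Prop :=
  exists pre post, P = pre ++ c ++ post /\ size pre = p.

Lemma code_at_cat p c1 c2 : code_at p (c1 ++ c2) ->
  code_at p c1 /\ code_at (p + size c1) c2.
Proof.
move=> [pre [post [E <-]]]; split; first by exists pre, (c2 ++ post); rewrite E -catA.
by exists (pre ++ c1), post; rewrite E -!catA size_cat.
Qed.

Lemma code_at_cons p i c : code_at p (i :: c) -> code_at p [:: i] /\ code_at p.+1 c.
Proof. by rewrite -cat1s => /code_at_cat; rewrite /= addn1. Qed.

Definition reach s t (Q : config -> Prop) : Prop :=
  exists2 k, k <= t & Q (iter k (step P) s).

Lemma reach0 s (Q : config -> Prop) : Q s -> reach s 0 Q.
Proof. by exists 0. Qed.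

Lemma reach_le s t t' Q : t <= t' -> reach s t Q -> reach s t' Q.
Proof. by move=> tt' [k kt Qk]; exists k => //; apply: leq_trans tt'. Qed.

Lemma reach_bind s t t' (Q1 Q2 : config -> Prop) : reach s t Q1 ->
  (forall s', Q1 s' -> reach s' t' Q2) -> reach s (t + t') Q2.
Proof.
move=> [k kt Qk] /(_ _ Qk)[l lt Ql]; exists (l + k); last by rewrite iterD.
by rewrite addnC leq_add.
Qed.

Lemma reach_instr p R M i t Q : code_at p [:: i] ->
  reach (exec i (Config p R M)) t Q -> reach (Config p R M) t.+1 Q.
Proof.
move=> [pre [post [defP szp]]] [k kt Qk]; exists k.+1 => //; rewrite iterSr.
suff -> : step P (Config p R M) = exec i (Config p R M) by [].
by rewrite {1}/step defP -szp /= onth_cat ltnn subnn.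
Qed.

Record sim (s : state) (R M : nat -> nat) : Prop := Sim {
  sim_var : forall x, x < D -> R x = rg s x;
  sim_zero : R D = 0;
  sim_size : R NN = size w;
  sim_input : forall j, j < size w -> M j = nth false w j;
  sim_arr : forall a i, a < K -> M (size w + (i * K + a)) = ar s a i
}.

Lemma sim_temp s R M u v : NN < u -> sim s R M -> sim s [eta R with u |-> v] M.
Proof.
move=> Du [sv sz sn si sa]; split=> //= [x xD||].
- by rewrite ifN ?sv //; lia.
- by rewrite ifN ?sz //; lia.
- by rewrite ifN ?sn //; lia.
Qed.

Lemma sim_setr s R M x v : x < D -> sim s R M ->
  sim (setr x v s) [eta R with x |-> v] M.
Proof.
move=> xD [sv sz sn si sa]; split=> //= [y yD||].
- by case: eqP => // _; rewrite sv.
- by rewrite ifN ?sz //; lia.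
- by rewrite ifN ?sn //; lia.
Qed.

(** [sim] except for variable [i]: the loop counter, inside and after a loop. *)
Definition sim_but i s R M := sim s [eta R with i |-> rg s i] M.

Lemma sim_butW i s R M : i < D -> sim s R M -> sim_but i s R M.
Proof.
move=> iD [sv sz sn si sa]; split=> //= [x xD||]; last 2 first.
- by rewrite ifN //; lia.
- by rewrite ifN //; lia.
by case: eqP => [->|_] //; rewrite sv.
Qed.

Lemma sim_but_setr i k s R M : i < D -> sim (setr i k s) R M -> sim_but i s R M.
Proof.
move=> iD [sv sz sn si sa]; split=> //= [x xD||]; last 2 first.
- by rewrite ifN //; lia.
- by rewrite ifN //; lia.
by case: eqP => [->|/eqP/negPf xi] //; rewrite sv //= xi.
Qed.

Lemma sim_set_but i k s R M : i < D -> sim_but i s R M ->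
  sim (setr i k s) [eta R with i |-> k] M.
Proof.
move=> iD [sv sz sn si sa]; split=> //= [x xD||].
- by move: (sv x xD) => /=; case: eqP.
- by move: sz => /=; rewrite !ifN //; lia.
- by move: sn => /=; rewrite !ifN //; lia.
Qed.

Lemma sim_but_temp i s R M u v : i < D -> NN < u -> sim_but i s R M ->
  sim_but i s [eta R with u |-> v] M.
Proof.
move=> iD Du [sv sz sn si sa]; split=> //= [x xD||].
- by move: (sv x xD) => /=; have -> : (x == u) = false by lia.
- by move: sz => /=; have -> : (D == u) = false by lia.
- by move: sn => /=; have -> : (NN == u) = false by lia.
Qed.

Lemma sim_but_zero i s R M : i < D -> sim_but i s R M -> R D = 0.
Proof. by move=> iD /sim_zero /=; rewrite ifN //; lia. Qed.

Lemma sim_but_size i s R M : i < D -> sim_but i s R M -> R NN = size w.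
Proof. by move=> iD /sim_size /=; rewrite ifN //; lia. Qed.

Lemma reach_nseq p R M u t k T Q : u != t -> code_at p (nseq k (Iadd u u t)) ->
  (forall R', R' u = R u + k * R t -> (forall r, r != u -> R' r = R r) ->
     reach (Config (p + k) R' M) T Q) ->
  reach (Config p R M) (k + T) Q.
Proof.
move=> ut; elim: k p R => [|k IH] p R.
  by move=> _ H; rewrite -[p]addn0; apply: H => //; rewrite mul0n addn0.
move=> /code_at_cons[c1 c2] H; apply: (reach_instr c1) => /=.
apply: IH => // R' R'u R'o; rewrite addSnnS; apply: H.
  by rewrite R'u /= eqxx eq_sym (negPf ut) mulSn addnA.
by move=> r ru; rewrite R'o //= (negPf ru).
Qed.

Lemma reach_caddr p u t a R M T Q : u != t -> NN < u -> R NN = size w ->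
  code_at p (caddr u t a) ->
  (forall R', R' u = size w + (R t * K + a) -> (forall r, r != u -> R' r = R r) ->
     reach (Config (p + K.+2) R' M) T Q) ->
  reach (Config p R M) (K.+2 + T) Q.
Proof.
move=> ut Du RN /code_at_cons[c1 /code_at_cons[c2 c3]] H.
rewrite !addSn; apply: (reach_instr c1); apply: (reach_instr c2); rewrite /=.
apply: (reach_nseq ut c3) => R' R'u R'o; rewrite !addSnnS; apply: H.
  rewrite R'u /= !eqxx [t == u]eq_sym (negPf ut) ifN ?RN; last by lia.
  by rewrite mulnC; lia.
by move=> r ru; rewrite R'o //= (negPf ru).
Qed.

Lemma size_caddr u t a : size (caddr u t a) = K.+2.
Proof. by rewrite /= size_nseq. Qed.

#[local] Opaque caddr.

(** The stack below [t] survives, so a first operand is still in place when the second has been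
    computed; the memory is untouched. *)
Definition done_expr p' t s R M v (s' : config) : Prop :=
  exists R', [/\ s' = Config p' R' M, sim s R' M, R' t = v &
    forall u, NN < u -> u < t -> R' u = R u].

Lemma done_exprI p p' t s R R' M v : p = p' -> sim s R' M -> R' t = v ->
  (forall u, NN < u -> u < t -> R' u = R u) ->
  done_expr p' t s R M v (Config p R' M).
Proof. by move=> <- S v_t low; exists R'. Qed.

Lemma cexp_ok e p t s R M : wf_expr e -> NN < t -> code_at p (cexp p t e) ->
  sim s R M -> reach (Config p R M) (ecost K (size w) e)
    (done_expr (p + size (cexp p t e)) t s R M (eval w e s)).
Proof.
have low (R' R0 : nat -> nat) t0 v : (forall u, NN < u -> u < t0 -> R' u = R0 u) ->
    forall u, NN < u -> u < t0 -> [eta R' with t0 |-> v] u = R0 u.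
  by move=> H u Du ut /=; rewrite ifN ?H //; lia.
elim: e p t s R M => /= [x|n||e1 IH1 e2 IH2|e1 IH1 e2 IH2|a e IH|e IH|e IH e1 IH1 e2 IH2|i e IH]
  p t s R M.
- move=> xD Dt c S; apply: (reach_instr c); apply: reach0.
  apply: done_exprI; [by rewrite addn1|exact: sim_temp|by rewrite /= eqxx (sim_var S) // (sim_zero S) addn0|].
  by apply: low.
- move=> _ Dt c S; apply: (reach_instr c); apply: reach0.
  apply: done_exprI; [by rewrite addn1|exact: sim_temp|by rewrite /= eqxx|].
  by apply: low.
- move=> _ Dt c S; apply: (reach_instr c); apply: reach0.
  apply: done_exprI; [by rewrite addn1|exact: sim_temp|by rewrite /= eqxx (sim_size S) (sim_zero S) addn0|].
  by apply: low.
- move=> /andP[w1 w2] Dt /code_at_cat[c1 /code_at_cat[c2 c3]] S.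
  apply: (reach_bind (IH1 _ _ _ _ _ w1 Dt c1 S)) => _ [R1 [-> S1 v1 l1]].
  have Dt1 : NN < t.+1 by lia.
  apply: (reach_bind (IH2 _ _ _ _ _ w2 Dt1 c2 S1)) => _ [R2 [-> S2 v2 l2]].
  apply: (reach_instr c3); apply: reach0.
  apply: done_exprI; [by rewrite !size_cat /=; lia|exact: sim_temp|by rewrite /= eqxx v2 l2 // v1|].
  by apply: low => u Du ut; rewrite l2 ?l1 //; lia.
- move=> /andP[w1 w2] Dt /code_at_cat[c1 /code_at_cat[c2 c3]] S.
  apply: (reach_bind (IH1 _ _ _ _ _ w1 Dt c1 S)) => _ [R1 [-> S1 v1 l1]].
  have Dt1 : NN < t.+1 by lia.
  apply: (reach_bind (IH2 _ _ _ _ _ w2 Dt1 c2 S1)) => _ [R2 [-> S2 v2 l2]].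
  apply: (reach_instr c3); apply: reach0.
  apply: done_exprI; [by rewrite !size_cat /=; lia|exact: sim_temp|by rewrite /= eqxx v2 l2 // v1|].
  by apply: low => u Du ut; rewrite l2 ?l1 //; lia.
- move=> /andP[aK we] Dt /code_at_cat[c1 /code_at_cat[c2 c3]] S.
  apply: (reach_bind (IH _ _ _ _ _ we Dt c1 S)) => _ [R1 [-> S1 v1 l1]].
  rewrite -[K + 3]/(K + 3) addnS -addSn addnS -addSn.
  have Dt1 : NN < t.+1 by lia.
  have ut : t.+1 != t by lia.
  apply: (reach_caddr ut Dt1 (sim_size S1) c2) => R2 R2u R2o.
  rewrite size_caddr in c3; apply: (reach_instr c3); apply: reach0.
  have S2 : sim s R2 M.
    case: S1 => sv sz sn si sa; split=> // [x xD||]; rewrite R2o ?sz ?sn //; try lia.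
    exact: sv.
  apply: done_exprI; [by rewrite !size_cat size_caddr /=; lia|exact: sim_temp| |].
    by rewrite /= eqxx R2u v1 (sim_arr S2).
  by apply: low => u Du ut'; rewrite R2o ?l1 //; lia.
- move=> we Dt /code_at_cat[c1 c2] S.
  apply: (reach_bind (IH _ _ _ _ _ we Dt c1 S)) => _ [R1 [-> S1 v1 l1]].
  have Dt1 : NN < t.+1 by lia.
  have [c3 /code_at_cons[c4 /code_at_cons[c5 /code_at_cons[c6 c7]]]] := code_at_cons c2.
  rewrite size_cat /= addnA; move: (p + size _) c3 c4 c5 c6 c7 => q c3 c4 c5 c6 c7.
  apply: (reach_instr c3) => /=.
  apply: (reach_instr c4); rewrite /= eqxx subn_eq0 (sim_size S1) v1.
  have S2 v : sim s [eta R1 with t.+1 |-> v] M by apply: sim_temp.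
  case: leqP => ew.
    apply: (reach_le (t := 1)) => //; apply: (reach_instr c7); apply: reach0.
    rewrite /=; apply: done_exprI; [by lia|exact: sim_temp| |].
      by rewrite /= eqxx nth_default.
    by apply: (low) => u Du ut /=; rewrite ifN ?l1 //; lia.
  apply: (reach_instr c5) => /=; apply: (reach_instr c6) => /=.
  have -> : (D == t) = false by lia.
  have -> : (D == t.+1) = false by lia.
  rewrite (sim_zero S1) /=; apply: reach0.
  apply: done_exprI; [by lia|apply: sim_temp => //; exact: S2| |].
    by rewrite /= eqxx ifN; [rewrite v1 (sim_input S1) | lia].
  by apply: low => u Du ut /=; rewrite ifN ?l1 //; lia.
- move=> /and3P[we w1 w2] Dt /code_at_cat[c1 /code_at_cons[c2 /code_at_cat[c3 /code_at_cons[c4 c5]]]] S.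
  apply: (reach_bind (IH _ _ _ _ _ we Dt c1 S)) => _ [R1 [-> S1 v1 l1]].
  apply: (reach_instr c2); rewrite /= v1; case: eqP => [_|_] /=.
    apply: (@reach_le _ (ecost K (size w) e2)); first by lia.
    rewrite -[ecost K (size w) e2]addn0.
    apply: (reach_bind (IH2 _ _ _ _ _ w2 Dt c5 S1)) => _ [R2 [-> S2 v2 l2]].
    apply: reach0; apply: done_exprI => //; first by rewrite !size_cat /= size_cat /=; lia.
    by move=> u Du ut; rewrite l2 ?l1.
  apply: (@reach_le _ (ecost K (size w) e1 + 1)); first by lia.
  apply: (reach_bind (IH1 _ _ _ _ _ w1 Dt c3 S1)) => _ [R2 [-> S2 v2 l2]].
  apply: (reach_instr c4); rewrite /= (sim_zero S2) /=; apply: reach0.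
  apply: done_exprI => //; first by rewrite !size_cat /= size_cat /=; lia.
  by move=> u Du ut; rewrite l2 ?l1.
- move=> /andP[iD we] Dt; rewrite -[[:: _, _, _, _, _, _ & _]]/([:: _; _; _; _; _; _] ++ _).
  set c := cexp (p + 6) t.+3 e; move=> /code_at_cat[].
  move=> /code_at_cons[a1 /code_at_cons[a2 /code_at_cons[a3 /code_at_cons[a4 /code_at_cons[a5 a6]]]]].
  rewrite /= => /code_at_cat[c1 /code_at_cons[b1 /code_at_cons[b2 /code_at_cons[b3 /code_at_cons[b4 b5]]]]] S.
  apply: (reach_instr a1); apply: (reach_instr a2); apply: (reach_instr a3) => /=.
  have Dt3 : NN < t.+3 by lia.
  pose acc k := \sum_(0 <= j < k) eval w e (setr i j s).
  (* Evaluation must not change [i], yet the loop overwrites it. Hence [sim_but] during the loop,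
     with the old value kept in [t.+1] and restored at the end. *)
  have loop n k R1 : k + n = size w -> sim_but i s R1 M -> R1 t.+2 = k ->
      R1 t = acc k -> R1 t.+1 = rg s i -> (forall u, NN < u -> u < t -> R1 u = R u) ->
      reach (Config p.+3 R1 M) (n * (ecost K (size w) e + 7) + 3)
        (done_expr (p + (size c + 11)) t s R M (acc (size w))).
    elim: n k R1 => [|n IHn] k R1 kn S1 vk va vs lo.
      apply: (reach_instr a4); apply: (reach_instr a5).
      rewrite /= eqxx (sim_but_size iD S1) vk -kn addn0 subnn /=.
      move: b5; rewrite (_ : (p + 6 + size c).+4 = p + 6 + size c + 4); last by lia.
      rewrite addn4 => b5; apply: (reach_instr b5); apply: reach0 => /=.
      have -> : (t.+1 == t.+3) = false by lia.
      have -> : (D == t.+3) = false by lia.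
      rewrite vs (sim_but_zero iD S1) addn0.
      have tN : (t == t.+3) = false /\ (t == i) = false by split; lia.
      apply: done_exprI => /=; rewrite ?tN.1 ?tN.2; first by lia.
      - exact: (sim_but_temp _ iD _ S1).
      - exact: va.
      - by move=> u Du ut; rewrite !ifN ?lo //; lia.
    rewrite (_ : _ + 3 = (ecost K (size w) e + (n * (ecost K (size w) e + 7) + 3).+4).+3);
      last by lia.
    apply: (reach_instr a4); apply: (reach_instr a5) => /=.
    rewrite eqxx (sim_but_size iD S1) vk ifN; last by lia.
    apply: (reach_instr a6) => /=.
    have -> : (t.+2 == t.+3) = false by lia.
    have -> : (D == t.+3) = false by lia.
    rewrite vk (sim_but_zero iD S1) addn0.
    set R2 := [eta _ with i |-> k].
    have S2 : sim (setr i k s) R2 M by apply: sim_set_but => //; apply: sim_but_temp.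
    rewrite (_ : p.+2.+4 = p + 6); last by lia.
    apply: (reach_bind (IH _ _ _ _ _ we Dt3 c1 S2)) => _ [R3 [-> S3 v3 l3]].
    have S3' := sim_but_setr iD S3.
    have R3E u : NN < u -> u < t.+3 -> R3 u = R1 u.
      by move=> Du ut; rewrite l3 //= !ifN //; lia.
    apply: (reach_instr b1); apply: (reach_instr b2); apply: (reach_instr b3).
    apply: (reach_instr b4) => /=.
    have -> : (D == t.+2) = false by lia.
    have -> : (D == t.+3) = false by lia.
    have -> : (D == t) = false by lia.
    rewrite (sim_but_zero iD S3') /= addn3; apply: (IHn k.+1) => /=; first by lia.
    - by do 3!(apply: sim_but_temp; [exact: iD|by lia|]).
    - have -> : (t.+2 == t.+3) = false by lia.
      have -> : (t.+2 == t) = false by lia.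
      by rewrite !eqxx R3E ?vk ?addn1 //; lia.
    - have -> : (t == t.+2) = false by lia.
      have -> : (t == t.+3) = false by lia.
      by rewrite eqxx v3 R3E ?va //= /acc ?big_nat_recr //; lia.
    - by rewrite !ifN ?R3E //; lia.
    - by move=> u Du ut; rewrite !ifN ?R3E ?lo //; lia.
  rewrite (_ : p + _ = p + (size c + 11)); last by rewrite size_cat /=; lia.
  rewrite -(big_mkord xpredT (fun k => eval w e (setr i k s))).
  have iN : i < D := iD.
  have tE : (t.+1 == t.+2) = false /\ (t == t.+2) = false by split; lia.
  have tE' : (i == t) = false /\ (D == t) = false by split; lia.
  apply: (loop (size w) 0) => //=.
  - do 3!(apply: sim_but_temp; [exact: iD|by lia|]).
    exact: sim_butW.
  - by rewrite eqxx.
  - by rewrite tE.2 ifN ?eqxx /acc ?big_geq //; lia.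
  - by rewrite tE.1 eqxx tE'.1 tE'.2 (sim_zero S) addn0 (sim_var S).
  - by move=> u Du ut; rewrite !ifN //; lia.
Qed.

Definition done_cmd p' t s R (s' : config) : Prop :=
  exists R' M', [/\ s' = Config p' R' M', sim s R' M' &
    forall u, NN < u -> u < t -> R' u = R u].

Lemma done_cmdI p p' t s R R' M' : p = p' -> sim s R' M' ->
  (forall u, NN < u -> u < t -> R' u = R u) ->
  done_cmd p' t s R (Config p R' M').
Proof. by move=> <- S low; exists R', M'. Qed.

Lemma addr_inj a b i j : a < K -> b < K -> i * K + a = j * K + b -> i = j /\ a = b.
Proof.
move=> aK bK E; have K0 : 0 < K by lia.
have ij : i = j.
  by have := congr1 (divn^~ K) E; rewrite /= !divnMDl // !divn_small // !addn0.
by split=> //; lia.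
Qed.

Lemma sim_seta a i v s R M : a < K -> sim s R M ->
  sim (seta a i v s) R [eta M with size w + (i * K + a) |-> v].
Proof.
move=> aK [sv sz sn si sa]; split=> //= [j jw|b j bK].
  by rewrite ifN ?si //; lia.
rewrite eqn_add2l; case: eqP => [E|E].
  by have [-> ->] := addr_inj bK aK E; rewrite !eqxx.
rewrite sa //; case: eqP => // ba; case: eqP => // ji.
by case: E; rewrite ba ji.
Qed.

Lemma sim_ext s R R' M : (forall r, r <= NN -> R' r = R r) -> sim s R M -> sim s R' M.
Proof.
move=> RR [sv sz sn si sa]; split=> // [x xD||]; rewrite RR //; [apply: sv => //|]; lia.
Qed.

Lemma ccmd_ok c p t s R M : wf_cmd c -> NN < t -> code_at p (ccmd p t c) ->
  sim s R M -> reach (Config p R M) (ccost K (size w) c)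
    (done_cmd (p + size (ccmd p t c)) t (sem w c s) R).
Proof.
elim: c p t s R M => /= [|x e|a e1 e2|c1 IH1 c2 IH2|e c1 IH1 c2 IH2|i c IH] p t s R M.
- by move=> _ Dt _ S; apply: reach0; apply: done_cmdI; rewrite ?addn0.
- move=> /andP[xD we] Dt /code_at_cat[d1 d2] S.
  apply: (reach_bind (cexp_ok we Dt d1 S)) => _ [R1 [-> S1 v1 l1]].
  apply: (reach_instr d2); apply: reach0 => /=; rewrite v1 (sim_zero S1) addn0.
  apply: done_cmdI; [by rewrite size_cat /=; lia|exact: sim_setr|].
  by move=> u Du ut /=; rewrite ifN ?l1 //; lia.
- move=> /and3P[aK w1 w2] Dt /code_at_cat[d1 /code_at_cat[d2 /code_at_cat[d3 d4]]] S.
  apply: (reach_bind (cexp_ok w1 Dt d1 S)) => _ [R1 [-> S1 v1 l1]].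
  have Dt1 : NN < t.+1 by lia.
  apply: (reach_bind (cexp_ok w2 Dt1 d2 S1)) => _ [R2 [-> S2 v2 l2]].
  rewrite addnS -addSn addnS -addSn.
  have Dt2 : NN < t.+2 by lia.
  have ut : t.+2 != t by lia.
  apply: (reach_caddr ut Dt2 (sim_size S2) d3) => R3 R3u R3o.
  rewrite size_caddr in d4; apply: (reach_instr d4); apply: reach0.
  rewrite /= R3u l2 ?v1 // R3o ?v2; last by lia.
  apply: done_cmdI; first by rewrite !size_cat size_caddr /=; lia.
    by apply: sim_seta => //; apply: sim_ext S2 => r rD; rewrite R3o //; lia.
  by move=> u Du ut'; rewrite R3o ?l2 ?l1 //; lia.
- move=> /andP[w1 w2] Dt /code_at_cat[d1 d2] S.
  apply: (reach_bind (IH1 _ _ _ _ _ w1 Dt d1 S)) => _ [R1 [M1 [-> S1 l1]]].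
  rewrite -[ccost K _ c2]addn0.
  apply: (reach_bind (IH2 _ _ _ _ _ w2 Dt d2 S1)) => _ [R2 [M2 [-> S2 l2]]].
  apply: reach0; apply: done_cmdI => //; first by rewrite size_cat; lia.
  by move=> u Du ut; rewrite l2 ?l1.
- move=> /and3P[we w1 w2] Dt /code_at_cat[d1 /code_at_cons[d2 /code_at_cat[d3 /code_at_cons[d4 d5]]]] S.
  apply: (reach_bind (cexp_ok we Dt d1 S)) => _ [R1 [-> S1 v1 l1]].
  apply: (reach_instr d2); rewrite /= v1; case: eqP => [_|_] /=.
    apply: (@reach_le _ (ccost K (size w) c2)); first by lia.
    rewrite -[ccost K (size w) c2]addn0.
    apply: (reach_bind (IH2 _ _ _ _ _ w2 Dt d5 S1)) => _ [R2 [M2 [-> S2 l2]]].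
    apply: reach0; apply: done_cmdI => //; first by rewrite !size_cat /= size_cat /=; lia.
    by move=> u Du ut; rewrite l2 ?l1.
  apply: (@reach_le _ (ccost K (size w) c1 + 1)); first by lia.
  apply: (reach_bind (IH1 _ _ _ _ _ w1 Dt d3 S1)) => _ [R2 [M2 [-> S2 l2]]].
  apply: (reach_instr d4); rewrite /= (sim_zero S2) /=; apply: reach0.
  apply: done_cmdI => //; first by rewrite !size_cat /= size_cat /=; lia.
  by move=> u Du ut; rewrite l2 ?l1.
move=> /andP[iD wc] Dt; rewrite -[[:: _, _, _, _ & _]]/([:: _; _; _; _] ++ _).
set d := ccmd (p + 4) t.+1 c; move=> /code_at_cat[].
move=> /code_at_cons[a1 /code_at_cons[a2 /code_at_cons[a3 a4]]].
rewrite /= => /code_at_cat[d1 /code_at_cons[b1 /code_at_cons[b2 b3]]] S.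
apply: (reach_instr a1) => /=.
have Dt1 : NN < t.+1 by lia.
have [NDt DDt] : (t == t.+1) = false /\ (D == t.+1) = false by split; lia.
pose f s k := sem w c (setr i k s).
have loop n k s1 R1 M1 : k + n = size w -> sim s1 R1 M1 -> R1 t = k ->
    (forall u, NN < u -> u < t -> R1 u = R u) ->
    reach (Config p.+1 R1 M1) (n * (ccost K (size w) c + 6) + 2)
      (done_cmd (p + (size d + 7)) t (foldl f s1 (iota k n)) R).
  elim: n k s1 R1 M1 => [|n IHn] k s1 R1 M1 kn S1 vk lo.
    apply: (reach_instr a2); apply: (reach_instr a3).
    rewrite /= eqxx (sim_size S1) vk -kn addn0 subnn /=.
    apply: reach0; apply: done_cmdI; [by lia|exact: sim_temp|].
    by move=> u Du ut /=; rewrite ifN ?lo //; lia.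
  rewrite (_ : _ + 2 = (ccost K (size w) c + (n * (ccost K (size w) c + 6) + 2).+3).+3);
    last by lia.
  apply: (reach_instr a2); apply: (reach_instr a3) => /=.
  rewrite eqxx (sim_size S1) vk ifN; last by lia.
  apply: (reach_instr a4) => /=; rewrite NDt DDt vk (sim_zero S1) addn0.
  set R2 := [eta _ with i |-> k].
  have S2 : sim (setr i k s1) R2 M1 by apply: sim_setr => //; apply: sim_temp.
  rewrite (_ : p.+4 = p + 4); last by lia.
  apply: (reach_bind (IH _ _ _ _ _ wc Dt1 d1 S2)) => _ [R3 [M3 [-> S3 l3]]].
  have R3E u : NN < u -> u < t.+1 -> R3 u = R1 u.
    by move=> Du ut; rewrite l3 //= !ifN //; lia.
  apply: (reach_instr b1); apply: (reach_instr b2); apply: (reach_instr b3) => /=.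
  have Dt0 : (D == t) = false by lia.
  rewrite Dt0 DDt (sim_zero S3) /=; apply: IHn => /=; first by lia.
  - by do 2!(apply: sim_temp; first by lia).
  - by rewrite !eqxx NDt R3E ?vk ?addn1 //; lia.
  - by move=> u Du ut; rewrite !ifN ?R3E ?lo //; lia.
rewrite (_ : p + _ = p + (size d + 7)); last by rewrite size_cat /=; lia.
apply: loop => //=; first exact: sim_temp.
  by rewrite eqxx.
by move=> u Du ut; rewrite ifN //; lia.
Qed.

End Compile.

(** The answer is left in variable 0. *)
Theorem compile_correct D K c : 0 < D -> wf_cmd D K c ->
  exists (P : program) (b d : nat), forall w : seq bool, exists t : nat,
    [/\ t <= b * size w ^ d + b, halted P (run P w t) &
        accepting (run P w t) = (rg (sem w c (state0 w)) 0 != 0)].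
Proof.
(* The input length is copied to its fixed register at once, since variable 0 may be overwritten
   later. *)
move=> D0 wc; pose P := Iadd D.+1 0 D :: ccmd D K 1 D.+2 c; exists P.
have [b [d bd]] := poly_add (poly_ccost K c) (poly_const 1); exists b, d => w.
have c1 : code_at P 0 [:: Iadd D.+1 0 D] by exists [::], (ccmd D K 1 D.+2 c).
have c2 : code_at P 1 (ccmd D K 1 D.+2 c).
  by exists [:: Iadd D.+1 0 D], [::]; rewrite cats0.
have [t tb [R [M [E S _]]]] : reach P (init w) (ccost K (size w) c).+1
    (done_cmd D K w (1 + size (ccmd D K 1 D.+2 c)) D.+2 (sem w c (state0 w))
              [eta (fun r => if r == 0 then size w else 0) with D.+1 |-> size w]).
  apply: (reach_instr c1); rewrite /= ifN ?addn0; last by lia.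
  rewrite -[ccost _ _ _]addn0; apply: reach_bind.
    apply: (@ccmd_ok D K w P c 1 D.+2 (state0 w)) => //; split=> //=.
    - by move=> x xD; rewrite ifN //; lia.
    - by rewrite !ifN //; lia.
    - by rewrite eqxx.
    - by move=> a i _; rewrite nth_default // leq_addr.
  by move=> s' H; apply: reach0.
exists t; split; rewrite /run ?E.
- by apply: leq_trans tb _; rewrite -addn1; apply: bd.
- by rewrite /halted /= add1n.
- by rewrite /accepting /= (sim_var S).
Qed.

(** * Reasoning about loops *)

Fixpoint writes_var c x : bool :=
  match c with
  | CSkip | CSto _ _ _ => false
  | CSet y _ => x == y
  | CSeq c1 c2 | CIf _ c1 c2 => writes_var c1 x || writes_var c2 x
  | CFor i c => (x == i) || writes_var c x
  end.

Fixpoint writes_arr c a : bool :=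
  match c with
  | CSkip | CSet _ _ => false
  | CSto b _ _ => a == b
  | CSeq c1 c2 | CIf _ c1 c2 => writes_arr c1 a || writes_arr c2 a
  | CFor _ c => writes_arr c a
  end.

Fixpoint reads_arr e a : bool :=
  match e with
  | EV _ | EC _ | EN => false
  | EAdd e1 e2 | ESub e1 e2 => reads_arr e1 a || reads_arr e2 a
  | EArr b e => (a == b) || reads_arr e a
  | EIn e | ESum _ e => reads_arr e a
  | EIf e e1 e2 => [|| reads_arr e a, reads_arr e1 a | reads_arr e2 a]
  end.

Section Loops.

Variable w : seq bool.
Local Notation N := (size w).
Local Notation T := 'I_(size w).

Lemma for_ind i c (P : nat -> state -> Prop) s : P 0 s ->
  (forall (k : T) s', P k s' -> P k.+1 (sem w c (setr i k s'))) ->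
  P N (sem w (CFor i c) s).
Proof.
move=> P0 PS /=; pose f s k := sem w c (setr i k s).
suff: forall n k s', k + n = N -> P k s' -> P (k + n) (foldl f s' (iota k n)).
  by move=> /(_ N 0 s erefl P0).
elim=> [|n IH] k s' kn Pk; first by rewrite addn0.
rewrite -addSnnS; apply: IH; first by rewrite addSnnS.
have kN : k < N by rewrite -kn addnS ltnS leq_addr.
exact: (PS (Ordinal kN)).
Qed.

Lemma sem_var c s x : ~~ writes_var c x -> rg (sem w c s) x = rg s x.
Proof.
elim: c s => //= [y e|c1 IH1 c2 IH2|e c1 IH1 c2 IH2|i c IH] s.
- by move/negPf->.
- by rewrite negb_or => /andP[h1 h2]; rewrite IH2 ?IH1.
- by rewrite negb_or => /andP[h1 h2]; case: ifP => _; rewrite ?IH2 ?IH1.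
rewrite negb_or => /andP[/negPf xi h].
apply: (@for_ind i c (fun _ s' => rg s' x = rg s x)) => // k s' E.
by rewrite IH //= xi.
Qed.

Lemma sem_arr c s a : ~~ writes_arr c a -> ar (sem w c s) a = ar s a.
Proof.
elim: c s => //= [b e1 e2|c1 IH1 c2 IH2|e c1 IH1 c2 IH2|i c IH] s.
- by move/negPf->.
- by rewrite negb_or => /andP[h1 h2]; rewrite IH2 ?IH1.
- by rewrite negb_or => /andP[h1 h2]; case: ifP => _; rewrite ?IH2 ?IH1.
move=> h; apply: (@for_ind i c (fun _ s' => ar s' a = ar s a)) => // k s' E.
by rewrite IH.
Qed.

Lemma eval_ext e a s1 s2 : ~~ reads_arr e a -> rg s1 =1 rg s2 ->
  (forall b, b != a -> ar s1 b =1 ar s2 b) -> eval w e s1 = eval w e s2.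
Proof.
elim: e s1 s2 => //= [e1 IH1 e2 IH2|e1 IH1 e2 IH2|b e IH|e IH|e IH e1 IH1 e2 IH2|i e IH]
  s1 s2.
- by rewrite negb_or => /andP[h1 h2] E F; rewrite (IH1 s1 s2) ?(IH2 s1 s2).
- by rewrite negb_or => /andP[h1 h2] E F; rewrite (IH1 s1 s2) ?(IH2 s1 s2).
- rewrite negb_or => /andP[h1 h2] E F; rewrite (IH s1 s2) // F //.
  by rewrite eq_sym.
- by move=> h E F; rewrite (IH s1 s2).
- rewrite !negb_or => /and3P[h1 h2 h3] E F.
  by rewrite (IH s1 s2) // (IH1 s1 s2) // (IH2 s1 s2).
move=> h E F; apply: eq_bigr => k _; apply: IH => // x /=.
by case: eqP.
Qed.

(** As [e] does not read the array being filled, the rounds are independent and [e] may be evaluated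
    in the initial state. *)
Lemma for_tab i a e s (k : T) : ~~ reads_arr e a ->
  ar (sem w (CFor i (CSto a (EV i) e)) s) a k = eval w e (setr i k s).
Proof.
move=> h; pose P n s' := [/\ forall x, x != i -> rg s' x = rg s x,
  forall b, b != a -> ar s' b = ar s b &
  forall j : T, j < n -> ar s' a j = eval w e (setr i j s)].
suff [_ _] : P N (sem w (CFor i (CSto a (EV i) e)) s) by apply.
apply: for_ind => [|n s' [E F G]]; first by split.
split=> [x xi|b ba|j].
- by rewrite /= (negPf xi) E.
- by rewrite /= (negPf ba) F.
rewrite ltnS leq_eqVlt /= !eqxx => /orP[/eqP->|jn]; last by rewrite ltn_eqF // G.
rewrite eqxx; apply: (eval_ext h) => [x|b ba] /=; last by rewrite F.
by case: eqP => // /eqP; apply: E.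
Qed.

(** Two nested loops, repeated until nothing can be improved: [Done] means that
    the body has nothing to do for the pair [i, j]. *)
Section Sweep.

Variables (r p q : nat) (body : cmd).
Variables (Inv : state -> Prop) (mu : state -> nat).
Variables (Done : state -> T -> T -> Prop) (B : nat).

Hypothesis stable : forall x v s, x \in [:: r; p; q] -> Inv s ->
  [/\ Inv (setr x v s), mu (setr x v s) = mu s &
      forall i j, Done (setr x v s) i j <-> Done s i j].
Hypothesis body_step : forall (i j : T) s, Inv s -> rg s p = i -> rg s q = j ->
  let s' := sem w body s in Inv s' /\
  ((Done s i j /\ mu s <= mu s' /\ forall i' j', Done s' i' j' <-> Done s i' j') \/
   (~ Done s i j /\ mu s < mu s')).
Hypothesis mu_bound : forall s, Inv s -> mu s <= B.
Hypotheses (body_p : ~~ writes_var body p) (pq : p != q).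

Let all_done s := forall i j, Done s i j.

(** [D] holds the pairs visited since [s]: either [mu] has grown, or [Done] is unchanged and all
    visited pairs were done. *)
Let progress (D : T -> T -> Prop) s s' :=
  [/\ Inv s', mu s <= mu s', all_done s -> all_done s' &
      mu s < mu s' \/ (forall i j, Done s' i j <-> Done s i j) /\
                      (forall i j, D i j -> Done s i j)].

Lemma progress_setr D x v s s' : x \in [:: r; p; q] -> progress D s s' ->
  progress D s (setr x v s').
Proof.
move=> xr [I M A E]; have [I' M' D'] := stable v xr I.
split; rewrite ?M' //.
  by move=> /A A' i j; apply/D'.
case: E => [E|[E1 E2]]; [by left | right; split=> // i j].
by split=> [/D'/E1|/E1/D'].
Qed.

Lemma sweep_once s : Inv s ->
  progress (fun _ _ => True) s (sem w (CFor p (CFor q body)) s).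
Proof.
move=> I.
have weak D D' s1 s2 : (forall i j, D' i j -> D i j) -> progress D s1 s2 -> progress D' s1 s2.
  move=> DD [h1 h2 h3 h4]; split=> //; case: h4 => [h|[h h']]; [by left|right].
  by split=> // i j /DD; apply: h'.
suff : progress (fun i _ => i < N) s (sem w (CFor p (CFor q body)) s).
  by apply: weak => i j _.
apply: (@for_ind p _ (fun n s' => progress (fun i _ => i < n) s s')).
  by split=> //; right; split.
move=> n s' /(progress_setr n (x := p)); rewrite !inE eqxx orbT => /(_ isT) H.
have H0 : progress (fun i j => i < n \/ i = n /\ j < 0) s (setr p n s').
  by apply: weak H => i j [|[]].
suff [_] : rg (sem w (CFor q body) (setr p n s')) p = n /\
    progress (fun i j => i < n \/ i = n /\ j < N) s (sem w (CFor q body) (setr p n s')).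
  apply: weak => i j; rewrite ltnS leq_eqVlt => /orP[/eqP/val_inj->|]; last by left.
  by right.
apply: (@for_ind q _ (fun k s2 => rg s2 p = n /\
   progress (fun i j => i < n \/ i = n /\ j < k) s s2)).
  by split=> //=; rewrite eqxx.
move=> k s2 [pn /(progress_setr k (x := q))]; rewrite !inE eqxx !orbT => /(_ isT).
set s3 := setr q k s2 => -[I3 M3 A3 E3].
have p3 : rg s3 p = n by rewrite /= (negPf pq).
have q3 : rg s3 q = k by rewrite /= eqxx.
have [I4 step] := body_step I3 p3 q3.
split; first by rewrite sem_var.
case: step => [[Dnk [M4 D4]]|[nD M4]]; split=> //.
- exact: leq_trans M4.
- by move=> /A3 A i j; apply/D4.
- case: E3 => [h|[h1 h2]]; [by left; apply: leq_trans M4|right; split=> i j].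
    by split=> [/D4/h1|/h1/D4].
  case=> [ilt|[-> jk]]; first by apply: h2; left.
  move: jk; rewrite ltnS leq_eqVlt => /orP[/eqP/val_inj->|jk]; first exact/h1.
  by apply: h2; right.
- by apply: leq_trans (ltnW M4).
- by move=> /A3 A; case: nD.
- by left; apply: leq_ltn_trans M4.
Qed.

(** A round that does not reach the goal raises [mu], and there is no room for [N] such rounds below
    [B]. *)
Lemma sweep s : Inv s -> B < mu s + N ->
  let s' := sem w (CFor r (CFor p (CFor q body))) s in
  Inv s' /\ forall i j, Done s' i j.
Proof.
move=> I BN.
have [I' [//|muN]] : Inv (sem w (CFor r (CFor p (CFor q body))) s) /\
    (all_done (sem w (CFor r (CFor p (CFor q body))) s) \/
     mu s + N <= mu (sem w (CFor r (CFor p (CFor q body))) s)).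
  apply: (@for_ind r _ (fun n s' => Inv s' /\ (all_done s' \/ mu s + n <= mu s'))).
    by split=> //; right; rewrite addn0.
  move=> n s1 [I1 H1]; have rin : r \in [:: r; p; q] by rewrite inE eqxx.
  have [I2 M2 D2] := stable n rin I1; have [I3 M3 A3 E3] := sweep_once I2.
  split=> //; case: H1 => [A1|H1]; first by left; apply: A3 => i j; apply/D2.
  case: E3 => [E3|[E3 E4]]; last by left=> i j; apply/E3/E4.
  by right; rewrite addnS; apply: leq_ltn_trans E3; rewrite M2.
by have := leq_trans BN (leq_trans muN (mu_bound I')); rewrite ltnn.
Qed.

End Sweep.

End Loops.

Lemma sem_set w x e s : sem w (CSet x e) s = setr x (eval w e s) s.
Proof. by []. Qed.

Lemma sem_sto w a e1 e2 s :
  sem w (CSto a e1 e2) s = seta a (eval w e1 s) (eval w e2 s) s.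
Proof. by []. Qed.

Lemma sem_seq w c1 c2 s : sem w (CSeq c1 c2) s = sem w c2 (sem w c1 s).
Proof. by []. Qed.

Lemma sem_if w e c1 c2 s :
  sem w (CIf e c1 c2) s = if eval w e s != 0 then sem w c1 s else sem w c2 s.
Proof. by []. Qed.

Arguments sem : simpl never.

(** * The program *)

Declare Scope prog_scope.
Notation "$ x" := (EV x) (at level 5, format "$ x") : prog_scope.
Notation "c1 ;; c2" := (CSeq c1 c2) (at level 90, right associativity) : prog_scope.
Local Open Scope prog_scope.

Definition EAnd a b := EIf a b (EC 0).
Definition ENot a := EIf a (EC 0) (EC 1).
Definition ELt a b := EIf (ESub b a) (EC 1) (EC 0).
Definition EEq a b := ENot (EAdd (ESub a b) (ESub b a)).

Local Notation vk := 0 (only parsing).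

(** The index [x * N + y]. Products are sums: [N] is added once for every [k] below [x], which is
    correct as long as [x] does not exceed [N]. *)
Definition EIdx x y := EAdd (ESum vk (EIf (ESub ($x) ($vk)) EN (EC 0))) ($y).

Section Expressions.

Variable w : seq bool.
Local Notation N := (size w).
Local Notation T := 'I_(size w).

Lemma eval_EArr a f s : eval w (EArr a f) s = ar s a (eval w f s).
Proof. by []. Qed.

Lemma eval_EIf f a b s :
  eval w (EIf f a b) s = if eval w f s != 0 then eval w a s else eval w b s.
Proof. by []. Qed.

Lemma eval_ENot a s : eval w (ENot a) s = (eval w a s == 0).
Proof. by rewrite /=; case: eqP. Qed.

Lemma eval_ELt a b s : eval w (ELt a b) s = (eval w a s < eval w b s).
Proof. by rewrite /= subn_eq0 -ltnNge; case: ifP. Qed.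

Lemma eval_EEq a b s : eval w (EEq a b) s = (eval w a s == eval w b s).
Proof. by rewrite eval_ENot /= addn_eq0 !subn_eq0 -eqn_leq. Qed.

Lemma eval_EAnd a b s (P Q : bool) : eval w a s = P -> (P -> eval w b s = Q) ->
  eval w (EAnd a b) s = P && Q.
Proof. by rewrite /= => ->; case: P => //= ->. Qed.

Lemma sum_lt_const (k c : nat) : k <= N -> \sum_(i < N) (if k - i != 0 then c else 0) = k * c.
Proof.
move=> kN; rewrite (eq_bigr (fun i : 'I_N => if i < k then c else 0)); last first.
  by move=> i _; rewrite subn_eq0 -ltnNge.
by rewrite -big_mkcond (big_ord_narrow kN) sum_nat_const card_ord.
Qed.

Lemma eval_EIdx x y s : x != vk -> rg s x <= N ->
  eval w (EIdx x y) s = rg s x * N + rg s y.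
Proof. by move=> xk xN; rewrite /= (negPf xk) sum_lt_const. Qed.

Lemma pair_eq (b t b' t' : T) : (b * N + t == b' * N + t') = (b == b') && (t == t').
Proof.
apply/eqP/andP=> [E|[/eqP-> /eqP->]] //.
have N0 : 0 < N := leq_ltn_trans (leq0n t) (ltn_ord t).
have bb : b = b' :> nat.
  by have := congr1 (divn^~ N) E; rewrite /= !divnMDl // !divn_small // !addn0.
by move: E; rewrite bb => /addnI tt; split; apply/eqP/val_inj.
Qed.

Lemma for_row b t a e s (i j k : T) : b != t -> b != vk -> ~~ reads_arr e a ->
  rg s b = i -> ar (sem w (CFor t (CSto a (EIdx b t) e)) s) a (j * N + k) =
    if j == i then eval w e (setr t k s) else ar s a (j * N + k).
Proof.
move=> bt bk h bi; pose P n s' := [/\ forall x, x != t -> rg s' x = rg s x,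
  forall c, c != a -> ar s' c = ar s c &
  forall j k : T, ar s' a (j * N + k) =
    if (j == i) && (k < n) then eval w e (setr t k s) else ar s a (j * N + k)].
suff [_ _] : P N (sem w (CFor t (CSto a (EIdx b t) e)) s).
  by move=> ->; rewrite ltn_ord andbT.
apply: for_ind => [|n s' [E F G]].
  by split=> // j' k'; rewrite ltn0 andbF.
split=> [x xt|c ca|j' k'].
- by rewrite sem_sto /= (negPf xt) E.
- by rewrite sem_sto /= (negPf ca) F.
have bn : rg (setr t n s') b = i by rewrite /= (negPf bt) E.
have st : rg (setr t n s') t = n by rewrite /= eqxx.
have ix : eval w (EIdx b t) (setr t n s') = i * N + n.
  by rewrite eval_EIdx ?bn ?st // ltnW.
rewrite sem_sto ix /= eqxx pair_eq.
have -> : (k' < n.+1) = (k' == n) || (k' < n) by rewrite ltnS leq_eqVlt.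
rewrite G; case: (j' == i) => //=; have [->|_] //= := eqVneq k' n.
by apply: (eval_ext w h) => [x|c ca] /=; [case: eqP => // /eqP; apply: E | rewrite F].
Qed.

Lemma for_tab2 b t a e s (j k : T) : b != t -> b != vk -> ~~ reads_arr e a ->
  ar (sem w (CFor b (CFor t (CSto a (EIdx b t) e))) s) a (j * N + k) =
    eval w e (setr t k (setr b j s)).
Proof.
move=> bt bk h; set c := CFor t _.
pose P n s' := [/\ forall x, x != t -> x != b -> rg s' x = rg s x,
  forall c, c != a -> ar s' c = ar s c &
  forall j k : T, j < n ->
    ar s' a (j * N + k) = eval w e (setr t k (setr b j s))].
suff [_ _] : P N (sem w (CFor b c) s) by apply.
apply: for_ind => [|n s' [E F G]]; first by split.
have cn : rg (setr b n s') b = n by rewrite /= eqxx.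
split=> [x xt xb|d da|j' k' jn].
- by rewrite sem_var /= ?(negPf xt) ?(negPf xb) ?E.
- by rewrite sem_arr /= ?(negPf da) // F.
rewrite (for_row j' k' bt bk h cn); case: eqP => [->|jn'].
  apply: (eval_ext w h) => [x|d da] /=; last by rewrite F.
  by case: eqP => // /eqP xt; case: eqP => // /eqP xb; apply: E.
by apply: G; move: jn; rewrite ltnS leq_eqVlt => /orP[/eqP/val_inj|].
Qed.

(** All numbers below the length of the input serve as vertices; those that do
    not code a vertex of the input graph are isolated in [e] and outside all sets. *)
Definition rep a (X : {set T}) s : Prop := forall v : T, ar s a v = (v \in X).
Definition repf a (M : T -> T) s : Prop := forall v : T, ar s a v = M v.
Definition rep2 a (R : rel T) s : Prop := forall u v : T, ar s a (u * N + v) = R u v.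

Lemma repE a (X : {set T}) s : rep a X s -> [set v : T | ar s a v != 0] = X.
Proof. by move=> H; apply/setP=> v; rewrite inE H; case: (v \in X). Qed.

Lemma sum_rep (X : {set T}) : \sum_(v < N) (v \in X) = #|X|.
Proof. by rewrite -sum1_card [RHS]big_mkcond; apply: eq_bigr => v _; case: ifP. Qed.

End Expressions.

(** Variable [vk] is bound in products; [vf] is the answer of [c_test].  [aE] is
    the matrix of [e]; [c_test] decides whether the matching [aM2] is not maximum
    in the subgraph [aL2], with [aO], [aC] and [aS] for the components of
    [forest]. *)
Local Notation vr := 1 (only parsing).
Local Notation vp := 2 (only parsing).
Local Notation vq := 3 (only parsing).
Local Notation vb := 4 (only parsing).
Local Notation vt := 5 (only parsing).
Local Notation vm := 6 (only parsing).
Local Notation vf := 7 (only parsing).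
Local Notation vv := 8 (only parsing).

Local Notation aE := 0 (only parsing).
Local Notation aL2 := 1 (only parsing).
Local Notation aM2 := 2 (only parsing).
Local Notation aO := 3 (only parsing).
Local Notation aC := 4 (only parsing).
Local Notation aS := 5 (only parsing).

Definition c_shrink :=
  CFor vb (CIf (EAnd (EArr aC ($vb))
                     (ENot (EEq (EArr aS (EIdx vb vp)) (EArr aS (EIdx vb vq)))))
             (CIf (EEq (EArr aM2 ($vb)) ($vb))
                (CSet vf (EC 1))
                (CSto aO (EArr aM2 ($vb)) (EC 1) ;; CSto aC ($vb) (EC 0)))
             CSkip).

(** Hanging [q] and [m] from [p] means copying column [p] of [aS] to their columns; row [m] becomes
    a singleton. *)
Definition c_grow :=
  CSet vm (EArr aM2 ($vq)) ;; CSto aO ($vm) (EC 1) ;; CSto aC ($vm) (EC 1) ;;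
  CFor vb (CIf (EEq ($vb) ($vm))
             (CFor vt (CSto aS (EIdx vb vt) (EEq ($vt) ($vm))))
             (CSto aS (EIdx vb vq) (EArr aS (EIdx vb vp)) ;;
              CSto aS (EIdx vb vm) (EArr aS (EIdx vb vp)))).

Definition c_test_body :=
  CIf (EAnd (ENot ($vf)) (EAnd (EArr aO ($vp)) (EAnd (EArr aL2 ($vq)) (EArr aE (EIdx vp vq)))))
    (CIf (EArr aO ($vq)) c_shrink (CIf (EArr aC (EArr aM2 ($vq))) CSkip c_grow))
    CSkip.

Definition c_test_init :=
  CSet vf (EC 0) ;;
  CFor vv (CSto aO ($vv) (EAnd (EArr aL2 ($vv)) (EEq (EArr aM2 ($vv)) ($vv)))) ;;
  CFor vv (CSto aC ($vv) (EArr aO ($vv))) ;;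
  CFor vb (CFor vt (CSto aS (EIdx vb vt) (EEq ($vb) ($vt)))).

Definition c_test :=
  c_test_init ;; CFor vr (CFor vp (CFor vq c_test_body)).

(** * Correctness of the maximality test *)

Section TestCorrect.

Variables (w : seq bool).
Local Notation N := (size w).
Local Notation T := 'I_(size w).
Variables (e : rel T) (L : {set T}) (M : T -> T).
Hypotheses (esym : symmetric e) (eirr : irreflexive e).
Hypotheses (ML : closed_mate e L M) (LN : #|L|.+1 < N).

Definition test_env s := [/\ rep2 aE e s, rep aL2 L s & repf aM2 M s].

Lemma test_env_frame c s : ~~ writes_arr c aE -> ~~ writes_arr c aL2 ->
  ~~ writes_arr c aM2 -> test_env s -> test_env (sem w c s).
Proof.
by move=> h1 h2 h3 [E1 E2 E3]; split=> [u v|v|v]; rewrite sem_arr.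
Qed.

Definition test_forest s (O C : {set T}) (S : T -> {set T}) : Prop :=
  [/\ rep aO O s, rep aC C s, rep2 aS (fun b t => t \in S b) s & forest e L M O C S].

Definition test_inv s : Prop :=
  test_env s /\ if rg s vf == 0 then exists O C S, test_forest s O C S
                else improvable e L M.

Lemma test_init_ok s : test_env s -> test_inv (sem w c_test_init s).
Proof.
move=> E; split; first exact: test_env_frame.
have -> : rg (sem w c_test_init s) vf = 0 by rewrite /c_test_init sem_seq sem_var.
rewrite eqxx; exists (roots L M), (roots L M), (fun b => [set b]).
rewrite /c_test_init; set c1 := CFor vv _; set c2 := CFor vv _; set c3 := CFor vb _.
rewrite !sem_seq sem_set -/c1 -/c2 -/c3 [eval _ _ _]/=.
set s1 := sem w c1 _; set s2 := sem w c2 _.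
have r1 : rep aO (roots L M) s1.
  move=> v; rewrite /s1 /c1 for_tab //.
  have [_ EL EM] := E; rewrite (eval_EAnd (P := v \in L) (Q := M v == v)) ?inE //.
    by rewrite /= EL.
  by move=> _; rewrite eval_EEq /= EM.
have r2 : rep aC (roots L M) s2 by move=> v; rewrite /s2 /c2 for_tab //= r1.
split.
- by move=> v; rewrite sem_arr // sem_arr.
- by move=> v; rewrite sem_arr.
- by move=> b t; rewrite /c3 for_tab2 // eval_EEq /= inE eq_sym.
by apply: forest_init.
Qed.

(** Round [k] sees row [k] of [aS] and entry [k] of [aC] in their original form, because earlier
    rounds only remove smaller bases. If a root separates, the arrays may be left inconsistent; from
    then on only the flag matters. *)
Lemma shrink_ok s (O C : {set T}) (S : T -> {set T}) (p q : T) :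
  test_env s -> test_forest s O C S -> rg s vf = 0 -> rg s vp = p -> rg s vq = q ->
  let Z := separating C S p q in let s' := sem w c_shrink s in
  (exists2 b, b \in Z & M b = b) /\ rg s' vf != 0 \/
  [/\ {in Z, forall b, M b != b}, rg s' vf = 0, rep aC (C :\: Z) s' &
      rep aO (O :|: [set t | M t \in Z]) s'].
Proof.
move=> [E1 E2 E3] [F1 F2 F3 FF] v0 vpE vqE Z s'.
pose P n s' := [/\ [/\ rg s' vp = p, rg s' vq = q, ar s' aS = ar s aS & ar s' aM2 = ar s aM2],
  rg s' vf != 0 <-> exists b, [/\ b \in Z, b < n & M b = b],
  forall t : T, ar s' aO t = (t \in O) || [&& M t \in Z, M t < n & t != M t] &
  forall t : T, ar s' aC t = (t \in C) && ~~ [&& t \in Z, t < n & M t != t]].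
suff [_ vfP OP CP] : P N s'.
  case vfE: (rg s' vf != 0).
    by left; split=> //; have /vfP[b [bZ _ Mb]] := vfE; exists b.
  have nZ : {in Z, forall b, M b != b}.
    move=> b bZ; apply/eqP=> Mb; have /vfP : exists b, [/\ b \in Z, b < N & M b = b] by exists b.
    by rewrite vfE.
  right; split=> //.
  - by apply/eqP; move/negbFE: vfE.
  - move=> t; rewrite CP ltn_ord in_setD /= andbC; case tZ: (t \in Z) => //=.
    by rewrite nZ.
  move=> t; rewrite OP ltn_ord !inE /=; case tZ: (M t \in Z); last by rewrite inE in tZ; rewrite tZ.
  move: (tZ); rewrite inE => ->; have := nZ _ tZ; rewrite ML.1.1 => ->.
  by rewrite orbT.
apply: for_ind.
  split=> //; first by rewrite v0; split=> // -[b []]; rewrite ltn0.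
    by move=> t; rewrite F1 ltn0 /= andbF orbF.
  by move=> t; rewrite F2 ltn0 /= andbF andbT.
move=> k s1 [[p1 q1 S1 M1] vfP OP CP]; rewrite sem_if.
have Ek x y : rg s1 x = y -> x != vk -> x != vb -> y < N ->
    eval w (EIdx vb x) (setr vb k s1) = k * N + y.
  move=> xy xk xb yN; rewrite eval_EIdx //=; last exact: ltnW.
  by rewrite (negPf xb) xy.
have kZ : (k \in Z) = (k \in C) && ((p \in S k) != (q \in S k)) by rewrite inE.
have -> : eval w (EAnd (EArr aC ($vb))
    (ENot (EEq (EArr aS (EIdx vb vp)) (EArr aS (EIdx vb vq))))) (setr vb k s1) = (k \in Z).
  rewrite kZ; apply: eval_EAnd => [|kC].
    by rewrite /= CP ltnn !andbF andbT.
  rewrite eval_ENot eval_EEq; set i1 := eval _ _ _; set i2 := eval _ _ _.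
  have -> : i1 = (p \in S k) by rewrite /i1 eval_EArr (Ek _ _ p1) //= S1 F3.
  have -> : i2 = (q \in S k) by rewrite /i2 eval_EArr (Ek _ _ q1) //= S1 F3.
  by case: (p \in _); case: (q \in _).
have ltS (t : T) : (t < k.+1) = (t == k) || (t < k) by rewrite ltnS leq_eqVlt.
have [kZ'|kZ'] := boolP (k \in Z); last first.
  rewrite /=; split=> //.
  - split=> [/vfP[b [bZ bk Mb]]|[b [bZ bk Mb]]]; first by exists b; rewrite ltS bk orbT.
    apply/vfP; exists b; split=> //; move: bk; rewrite ltS => /orP[/eqP bk|//].
    by move: kZ'; rewrite -bk bZ.
  - move=> t; rewrite /= OP ltS; case tk: (M t == k) => //=.
    by rewrite (eqP tk) (negPf kZ').
  - move=> t; rewrite /= CP ltS; case tk: (t == k) => //=.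
    by rewrite (eqP tk) (negPf kZ').
rewrite [_ != 0]/= sem_if eval_EEq /=.
have -> : ar s1 aM2 k = M k by rewrite M1 E3.
case: (eqVneq (M k) k) => [Mk|Mk].
  rewrite Mk eqxx sem_set /=; split=> //=.
  - by split=> // _; exists k; rewrite ltS eqxx.
  - move=> t; rewrite OP ltS; case tk: (M t == k) => //=.
    have -> : t = k by rewrite -[t]ML.1.1 (eqP tk) Mk.
    by rewrite Mk eqxx !andbF.
  - move=> t; rewrite CP ltS; case tk: (t == k) => //=.
    by rewrite (eqP tk) Mk eqxx !andbF.
have -> : (nat_of_ord (M k) == nat_of_ord k) = false by apply/negbTE.
rewrite sem_seq !sem_sto /=.
have -> : ar s1 aM2 k = M k by rewrite M1 E3.
split=> //=.
- split=> [/vfP[b [bZ bk Mb]]|[b [bZ bk Mb]]]; first by exists b; rewrite ltS bk orbT.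
  apply/vfP; exists b; split=> //; move: bk; rewrite ltS => /orP[/eqP bk|//].
  by move: Mk; rewrite -bk Mb eqxx.
- move=> t; rewrite OP ltS (inj_eq (@ord_inj N)) -(can2_eq ML.1.1 ML.1.1).
  case: eqP => [tk|_] //=; rewrite tk kZ' /=.
  have -> : t = M k by rewrite -tk ML.1.1.
  by rewrite Mk orbT.
- move=> t; rewrite CP ltS (inj_eq (@ord_inj N)).
  by case: eqP => [->|_] //=; rewrite kZ' Mk andbF.
Qed.

Lemma grow_ok s (O C : {set T}) (S : T -> {set T}) (p q : T) :
  test_env s -> test_forest s O C S -> rg s vp = p -> rg s vq = q ->
  p \in O -> q \in L -> e p q -> q \notin O -> M q \notin C ->
  exists S', test_forest (sem w c_grow s) (M q |: O) (M q |: C) S'.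
Proof.
move=> [E1 E2 E3] [F1 F2 F3 FF] vpE vqE pO qL epq qO MqC.
(* Column [p] is read again after column [q] has been overwritten. *)
have pq : p != q by apply: contraNneq qO => <-.
pose m := M q.
pose S' b := [set t | if b == m then t == m else
  if (t == q) || (t == m) then p \in S b else t \in S b].
exists S'.
have FG : forest e L M (m |: O) (m |: C) S'.
  by apply: (forest_grow ML.1 ML.2 FF pO qL epq qO MqC) => b t _; rewrite inE.
have defm : ar s aM2 q = m by rewrite E3.
rewrite /c_grow !sem_seq sem_set !sem_sto /= vqE defm.
set s3 := seta aC _ _ _; set c := CIf _ _ _.
have [p3 q3 m3] : [/\ rg s3 vp = p, rg s3 vq = q & rg s3 vm = m] by [].
have S3 (b t : T) : ar s3 aS (b * N + t) = (t \in S b) by exact: F3.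
split=> //.
- move=> t; rewrite sem_arr //= in_setU1 -(inj_eq (@ord_inj N)).
  by case: eqP => // _; rewrite F1.
- move=> t; rewrite sem_arr //= in_setU1 -(inj_eq (@ord_inj N)).
  by case: eqP => // _; rewrite F2.
pose P n s' := [/\ rg s' vp = p, rg s' vq = q, rg s' vm = m &
  forall b t : T, ar s' aS (b * N + t) = if b < n then t \in S' b else t \in S b].
suff [_ _ _ SP] : P N (sem w (CFor vb c) s3) by move=> b t; rewrite SP ltn_ord.
apply: for_ind => [|k s1 [p1 q1 m1 SP]]; first by split.
have ltS (b : T) : (b < k.+1) = (b == k) || (b < k) by rewrite ltnS leq_eqVlt.
split; try by rewrite sem_var.
move=> b t; rewrite /c sem_if eval_EEq /= m1 (inj_eq (@ord_inj N)) ltS.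
have [km|km] := eqVneq k m.
  rewrite (@for_row _ _ _ _ _ _ k) // eval_EEq /= m1 SP.
  by have [->|bk] //= := eqVneq b k; rewrite inE km eqxx (inj_eq (@ord_inj N)).
have ix x y s0 : rg s0 vb = k -> rg s0 x = y -> eval w (EIdx vb x) s0 = k * N + y.
  by move=> h1 h2; rewrite eval_EIdx ?h1 ?h2 // ltnW.
have kk : (k < k) = false by rewrite ltnn.
rewrite sem_seq !sem_sto; set s2 := setr vb k s1.
rewrite (ix vq q s2) // eval_EArr (ix vp p s2) //.
rewrite [ar s2 aS _]SP kk; set s4 := seta aS _ _ s2.
have h4 : rg s4 vb = k by [].
rewrite (ix vm m s4) // eval_EArr (ix vp p s4) //.
have -> : ar s4 aS (k * N + p) = (p \in S k).
  by rewrite /= pair_eq eqxx (negPf pq) /= SP kk.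
rewrite /= !pair_eq SP; have [->|bk] //= := eqVneq b k.
by rewrite inE (negPf km) kk; case: (t == m); case: (t == q).
Qed.

(** With the flag set, every pair counts as done and the remaining rounds idle; otherwise this is
    [forest_closed] for a single pair, in terms of the arrays. *)
Definition test_done s (i j : T) : Prop :=
  rg s vf != 0 \/
  (ar s aO i != 0 -> j \in L -> e i j ->
   if ar s aO j != 0
   then forall b : T, ar s aC b != 0 -> ar s aS (b * N + i) = ar s aS (b * N + j)
   else ar s aC (M j) != 0).

(** Growing and shrinking both enlarge the outer set; success is valued one higher than any outer
    set can be. *)
Definition test_mu s : nat :=
  if rg s vf != 0 then #|L|.+1 else #|[set v : T | ar s aO v != 0]|.

Lemma b2n_neq0 (b : bool) : ((b : nat) != 0) = b. Proof. by case: b. Qed.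

Lemma test_body_ok (i j : T) s : test_inv s -> rg s vp = i -> rg s vq = j ->
  let s' := sem w c_test_body s in test_inv s' /\
  ((test_done s i j /\ test_mu s <= test_mu s' /\
      forall i' j', test_done s' i' j' <-> test_done s i' j') \/
   (~ test_done s i j /\ test_mu s < test_mu s')).
Proof.
move=> [E I] vpE vqE s'; have E' : test_env s' by exact: test_env_frame.
have [E1 E2 E3] := E.
have ix : eval w (EIdx vp vq) s = i * N + j.
  by rewrite eval_EIdx ?vpE ?vqE // ltnW.
case vfE : (rg s vf == 0) I => I; last first.
  have -> : s' = s.
    rewrite /s' /c_test_body sem_if.
    have -> : eval w (EAnd (ENot ($vf)) (EAnd (EArr aO ($vp)) (EAnd (EArr aL2 ($vq)) (EArr aE (EIdx vp vq))))) s = false.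
      by apply: (eval_EAnd (P := false) (Q := true)) => //; rewrite eval_ENot /= vfE.
    by [].
  by split; [split=> //; rewrite vfE | left; split=> //; left; rewrite vfE].
have [O [C [S FS]]] := I; have [F1 F2 F3 FF] := FS.
have vf0 : rg s vf = 0 by apply/eqP.
have muE : test_mu s = #|O| by rewrite /test_mu vf0 /= (repE F1).
have OL : #|O| <= #|L| by apply: subset_leq_card; apply: (forest_alive FF).
have doneE i' j' : test_done s i' j' <-> (i' \in O -> j' \in L -> e i' j' ->
    if j' \in O then separating C S i' j' = set0 else M j' \in C).
  rewrite /test_done vf0 /= !F1 F2 !b2n_neq0; split=> [[//|]|] H.
    move=> h1 h2 h3; have := H h1 h2 h3; case: ifP => // _ {}H.
    apply/setP=> b; rewrite !inE; case bC: (b \in C) => //=.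
    by have := H b; rewrite F2 bC !F3 => /(_ isT); case: (_ \in _); case: (_ \in _).
  right=> h1 h2 h3; have := H h1 h2 h3; case: ifP => // _ /setP {}H b.
  rewrite F2 b2n_neq0 !F3 => bC; have := H b; rewrite !inE bC /= => /negbFE/eqP->.
  by [].
have same : s' = s -> test_done s i j -> test_inv s' /\
  ((test_done s i j /\ test_mu s <= test_mu s' /\
      forall i' j', test_done s' i' j' <-> test_done s i' j') \/
   (~ test_done s i j /\ test_mu s < test_mu s')).
  by move=> -> D; split; [split=> //; rewrite vfE; exists O, C, S | left].
have condE : eval w (EAnd (ENot ($vf)) (EAnd (EArr aO ($vp)) (EAnd (EArr aL2 ($vq)) (EArr aE (EIdx vp vq))))) s
    = [&& i \in O, j \in L & e i j].
  rewrite (eval_EAnd (P := true) (Q := [&& i \in O, j \in L & e i j])) //.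
    by rewrite eval_ENot /= vf0.
  move=> _; apply: eval_EAnd => [|_]; first by rewrite /= vpE F1.
  by apply: eval_EAnd => [|_]; [rewrite /= vqE E2 | rewrite eval_EArr ix E1].
move: E' same; rewrite /s' /c_test_body sem_if condE b2n_neq0.
case cond: [&& _, _ & _] => E' same; last first.
  by apply: same => //; apply/doneE=> h1 h2 h3; rewrite h1 h2 h3 in cond.
have /and3P[iO jL eij] := cond.
move: E' same; rewrite sem_if /= vqE F1 b2n_neq0.
case jO: (j \in O) => E' same.
  set s1 := sem w c_shrink s in E' same *.
  have ZD : separating C S i j != set0 -> ~ test_done s i j.
    by move=> Z /doneE/(_ iO jL eij); rewrite jO => Z0; rewrite Z0 eqxx in Z.
  case: (shrink_ok E FS vf0 vpE vqE) => [[[b bZ Mb] vf1]|[nZ vf1 C1 O1]].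
    have imp : improvable e L M.
      have [K [KL pK cK]] := forest_found esym ML.1 ML.2 FF iO jO eij bZ Mb.
      by exists K; rewrite coveredE.
    split; first by split=> //; rewrite (negPf vf1).
    right; split; first by apply: ZD; apply/set0Pn; exists b.
    by rewrite muE /test_mu vf1.
  have FF1 := forest_shrink esym ML.1 ML.2 FF iO jO eij nZ.
  have FS1 : test_forest s1 (O :|: [set t | M t \in separating C S i j])
      (C :\: separating C S i j) S by split=> //; move=> b t; rewrite sem_arr.
  split; first by split=> //; rewrite vf1; eexists; eexists; eexists; exact: FS1.
  have mu1 : test_mu s1 = #|O :|: [set t | M t \in separating C S i j]|.
    by rewrite /test_mu vf1 /= (repE O1).
  have [Z0|Z0] := eqVneq (separating C S i j) set0.
    left; split; first by apply/doneE => _ _ _; rewrite jO.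
    have O1' : O :|: [set t | M t \in separating C S i j] = O.
      by apply/setP=> t; rewrite Z0 !inE orbF.
    rewrite mu1 muE O1'; split=> // i' j'.
    rewrite /test_done vf1 vf0 !O1 !F1 O1' !b2n_neq0 C1 F2 Z0 setD0.
    have SA : ar s1 aS = ar s aS by rewrite sem_arr.
    split=> -[//|H]; right=> h1 h2 h3; have := H h1 h2 h3; case: ifP => // _ H' b.
      by rewrite F2 -SA => bC; apply: H'; rewrite C1 Z0 setD0.
    by rewrite C1 Z0 setD0 SA => bC; apply: H'; rewrite F2.
  right; split; first exact: ZD.
  rewrite mu1 muE; apply: proper_card; rewrite properE subsetUl /=.
  have [b bZ] := set0Pn _ Z0; apply/subsetPn; exists (M b).
    by rewrite !inE ML.1.1; move: bZ; rewrite inE => ->; rewrite orbT.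
  by apply: (forest_inner FF) (nZ _ bZ); move: bZ; rewrite inE => /andP[].
move: E' same; rewrite sem_if /= vqE E3 F2 b2n_neq0.
case MjC: (M j \in C) => E' same.
  by apply: same => //; apply/doneE=> _ _ _; rewrite jO.
have [S' FS'] := grow_ok E FS vpE vqE iO jL eij (negbT jO) (negbT MjC).
have vf1 : rg (sem w c_grow s) vf = 0 by rewrite sem_var.
split; first by split=> //; rewrite vf1; eexists; eexists; eexists; exact: FS'.
right; split; first by move/doneE => /(_ iO jL eij); rewrite jO MjC.
have [O1 _ _ _] := FS'.
rewrite muE /test_mu vf1 /= (repE O1) cardsU1.
by rewrite (grow_new ML.1 FF (negbT jO) (negbT MjC)).
Qed.

Lemma test_mu_bound s : test_inv s -> test_mu s <= #|L|.+1.
Proof.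
rewrite /test_mu => -[_]; case: eqP => //= _ [O [C [S [F1 _ _ FF]]]].
by rewrite (repE F1) ltnW // ltnS; apply: subset_leq_card; apply: (forest_alive FF).
Qed.

(** The flag is raised only for an improvable matching, and if it is still 0 after the sweep, the
    forest is closed and [forest_max] applies. *)
Lemma test_ok s : test_env s ->
  (rg (sem w c_test s) vf != 0 <-> improvable e L M).
Proof.
move=> E; rewrite /c_test sem_seq; have I := test_init_ok E.
set s1 := sem w c_test_init s in I *.
have BN : #|L|.+1 < test_mu s1 + N by apply: leq_trans LN (leq_addl _ _).
have stab x v s2 : x \in [:: vr; vp; vq] -> test_inv s2 ->
    [/\ test_inv (setr x v s2), test_mu (setr x v s2) = test_mu s2 &
        forall i j, test_done (setr x v s2) i j <-> test_done s2 i j].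
  by rewrite !inE => /or3P[]/eqP->; split.
have [] := sweep stab test_body_ok test_mu_bound isT isT I BN.
set s2 := sem w _ s1 => -[E2 I2] D; move: I2; case: eqP => [v0|v0] I2; last by split.
split=> // -[K [KL pK cK]].
have [O [C [S [F1 F2 F3 FF]]]] := I2.
have cl : forest_closed e L M O C S.
  move=> x y xO yL exy; have := D x y; rewrite /test_done v0 => -[//|].
  rewrite !F1 F2 !b2n_neq0 => /(_ xO yL exy); case: ifP => // _ H.
  apply/setP=> b; rewrite !inE; case bC: (b \in C) => //=.
  by have := H b; rewrite F2 bC !F3 => /(_ isT); case: (_ \in _); case: (_ \in _).
by have := forest_max esym eirr ML.1 FF cl KL pK; rewrite -coveredE leqNgt cK.
Qed.

End TestCorrect.

Local Notation vs := 9 (only parsing).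
Local Notation vx := 10 (only parsing).
Local Notation vy := 11 (only parsing).

(** [aU]: the vertices not yet coloured; [aM]: the matching; [aL]: the subgraph to
    which the search for an augmenting path has been narrowed. *)
Local Notation aU := 6 (only parsing).
Local Notation aM := 7 (only parsing).
Local Notation aL := 8 (only parsing).

Definition c_rematch :=
  CFor vv (CSto aM2 ($vv) (EIf (EEq ($vv) ($vx)) ($vy)
    (EIf (EEq ($vv) ($vy)) ($vx)
    (EIf (EEq ($vv) (EArr aM ($vy))) ($vv) (EArr aM ($vv)))))) ;;
  CFor vv (CSto aL2 ($vv) (EAnd (EArr aL ($vv))
    (EAnd (ENot (EEq ($vv) ($vx))) (ENot (EEq ($vv) ($vy)))))).

Definition c_aug_body :=
  CIf (EAnd (EArr aL ($vx)) (EAnd (EEq (EArr aM ($vx)) ($vx))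
         (EAnd (EArr aL ($vy)) (EArr aE (EIdx vx vy)))))
    (CIf (EEq (EArr aM ($vy)) ($vy))
       (CSto aM ($vx) ($vy) ;; CSto aM ($vy) ($vx) ;;
        CFor vv (CSto aL ($vv) (EArr aU ($vv))))
       (c_rematch ;; c_test ;;
        CIf ($vf) (CFor vv (CSto aL ($vv) (EArr aL2 ($vv))) ;;
                   CFor vv (CSto aM ($vv) (EArr aM2 ($vv)))) CSkip))
    CSkip.

Definition c_matching :=
  CFor vv (CSto aM ($vv) ($vv)) ;; CFor vv (CSto aL ($vv) (EArr aU ($vv))) ;;
  CFor vs (CFor vx (CFor vy c_aug_body)).

(** * Correctness of the maximum matching computation *)

Section MatchingCorrect.

Variables (w : seq bool).
Local Notation N := (size w).
Local Notation T := 'I_(size w).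
Variables (e : rel T) (U : {set T}).
Hypotheses (esym : symmetric e) (eirr : irreflexive e).
Hypothesis UN : #|U| * #|U| + #|U| + 1 < N.

Lemma improvable_ext (L : {set T}) M M' : M =1 M' -> improvable e L M -> improvable e L M'.
Proof.
move=> MM [K [KL pK cK]]; exists K; split=> //; rewrite (_ : covered _ _ = covered L M) //.
by apply/setP=> v; rewrite !inE MM.
Qed.

(** Whenever [L] has been narrowed, the matching is known to be improvable within [L], so the search
    cannot end there. *)
Definition aug_inv s : Prop := [/\ rep2 aE e s, rep aU U s &
  exists L M, [/\ rep aL L s, repf aM M s, L \subset U,
    closed_mate e L M /\ closed_mate e U M & L = U \/ improvable e L M]].

Definition aug_done s (x u : T) : Prop := exists L M, [/\ rep aL L s, repf aM M s &
  x \in L -> u \in L -> M x = x -> e x u ->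
  M u != u /\ ~ improvable e (L :\ x :\ u) (rematch M x u)].

(** A lexicographic measure: the number of matching edges, and below it the number of vertices
    removed from [L]. The weight [#|U|.+1] outweighs the reset of [L] to [U] after an
    augmentation. *)
Definition aug_mu s : nat :=
  #|[set v in U | ar s aM v != v]|./2 * #|U|.+1 + #|U :\: [set v : T | ar s aL v != 0]|.

Lemma rep_inj a (X Y : {set T}) s : rep a X s -> rep a Y s -> X = Y.
Proof. by move=> /repE <- /repE <-. Qed.

Lemma repf_inj a (M M' : T -> T) s : repf a M s -> repf a M' s -> M =1 M'.
Proof. by move=> h h' v; apply: ord_inj; rewrite -h -h'. Qed.

Lemma aug_muE s (L : {set T}) (M : T -> T) : rep aL L s -> repf aM M s ->
  aug_mu s = #|covered U M|./2 * #|U|.+1 + #|U :\: L|.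
Proof.
move=> rL rM; rewrite /aug_mu (repE rL); congr (_./2 * _ + _).
by apply: eq_card => v; rewrite !inE rM (inj_eq (@ord_inj N)).
Qed.

Lemma aug_mu_bound s : aug_inv s -> aug_mu s <= #|U| * #|U| + #|U|.
Proof.
move=> [_ _ [L [M [rL rM LU _ _]]]]; rewrite (aug_muE rL rM).
have h1 : #|covered U M| <= #|U|.
  by apply: subset_leq_card; apply/subsetP=> v; rewrite inE => /andP[].
have h2 : #|U :\: L| <= #|U| by apply: subset_leq_card; apply: subsetDl.
have h3 : #|covered U M|./2 * 2 <= #|U| by rewrite muln2; lia.
by move: (#|covered U M|./2) h3 => h; nia.
Qed.

Lemma aug_done_ext s s' x u : ar s' aL = ar s aL -> ar s' aM = ar s aM ->
  aug_done s' x u <-> aug_done s x u.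
Proof.
by move=> EL EM; split=> -[L [M [h1 h2 h3]]]; exists L, M; split=> // v;
  rewrite ?EL ?EM // -?EL -?EM.
Qed.

Lemma rematch_ok s (L : {set T}) (M : T -> T) (x u : T) : rep aL L s -> repf aM M s ->
  rg s vx = x -> rg s vy = u ->
  repf aM2 (rematch M x u) (sem w c_rematch s) /\
  rep aL2 (L :\ x :\ u) (sem w c_rematch s).
Proof.
move=> rL rM vxE vyE; rewrite /c_rematch sem_seq.
set s1 := sem w (CFor vv (CSto aM2 _ _)) s; split=> v.
  rewrite sem_arr // /s1 for_tab //.
  rewrite eval_EIf eval_EEq eval_EIf eval_EEq eval_EIf eval_EEq.
  rewrite /= vxE vyE !rM !b2n_neq0 !(inj_eq (@ord_inj N)) /rematch.
  by case: eqP => // _; case: eqP => // _; case: eqP.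
rewrite for_tab // !in_setD1; have [v1 v2] : rg s1 vx = x /\ rg s1 vy = u.
  by rewrite /s1 !sem_var.
have r1 : rep aL L s1 by move=> t; rewrite /s1 sem_arr.
rewrite andbA andbC; apply: eval_EAnd => [|_]; first by rewrite /= r1.
rewrite andbC; apply: eval_EAnd => [|_]; rewrite eval_ENot eval_EEq /= ?v1 ?v2.
  by rewrite (inj_eq (@ord_inj N)); case: (v == x).
by rewrite (inj_eq (@ord_inj N)); case: (v == u).
Qed.

Lemma aug_body_ok (i j : T) s : aug_inv s -> rg s vx = i -> rg s vy = j ->
  let s' := sem w c_aug_body s in aug_inv s' /\
  ((aug_done s i j /\ aug_mu s <= aug_mu s' /\
      forall i' j', aug_done s' i' j' <-> aug_done s i' j') \/
   (~ aug_done s i j /\ aug_mu s < aug_mu s')).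
Proof.
move=> [E1 E2 [L [M [rL rM LU [ML MU] imp]]]] vxE vyE s'.
have EU : rep2 aE e s' /\ rep aU U s'.
  by split=> [u v|v]; rewrite /s' sem_arr.
have inv1 : aug_inv s by split=> //; exists L, M.
have muE := aug_muE rL rM.
have same : ar s' aL = ar s aL -> ar s' aM = ar s aM -> aug_done s i j ->
    aug_inv s' /\ ((aug_done s i j /\ aug_mu s <= aug_mu s' /\
      forall i' j', aug_done s' i' j' <-> aug_done s i' j') \/
   (~ aug_done s i j /\ aug_mu s < aug_mu s')).
  move=> EL EM D; split.
    split; [exact: EU.1|exact: EU.2|exists L, M; split=> // v].
      by rewrite EL rL.
    by rewrite EM rM.
  left; split=> //; split; first by rewrite /aug_mu EL EM.
  by move=> i' j'; apply: aug_done_ext.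
have doneE : aug_done s i j -> i \in L -> j \in L -> M i = i -> e i j ->
    M j != j /\ ~ improvable e (L :\ i :\ j) (rematch M i j).
  move=> [L' [M' [rL' rM' H]]] iL jL Mi eij.
  have LL := rep_inj rL rL'; have MM := repf_inj rM rM'.
  have [|||//|h1 h2] := H; rewrite -?LL -?MM //.
  split; first by rewrite MM.
  move=> h; apply: h2; rewrite -LL; apply: improvable_ext h => v.
  by rewrite /rematch !MM.
have condE : eval w (EAnd (EArr aL ($vx)) (EAnd (EEq (EArr aM ($vx)) ($vx))
    (EAnd (EArr aL ($vy)) (EArr aE (EIdx vx vy))))) s
    = [&& i \in L, M i == i, j \in L & e i j].
  apply: eval_EAnd => [|_]; first by rewrite /= vxE rL.
  apply: eval_EAnd => [|_].
    by rewrite eval_EEq /= vxE rM (inj_eq (@ord_inj N)).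
  apply: eval_EAnd => [|_]; first by rewrite /= vyE rL.
  by rewrite eval_EArr eval_EIdx ?vxE ?vyE ?E1 // ltnW.
move: EU same; rewrite /s' /c_aug_body sem_if condE b2n_neq0.
case cond: [&& _, _, _ & _] => EU same; last first.
  apply: same => //; exists L, M; split=> // h1 h2 h3 h4.
  by rewrite h1 h2 h3 h4 eqxx in cond.
have /and4P[iL /eqP Mi jL eij] := cond.
have [iU jU] : i \in U /\ j \in U by rewrite !(subsetP LU).
have ij : i != j by apply: contraTneq eij => ->; rewrite eirr.
move: EU same; rewrite sem_if eval_EEq [eval _ _ _]/= [eval _ _ _]/= vyE rM.
rewrite (inj_eq (@ord_inj N)) b2n_neq0.
have [Mj|Mj] := eqVneq (M j) j => EU same.
  rewrite !sem_seq !sem_sto /= vxE vyE.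
  set s1 := seta aM j _ _; set s2 := sem w _ s1.
  have rM2 : repf aM (rematch M i j) s2.
    move=> v; rewrite /s2 sem_arr //= !(inj_eq (@ord_inj N)) rM /rematch Mj.
    have [->|vj] := eqVneq v j; first by rewrite eq_sym (negPf ij).
    by have [_|vi] := eqVneq v i.
  have rL2 : rep aL U s2 by move=> v; rewrite /s2 for_tab //= E2.
  split.
    split; [by move=> u v; rewrite /s2 sem_arr //; exact: E1|
            by move=> v; rewrite /s2 sem_arr //; exact: E2|].
    exists U, (rematch M i j); split=> //.
      by split; apply: rematch_same.
    by left.
  right; split; first by move/doneE => /(_ iL jL Mi eij)[]; rewrite Mj eqxx.
  rewrite muE (aug_muE rL2 rM2) (covered_match eirr iU jU Mi eij Mj) /=.
  have h2 : #|U :\: L| <= #|U| by apply: subset_leq_card; apply: subsetDl.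
  by rewrite setDv cards0 addn0 mulSn addnC ltn_add2r ltnS.
rewrite !sem_seq; set s1 := sem w c_rematch s.
have [rM1 rL1] := rematch_ok rL rM vxE vyE.
have LD : #|L :\ i :\ j|.+1 < N.
  have h1 : #|L :\ i :\ j| <= #|L|.
    by apply: subset_leq_card; apply: subset_trans (subsetDl _ _) (subsetDl _ _).
  have h2 := subset_leq_card LU; move: UN h1 h2; clear; nia.
have ML1 := rematch_closed esym eirr ML Mi eij.
have TE : test_env e (L :\ i :\ j) (rematch M i j) s1.
  by split=> // u v; rewrite /s1 sem_arr.
have tok := test_ok esym eirr ML1 LD TE.
rewrite -/s1 in rM1 rL1; set s2 := sem w c_test s1 in tok *.
have fr a : ~~ writes_arr c_test a -> ar s2 a = ar s1 a by move=> h; rewrite /s2 sem_arr.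
have [L12 M12] : ar s2 aL = ar s aL /\ ar s2 aM = ar s aM.
  by rewrite !fr // /s1 !sem_arr.
move: EU same; rewrite !sem_seq -/s1 -/s2 sem_if /=.
case: eqP tok => [v0|v1] tok EU same.
  apply: same; rewrite ?L12 ?M12 //; exists L, M; split=> // _ _ _ _.
  by split=> // /tok.
have {tok}imp1 : improvable e (L :\ i :\ j) (rematch M i j) by apply/tok.
move: EU same; rewrite !sem_seq; set s3 := sem w _ s2; set s4 := sem w _ s3 => EU same.
have rM4 : repf aM (rematch M i j) s4.
  by move=> v; rewrite /s4 for_tab //= /s3 sem_arr // fr.
have rL4 : rep aL (L :\ i :\ j) s4.
  by move=> v; rewrite /s4 sem_arr // /s3 for_tab //= fr.
split.
  split; [exact: EU.1|exact: EU.2|exists (L :\ i :\ j), (rematch M i j); split=> //].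
  - by apply: subset_trans LU; apply: subset_trans (subsetDl _ _) (subsetDl _ _).
  - by split=> //; apply: rematch_same.
  - by right.
right; split; first by move/doneE => /(_ iL jL Mi eij)[_].
rewrite muE (aug_muE rL4 rM4) (covered_rematch_same eirr MU iU jU Mi eij Mj).
rewrite ltn_add2l; apply: proper_card; rewrite properE; apply/andP; split.
  by apply: setDS; apply: subset_trans (subsetDl _ _) (subsetDl _ _).
by apply/subsetPn; exists i; rewrite !inE ?eqxx ?andbF ?iU ?iL.
Qed.

(** Once all pairs are done, [improvable_step] excludes that the matching is improvable in [L]; by
    the invariant [L] is then [U]. *)
Lemma matching_ok s : rep2 aE e s -> rep aU U s ->
  exists M, [/\ repf aM M (sem w c_matching s), closed_mate e U M &
    forall K : {set T}, K \subset U -> pm e K -> #|K| <= #|covered U M|].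
Proof.
move=> E1 E2; rewrite /c_matching !sem_seq; set s1 := sem w _ s; set s2 := sem w _ s1.
have I : aug_inv s2.
  split=> [u v|v|]; rewrite ?/s2 ?/s1 ?sem_arr //.
  exists U, id; split=> //; last by left.
  - by move=> v; rewrite /s2 for_tab //= /s1 sem_arr.
  - by move=> v; rewrite /s2 sem_arr // /s1 for_tab.
  - by split; split=> //; split=> // v; rewrite eqxx.
have BN : #|U| * #|U| + #|U| < aug_mu s2 + N.
  by apply: leq_trans (leq_addl _ _); move: UN; lia.
have stab x v s0 : x \in [:: vs; vx; vy] -> aug_inv s0 ->
    [/\ aug_inv (setr x v s0), aug_mu (setr x v s0) = aug_mu s0 &
        forall i j, aug_done (setr x v s0) i j <-> aug_done s0 i j].
  by rewrite !inE => /or3P[]/eqP->; split.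
have [] := sweep stab aug_body_ok aug_mu_bound isT isT I BN.
set s3 := sem w _ s2 => -[_ _ [L [M [rL rM LU [ML MU] imp]]]] D.
have nimp : ~ improvable e L M.
  move=> /(improvable_step esym eirr ML) [x [u [xL uL Mx exu H]]].
  have [L' [M' [rL' rM' []]]] := D x u.
  - by rewrite -(rep_inj rL rL').
  - by rewrite -(rep_inj rL rL').
  - by rewrite -(repf_inj rM rM').
  - by [].
  rewrite -(repf_inj rM rM') => /H h []; rewrite -(rep_inj rL rL').
  apply: improvable_ext h => v; have MM := repf_inj rM rM'.
  by rewrite /rematch !MM.
exists M; split=> // K KU pK; case: imp => [LE|//].
rewrite leqNgt; apply/negP=> h; apply: nimp; exists K; rewrite LE.
by [].
Qed.

End MatchingCorrect.

(** [vtot]: the sum of the colours used so far; [aK], [aB]: the current and the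
    largest greedy clique. *)
Local Notation vi := 12 (only parsing).
Local Notation vtot := 13 (only parsing).
Local Notation vbest := 14 (only parsing).
Local Notation vcnt := 15 (only parsing).
Local Notation vz := 16 (only parsing).
Local Notation vu := 17 (only parsing).

Local Notation aK := 9 (only parsing).
Local Notation aB := 10 (only parsing).

Definition c_greedy :=
  CFor vu (CSto aK ($vu) (EAnd (EEq ($vu) ($vv)) (EArr aU ($vu)))) ;;
  CFor vu (CIf (EAnd (EArr aU ($vu))
                 (ENot (ESum vz (EAnd (EArr aK ($vz)) (ENot (EArr aE (EIdx vu vz)))))))
             (CSto aK ($vu) (EC 1)) CSkip).

(** [vbest] starts at 2, so [aB] records only cliques that the exchange argument may remove. The
    difference of [aU] and [aB] passes through [aK], since [for_tab] asks that the array being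
    filled is not read. *)
Definition c_clique_step :=
  CSet vbest (EC 2) ;;
  CFor vv (c_greedy ;; CSet vcnt (ESum vu (EArr aK ($vu))) ;;
    CIf (ELt ($vbest) ($vcnt))
      (CSet vbest ($vcnt) ;; CFor vu (CSto aB ($vu) (EArr aK ($vu)))) CSkip) ;;
  CIf (ELt (EC 2) ($vbest))
    (CSet vtot (EAdd ($vtot) (ESum vu (EArr aU ($vu)))) ;;
     CFor vu (CSto aK ($vu) (EAnd (EArr aU ($vu)) (ENot (EArr aB ($vu))))) ;;
     CFor vu (CSto aU ($vu) (EArr aK ($vu))))
    CSkip.

(** Matching edges are counted at their smaller ends, and [t - (t - p)] is [minn t p], so the last
    sum is the one of [achievable_pm]. *)
Definition c_min_sum :=
  CSet vtot (EC 0) ;; CFor vi c_clique_step ;; c_matching ;;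
  CSet vcnt (ESum vu (EArr aU ($vu))) ;;
  CSet vbest (ESum vu (EAnd (EArr aU ($vu)) (ELt ($vu) (EArr aM ($vu))))) ;;
  CSet vtot (EAdd ($vtot) (ESum vu
    (ESub ($vcnt) (EAdd ($vu) (ESub ($vu) (ESub ($vu) ($vbest))))))).

(** * Correctness of clique removal and of the minimum sum *)

Section CliquesCorrect.

Variables (w : seq bool).
Local Notation N := (size w).
Local Notation T := 'I_(size w).
Variables (e : rel T).
Hypotheses (esym : symmetric e) (eirr : irreflexive e) (paw : paw_free e).

Lemma eval_ESum i f s : eval w (ESum i f) s = \sum_(k < N) eval w f (setr i k s).
Proof. by []. Qed.

Lemma eval_sum_rep a i (X : {set T}) s : rep a X s -> eval w (ESum i (EArr a ($i))) s = #|X|.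
Proof.
by move=> rX; rewrite /= -sum_rep; apply: eq_bigr => k _; rewrite eqxx rX.
Qed.

Definition maximal_clique (U C : {set T}) : Prop := [/\ C \subset U, clique e C &
  forall u, u \in U -> u \notin C -> exists2 z, z \in C & ~~ e u z].

(** A rejected vertex has a non-neighbour in the current clique, and this stays true because the
    clique only grows. *)
Lemma greedy_ok s (U : {set T}) (v : T) : rep2 aE e s -> rep aU U s -> rg s vv = v ->
  exists C, [/\ rep aK C (sem w c_greedy s), maximal_clique U C & v \in U -> v \in C].
Proof.
move=> E1 E2 vvE; rewrite /c_greedy sem_seq; set s1 := sem w _ s; set c := CIf _ _ _.
pose P n s' := [/\ ar s' aU = ar s aU, ar s' aE = ar s aE & exists C, [/\ rep aK C s',
  C \subset U, clique e C, v \in U -> v \in C & forall u : T, u < n -> u \in U -> u \notin C ->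
  exists2 z, z \in C & ~~ e u z]].
suff [_ _ [C [h1 h2 h3 h4 h5]]] : P N (sem w (CFor vu c) s1).
  by exists C; split=> //; split=> // u; apply: h5.
apply: for_ind.
  split; rewrite ?/s1 ?sem_arr //; exists ([set v] :&: U); split=> //.
  - move=> u; rewrite for_tab // in_setI in_set1; apply: eval_EAnd => [|_].
      by rewrite eval_EEq /= vvE (inj_eq (@ord_inj N)).
    by rewrite /= E2.
  - exact: subsetIr.
  - by move=> u u' /setIP[/set1P-> _] /setIP[/set1P-> _]; rewrite eqxx.
  by move=> vU; rewrite in_setI set11.
move=> k s2 [U2 E22 [C [rC CU clC vC maxC]]]; rewrite sem_if.
set s3 := setr vu k s2.
have -> : eval w (EAnd (EArr aU ($vu)) (ENot (ESum vz (EAnd (EArr aK ($vz))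
     (ENot (EArr aE (EIdx vu vz))))))) s3 = (k \in U) && [forall z in C, e k z].
  apply: eval_EAnd => [|_]; first by rewrite /= U2 E2.
  rewrite eval_ENot; congr nat_of_bool.
  have -> : eval w (ESum vz (EAnd (EArr aK ($vz)) (ENot (EArr aE (EIdx vu vz))))) s3 =
      \sum_(z < N) ((z \in C) && ~~ e k z).
    rewrite eval_ESum; apply: eq_bigr => z _; apply: eval_EAnd => [|_]; first by rewrite /= rC.
    by rewrite eval_ENot eval_EArr eval_EIdx //= ?E22 ?E1; [case: (e k z) | exact: ltnW].
  rewrite sum_nat_eq0; apply/forall_inP/forall_inP => H z.
    by move=> zC; have := H z isT; rewrite zC /=; case: (e k z).
  by move=> _; case zC: (z \in C) => //=; rewrite H.
rewrite b2n_neq0; case: ifP => cond.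
  have [kU /forall_inP ke] := andP cond.
  rewrite sem_sto; split=> //; exists (k |: C); split.
  - by move=> u; rewrite /= in_setU1 (inj_eq (@ord_inj N)) rC; case: (u == k).
  - by rewrite subUset sub1set kU.
  - move=> a b /setU1P[->|aC] /setU1P[->|bC]; rewrite ?eqxx //.
    + by move=> _; apply: ke.
    + by move=> _; rewrite esym ke.
    + exact: clC.
  - by move=> vU; rewrite in_setU1 vC ?orbT.
  move=> u; rewrite ltnS leq_eqVlt => /orP[/eqP/val_inj->|uk] uU.
    by rewrite setU11.
  rewrite in_setU1 negb_or => /andP[_ uC]; have [z zC ez] := maxC u uk uU uC.
  by exists z => //; rewrite in_setU1 zC orbT.
split=> //; exists C; split=> // u.
rewrite ltnS leq_eqVlt => /orP[/eqP/val_inj->|uk] uU uC; last exact: maxC.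
by move: cond; rewrite uU /= => /negbT; rewrite negb_forall_in => /exists_inP.
Qed.

(** By [clique_bound] no clique exceeds [vbest]: either all cliques have at most two vertices, or
    the recorded one is a largest clique. *)
Lemma clique_step_ok s (U : {set T}) : rep2 aE e s -> rep aU U s ->
  let s' := sem w c_clique_step s in
  [/\ triangle_free e U, rep aU U s' & rg s' vtot = rg s vtot] \/
  exists Q : {set T}, [/\ [/\ Q \subset U, clique e Q & 3 <= #|Q|],
    forall Q' : {set T}, Q' \subset U -> clique e Q' -> #|Q'| <= #|Q|,
    rep aU (U :\: Q) s' & rg s' vtot = rg s vtot + #|U|].
Proof.
move=> E1 E2; rewrite /c_clique_step !sem_seq sem_set.
set s1 := setr vbest _ s; set c := CSeq c_greedy _; set s2 := sem w _ s1.
have [U2 B2 [Q BP] maxP] : [/\ ar s2 aU = ar s aU, 2 <= rg s2 vbest,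
  exists Q, rg s2 vbest = 2 \/
    [/\ rep aB Q s2, Q \subset U, clique e Q & #|Q| = rg s2 vbest] &
  forall v : T, v < N -> v \in U ->
    exists C, [/\ maximal_clique U C, v \in C & #|C| <= rg s2 vbest]].
  pose P n s' := [/\ ar s' aU = ar s aU /\ ar s' aE = ar s aE, 2 <= rg s' vbest,
  exists Q, rg s' vbest = 2 \/
    [/\ rep aB Q s', Q \subset U, clique e Q & #|Q| = rg s' vbest] &
  forall v : T, v < n -> v \in U ->
    exists C, [/\ maximal_clique U C, v \in C & #|C| <= rg s' vbest]].
  suff [[? ?] ? ? ?] : P N (sem w (CFor vv c) s1) by [].
  apply: for_ind => [|k s3 [[U3 E3] B3 [Q BP] maxP]].
    by split=> //; exists set0; left.
  have r3 : rep aU U (setr vv k s3) by move=> u; rewrite /= U3 E2.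
  have r3' : rep2 aE e (setr vv k s3) by move=> u v; rewrite /= E3 E1.
  have vk3 : rg (setr vv k s3) vv = k by [].
  have [C [rC maxC kC]] := greedy_ok r3' r3 vk3.
  rewrite /c !sem_seq; set s4 := sem w c_greedy _ in rC *.
  rewrite sem_set (eval_sum_rep _ rC); set s5 := setr vcnt _ s4.
  have b5 : rg s5 vbest = rg s3 vbest by rewrite /s5 /= /s4 sem_var.
  have U5 : ar s5 aU = ar s aU by rewrite -U3 /s5 /= /s4 sem_arr.
  have E5 : ar s5 aE = ar s aE by rewrite -E3 /s5 /= /s4 sem_arr.
  have B5 : ar s5 aB = ar s3 aB by rewrite /s5 /= /s4 sem_arr.
  rewrite sem_if eval_ELt b2n_neq0 [eval _ _ _]b5 [eval _ _ _]/=.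
  have [bC|Cb] := ltnP (rg s3 vbest) #|C|.
    rewrite sem_seq sem_set; set s6 := setr vbest _ s5; set s7 := sem w _ s6.
    have b7 : rg s7 vbest = #|C| by rewrite /s7 sem_var.
    split.
    - by rewrite /s7 !sem_arr.
    - by rewrite b7; apply: leq_trans (ltnW bC).
    - exists C; right; have [CU clC _] := maxC; split=> // u.
      by rewrite /s7 for_tab //= rC.
    move=> v; rewrite b7 ltnS leq_eqVlt => /orP[/eqP/val_inj->|vk] vU.
      by exists C; split=> //; apply: kC.
    have [C' [h1 h2 h3]] := maxP v vk vU; exists C'; split=> //.
    exact: leq_trans (ltnW bC).
  have -> : sem w CSkip s5 = s5 by [].
  split; rewrite ?b5 //.
    by exists Q; case: BP => [->|[h1 h2 h3 h4]]; [left|right; split=> // u; rewrite B5].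
  move=> v; rewrite ltnS leq_eqVlt => /orP[/eqP/val_inj->|vk] vU; last exact: maxP.
  by exists C; split=> //; apply: kC.
have maxQ : forall Q' : {set T}, Q' \subset U -> clique e Q' -> #|Q'| <= rg s2 vbest.
  apply: (clique_bound esym eirr paw B2) => v vU.
  by have [C [[h1 h2 h3] h4 h5]] := maxP v (ltn_ord v) vU; exists C.
have tot2 : rg s2 vtot = rg s vtot by rewrite /s2 sem_var.
rewrite sem_if eval_ELt b2n_neq0 [eval _ _ _]/= [eval _ _ _]/=.
have [b2|b2] := ltnP.
  right; case: BP => [E|[rQ QU clQ cQ]]; first by rewrite E in b2.
  have rU2 : rep aU U s2 by move=> u; rewrite U2 E2.
  exists Q; rewrite cQ; split=> //.
    rewrite !sem_seq => u; rewrite for_tab // /= for_tab // in_setD andbC.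
    apply: eval_EAnd => [|_]; first by rewrite /= rU2.
    by rewrite eval_ENot /= rQ; case: (u \in Q).
  by rewrite !sem_seq 2?sem_var // sem_set /= tot2; congr (_ + _); apply: (eval_sum_rep vu rU2).
left; split=> //; last by move=> u; rewrite U2 E2.
by move=> Q' Q'U clQ'; apply: leq_trans (maxQ Q' Q'U clQ') b2.
Qed.

(** [M] exchanges the smaller ends of the matching edges with the larger ones. *)
Lemma card_covered (U : {set T}) (M : T -> T) : closed_mate e U M ->
  #|covered U M| = #|[set v in U | v < M v]|.*2.
Proof.
move=> [[invM _] UM]; rewrite -addnn; pose D := [set v in U | v < M v].
rewrite -(cardsID D (covered U M)); congr (_ + _).
  apply: eq_card => v; rewrite !inE -(inj_eq (@ord_inj N)) neq_ltn.
  by case: (v \in U); rewrite //=; case: ltngtP.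
rewrite -(card_imset D (inv_inj invM)); apply: eq_card => v.
rewrite -[v in RHS]invM (mem_imset _ _ (inv_inj invM)) !inE invM.
rewrite -(inj_eq (@ord_inj N)) neq_ltn.
have -> : (M v \in U) = (v \in U) by apply/idP/idP=> [/UM|/UM//]; rewrite invM.
by case: (v \in U); rewrite //=; case: ltngtP.
Qed.

(** [achievable_add] turns colourings of the remaining set into colourings of [U], and
    [achievable_del] shows that nothing is lost, so the two bounds meet. *)
Lemma min_sum_ok s (U : {set T}) : #|U| * #|U| + #|U| + 1 < N ->
  rep2 aE e s -> rep aU U s ->
  let m := rg (sem w c_min_sum s) vtot in
  achievable e U m /\ forall k, achievable e U k -> m <= k.
Proof.
move=> UN E1 E2; rewrite /c_min_sum !sem_seq !sem_set.
set s1 := setr vtot _ s; set s2 := sem w _ s1; set s3 := sem w c_matching s2.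
have [E3 [V [rV triV VU lowV]]] : ar s2 aE = ar s aE /\ exists V, [/\ rep aU V s2,
    triangle_free e V, #|V| <= #|U| &
    (forall k, achievable e V k -> achievable e U (rg s2 vtot + k)) /\
    (forall k, achievable e U k -> exists2 k', achievable e V k' & rg s2 vtot + k' <= k)].
  have E2s : ar s2 aE = ar s aE by rewrite /s2 sem_arr.
  split=> //.
  (* Every round removes vertices unless no triangle is left; as [N] exceeds [#|U|], the second case
     of the disjunction is impossible at the end. *)
  pose P n s' := ar s' aE = ar s aE /\ exists V, [/\ rep aU V s',
    triangle_free e V \/ #|V| + n <= #|U|, #|V| <= #|U| &
    (forall k, achievable e V k -> achievable e U (rg s' vtot + k)) /\
    (forall k, achievable e U k -> exists2 k', achievable e V k' & rg s' vtot + k' <= k)].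
  have [_ [V [h1 h2 h3 h4]]] : P N s2.
    apply: for_ind => [|k s4 [E4 [V [rV triV VU [ach1 ach2]]]]].
      split=> //; exists U; split=> //; first by right; rewrite addn0.
      by split=> // k Uk; exists k.
    set s5 := setr vi k s4.
    have E5 : rep2 aE e s5 by move=> u v; rewrite /= E4 E1.
    have rV5 : rep aU V s5 by move=> u; rewrite /= rV.
    split; first by rewrite sem_arr.
    case: (clique_step_ok E5 rV5) => [[tri r5 t5]|[Q [[QV clQ Q3] maxQ r5 t5]]].
      by exists V; rewrite t5; split=> //; left.
    have cVQ : #|V :\: Q| + #|Q| = #|V| by rewrite cardsD (setIidPr QV) subnK // subset_leq_card.
    exists (V :\: Q); rewrite t5; split=> //.
    - case: triV => [tri|Vk]; last by right; rewrite addnS; lia.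
      by have := tri Q QV clQ; rewrite leqNgt Q3.
    - by apply: leq_trans VU; apply: subset_leq_card; apply: subsetDl.
    split=> [k'|k'].
      by move=> /(achievable_add QV clQ)/ach1; rewrite addnA.
    case/ach2 => k1 Vk1 le1.
    have [k2 Vk2 le2] := achievable_del esym eirr paw QV clQ Q3 maxQ Vk1.
    exists k2 => //; rewrite -addnA; apply: leq_trans le1.
    by rewrite leq_add2l.
  exists V; split=> //; case: h2 => // h2; exfalso; move: h2 UN; lia.
have E3' : rep2 aE e s2 by move=> u v; rewrite E3 E1.
have VN : #|V| * #|V| + #|V| + 1 < N.
  by apply: leq_ltn_trans UN; rewrite leq_add2r leq_add // leq_mul.
have [M [rM MV maxM]] := matching_ok esym eirr VN E3' rV.
rewrite -/s3 in rM.
have rV3 : rep aU V s3 by move=> u; rewrite /s3 sem_arr.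
rewrite (eval_sum_rep _ rV3); set s4 := setr vcnt _ s3.
pose p := #|[set v in V | v < M v]|.
have -> : eval w (ESum vu (EAnd (EArr aU ($vu)) (ELt ($vu) (EArr aM ($vu))))) s4 = p.
  rewrite /p -sum_rep eval_ESum; apply: eq_bigr => u _; rewrite inE.
  apply: eval_EAnd => [|_]; first by rewrite /= rV3.
  by rewrite eval_ELt /= rM.
set s5 := setr vbest p s4.
pose F := \sum_(t < N) (#|V| - (t + minn t p)).
have -> : rg (setr vtot (eval w (EAdd ($vtot) (ESum vu (ESub ($vcnt) (EAdd ($vu) (ESub ($vu) (ESub ($vu) ($vbest))))))) s5) s5) vtot = rg s2 vtot + F.
  rewrite /= /s3 sem_var //; congr (_ + _); apply: eq_bigr => t _ /=.
  by congr (_ - (_ + _)); rewrite minnE; lia.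
have pE : #|covered V M|./2 = p by rewrite (card_covered MV) doubleK.
case: lowV => low1 low2; split.
  apply: low1; rewrite /F -pE; apply: achievable_pm => //.
  - apply: (pm_mating MV.1) => v; rewrite inE => /andP[vV Mv].
    by rewrite inE MV.1.1 MV.2 // eq_sym.
  - by apply/subsetP=> v; rewrite inE => /andP[].
  - by rewrite -[leqRHS]card_ord max_card.
move=> k /low2[k' Vk' le]; apply: leq_trans le; rewrite leq_add2l.
apply: (achievable_bound N triV) Vk' => K KV pK.
by rewrite -(card_covered MV); apply: maxM.
Qed.

End CliquesCorrect.

(** [vn]: the number of vertices; [vo]: the position of the sign bit. *)
Local Notation vn := 18 (only parsing).
Local Notation vo := 19 (only parsing).
Local Notation vkk := 20 (only parsing).
Local Notation vpw := 21 (only parsing).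

Definition e_matrix_entry :=
  EAdd (EAdd ($vn) (EC 1)) (EAdd (ESum vk (EIf (ESub ($vx) ($vk)) ($vn) (EC 0))) ($vy)).

(** [vn] counts the positions up to which no bit is 0, which is the length of the unary prefix.
    Numbers from [vn] on become isolated. *)
Definition c_graph :=
  CSet vn (ESum vv (ENot (ESum vu (EAnd (ENot (ELt ($vv) ($vu))) (ENot (EIn ($vu))))))) ;;
  CFor vx (CFor vy (CSto aE (EIdx vx vy)
    (EAnd (ELt ($vx) ($vn)) (EAnd (ELt ($vy) ($vn))
       (EAnd (ENot (EEq ($vx) ($vy))) (ENot (EIn e_matrix_entry))))))) ;;
  CFor vv (CSto aU ($vv) (ELt ($vv) ($vn))).

(** Cells beyond the end of the input read as 0, so running through all [N] rounds does not change
    the value. *)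
Definition c_number :=
  CSet vo (EAdd (EAdd ($vn) (EC 1)) (ESum vk (EIf (ESub ($vn) ($vk)) ($vn) (EC 0)))) ;;
  CSet vkk (EC 0) ;; CSet vpw (EC 1) ;;
  CFor vv (CIf (EIn (EAdd (EAdd ($vo) (EC 1)) ($vv))) (CSet vkk (EAdd ($vkk) ($vpw))) CSkip ;;
           CSet vpw (EAdd ($vpw) ($vpw))).

Definition c_main :=
  c_graph ;; c_min_sum ;; c_number ;;
  CSet 0 (EIf (EIn ($vo)) (EC 0) (ENot (ELt ($vkk) ($vtot)))).

Lemma nth_allpairs_square (A : eqType) (f : A -> A -> bool) (s1 s2 : seq A) x0 i j :
  i < size s1 -> j < size s2 ->
  nth false [seq f x y | x <- s1, y <- s2] (i * size s2 + j) = f (nth x0 s1 i) (nth x0 s2 j).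
Proof.
elim: s1 i => //= x s1 IH [|i] is1 js2; rewrite nth_cat size_map.
  by rewrite mul0n add0n js2 (nth_map x0).
by rewrite mulSn -addnA ltnNge leq_addr /= addKn IH.
Qed.

Lemma pair_lt i j n : i < n -> j < n -> i * n + j < n * n.
Proof. by nia. Qed.

Lemma binary_expansion k m : k = \sum_(i < m) odd (k %/ 2 ^ i) * 2 ^ i + k %/ 2 ^ m * 2 ^ m.
Proof.
elim: m => [|m IH]; first by rewrite big_ord0 expn0 divn1 muln1.
rewrite big_ord_recr /= {1}IH -addnA; congr (_ + _).
rewrite expnSr divnMA -{1}(odd_double_half (k %/ 2 ^ m)) mulnDl divn2.
by rewrite -[_./2.*2]muln2 -mulnA [2 * _]mulnC.
Qed.

Lemma nth_binary k i : nth false (binary k) i = odd (k %/ 2 ^ i).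
Proof.
rewrite /binary; have [ik|ki] := ltnP i (up_log 2 k.+1); first by rewrite nth_mkseq.
rewrite nth_default ?size_mkseq // divn_small //.
apply: leq_trans (_ : 2 ^ up_log 2 k.+1 <= _); last by rewrite leq_exp2l.
by apply: up_logP.
Qed.

Lemma sum_binary k N : size (binary k) <= N ->
  \sum_(i < N) nth false (binary k) i * 2 ^ i = k.
Proof.
rewrite size_mkseq => kN; rewrite {2}[k](binary_expansion k N) divn_small ?mul0n ?addn0.
  by apply: eq_bigr => i _; rewrite nth_binary.
apply: leq_trans (_ : 2 ^ up_log 2 k.+1 <= _); last by rewrite leq_exp2l.
by apply: up_logP.
Qed.

(** * Reading the instance from its encoding *)

Section Encoding.

Variables (G : sgraph) (k : int).
Local Notation w := (encode (G, k)).
Local Notation N := (size w).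
Local Notation n := #|vertex G|.

Let matrix := [seq adj u v | u <- enum G, v <- enum G].

Let size_matrix : size matrix = n * n.
Proof. by rewrite size_allpairs -cardE. Qed.

Let wE : w = nseq n true ++ false :: matrix ++ (k < 0)%R :: binary `|k|.
Proof. by []. Qed.

Let sizeE : N = n + (n * n + (size (binary `|k|)).+1).+1.
Proof. by rewrite wE size_cat size_nseq /= size_cat size_matrix /=. Qed.

Lemma encode_unary j : j < n -> nth false w j.
Proof. by move=> jn; rewrite wE nth_cat size_nseq jn nth_nseq jn. Qed.

Lemma encode_stop : nth false w n = false.
Proof. by rewrite wE nth_cat size_nseq ltnn subnn. Qed.

Lemma encode_adj (u v : G) :
  nth false w (n + 1 + (enum_rank u * n + enum_rank v)) = adj u v.
Proof.
rewrite wE nth_cat size_nseq -addnA ltnNge leq_addr /= addKn add1n /=.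
have lt : enum_rank u * n + enum_rank v < n * n.
  exact: pair_lt.
rewrite nth_cat size_matrix lt /matrix {2}cardE.
rewrite (nth_allpairs_square _ u) -?cardE //.
by rewrite -!enum_val_nth !enum_rankK.
Qed.

Lemma encode_sign : nth false w (n + 1 + n * n) = (k < 0)%R.
Proof.
rewrite wE nth_cat size_nseq -addnA ltnNge leq_addr /= addKn add1n /=.
by rewrite nth_cat size_matrix ltnn subnn.
Qed.

Lemma encode_number i : nth false w (n + 1 + n * n + 1 + i) = nth false (binary `|k|) i.
Proof.
rewrite wE nth_cat size_nseq -!addnA ltnNge leq_addr /= addKn add1n /=.
by rewrite nth_cat size_matrix ltnNge leq_addr /= addKn add1n.
Qed.

Local Notation T := 'I_(size w).

Lemma vertex_lt (v : G) : enum_rank v < N.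
Proof. by rewrite sizeE; apply: leq_trans (ltn_ord _) (leq_addr _ _). Qed.

Definition code (v : G) : T := Ordinal (vertex_lt v).

Definition codes : {set T} := [set i : T | i < n].

Definition co_adj : rel T := fun i j =>
  [&& i < n, j < n, i != j & ~~ nth false w (n + 1 + (i * n + j))].

Lemma code_inj : injective code.
Proof. by move=> u v /(congr1 val) /= /ord_inj E; apply: enum_rank_inj. Qed.

Lemma codeP (i : T) : i < n -> exists v, i = code v.
Proof.
move=> i_n; exists (enum_val (Ordinal i_n)); apply: val_inj.
by rewrite /= enum_valK.
Qed.

Lemma co_adj_code u v : co_adj (code u) (code v) = (u != v) && ~~ adj u v.
Proof. by rewrite /co_adj /= !ltn_ord (inj_eq code_inj) encode_adj. Qed.

Lemma co_adjP i j : co_adj i j ->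
  exists u v, [/\ i = code u, j = code v, u != v & ~~ adj u v].
Proof.
move=> eij; have /and4P[i_n jn _ _] := eij.
have [u iu] := codeP i_n; have [v jv] := codeP jn; exists u, v.
by move: eij; rewrite iu jv co_adj_code => /andP[].
Qed.

Lemma co_adj_sym : symmetric co_adj.
Proof.
suff H i j : co_adj i j -> co_adj j i by move=> i j; apply/idP/idP; apply: H.
by move=> /co_adjP[u [v [-> -> uv auv]]]; rewrite co_adj_code eq_sym uv adj_sym.
Qed.

Lemma co_adj_irr : irreflexive co_adj.
Proof. by move=> i; rewrite /co_adj eqxx !andbF. Qed.

(** An induced paw of the complement is an induced [P3_P1] in [G]: the vertex of degree 3 becomes
    isolated, and the pendant vertex becomes the middle of the path. *)
Lemma co_adj_paw_free : induced_free P3_P1 G -> paw_free co_adj.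
Proof.
move=> free i j l h /co_adjP[a [b [-> -> ab nab]]].
move=> /co_adjP[a' [c [/code_inj <- -> ac nac]]].
move=> /co_adjP[b' [c' [/code_inj <- /code_inj <- bc nbc]]].
move=> /co_adjP[a'' [d [/code_inj <- -> ad nad]]] {i j l h}.
rewrite !(inj_eq code_inj) !co_adj_code => db dc; rewrite db dc /=.
rewrite -negb_and; apply/negP=> /andP[adb adc]; apply: free.
(* The path is [b], [d], [c], the isolated vertex [a]. *)
pose f (x : P3_P1) : G := match x with inl i => nth a [:: b; d; c] i | inr _ => a end.
have nba : adj b a = false by rewrite adj_sym (negPf nab).
have nca : adj c a = false by rewrite adj_sym (negPf nac).
have ncb : adj c b = false by rewrite adj_sym (negPf nbc).
have nda : adj d a = false by rewrite adj_sym (negPf nad).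
have abd : adj b d by rewrite adj_sym.
have acd : adj c d by rewrite adj_sym.
exists f.
  move=> [[[|[|[|i]]] //= hi]|i] [[[|[|[|j]]] //= hj]|j] /= E;
    try (by congr inl; apply: val_inj); try (by rewrite !ord1);
    move: ab ac bc ad db dc; rewrite -?E ?E eqxx //.
move=> [[[|[|[|i]]] //= hi]|i] [[[|[|[|j]]] //= hj]|j] /=;
  rewrite ?(negPf nab) ?(negPf nac) ?(negPf nbc) ?(negPf nad) ?adb ?adc ?nba ?nca ?ncb
    ?nda ?abd ?acd ?adj_irrefl //.
by rewrite !ord1.
Qed.

Lemma codes_imset : codes = code @: [set: G].
Proof.
apply/setP=> i; rewrite inE; apply/idP/imsetP=> [/codeP[v ->]|[v _ ->]].
  by exists v.
by rewrite /= ltn_ord.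
Qed.

Lemma card_codes : #|codes| = n.
Proof. by rewrite codes_imset card_imset ?cardsT //; apply: code_inj. Qed.

Lemma chromatic_sum_achievable :
  chromatic_sum (G, k) <-> exists2 s, achievable co_adj codes s & (Posz s <= k)%R.
Proof.
have sumE (c : T -> nat) : \sum_(i in codes) c i = \sum_(v : G) c (code v).
  rewrite codes_imset big_imset /=; last by move=> u v _ _ /code_inj.
  by apply: eq_bigl => v; rewrite inE.
split=> [[c [c0 ca] le]|[s [c [c0 ce <-]] le]].
  exists (colouring_sum c) => //.
  pose c' (i : T) := if [pick v | code v == i] is Some v then c v else 0.
  have c'E v : c' (code v) = c v.
    by rewrite /c'; case: pickP => [u /eqP/code_inj->|/(_ v)] //; rewrite eqxx.
  exists c'; split.
  - by move=> i; rewrite inE => /codeP[v ->]; rewrite c'E.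
  - move=> i j; rewrite !inE => /codeP[u ->] /codeP[v ->].
    rewrite (inj_eq code_inj) !c'E => uv cuv; rewrite co_adj_code uv.
    by apply/negP=> /ca.
  by rewrite sumE; apply: eq_bigr => v _; rewrite c'E.
exists (fun v => c (code v)); last by rewrite /colouring_sum -sumE.
split=> [v|u v auv cuv]; first by apply: c0; rewrite inE /= ltn_ord.
have uv : u != v by apply: contraTneq auv => ->; rewrite adj_irrefl.
have := ce (code u) (code v); rewrite !inE /= !ltn_ord (inj_eq code_inj) uv.
by move=> /(_ isT isT isT cuv); rewrite co_adj_code auv andbF.
Qed.

Lemma graph_ok s : [/\ rg (sem w c_graph s) vn = n,
  rep2 aE co_adj (sem w c_graph s) & rep aU codes (sem w c_graph s)].
Proof.
rewrite /c_graph !sem_seq sem_set.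
have nN : n <= N by rewrite sizeE leq_addr.
have -> : eval w (ESum vv (ENot (ESum vu (EAnd (ENot (ELt ($vv) ($vu))) (ENot (EIn ($vu))))))) s = n.
  rewrite -card_codes -sum_rep eval_ESum; apply: eq_bigr => i _.
  rewrite eval_ENot inE eval_ESum.
  have E (j : T) : eval w (EAnd (ENot (ELt ($vv) ($vu))) (ENot (EIn ($vu)))) (setr vu j (setr vv i s))
      = (j <= i) && ~~ nth false w j.
    apply: eval_EAnd => [|_]; first by rewrite eval_ENot eval_ELt /=; case: (leqP j i).
    by rewrite eval_ENot /=; case: (nth _ _ _).
  rewrite (eq_bigr _ (fun j _ => E j)); congr nat_of_bool.
  rewrite sum_nat_eq0; apply/forall_inP/idP=> [H|i_n j _].
    rewrite ltnNge; apply/negP=> ni; have nltN : n < N by apply: leq_ltn_trans ni _.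
    by have := H (Ordinal nltN) isT; rewrite /= ni encode_stop.
  by case: leqP => //= ji; rewrite encode_unary //; apply: leq_ltn_trans ji i_n.
set s1 := setr vn n s; set s2 := sem w _ s1.
have n2 : rg s2 vn = n by rewrite /s2 sem_var.
split; first by rewrite sem_var.
  move=> i j; rewrite sem_arr // /s2 for_tab2 //; set s3 := setr vy j _.
  have [x3 y3 n3] : [/\ rg s3 vx = i, rg s3 vy = j & rg s3 vn = n] by [].
  apply: eval_EAnd => [|_]; first by rewrite eval_ELt.
  apply: eval_EAnd => [|_]; first by rewrite eval_ELt.
  apply: eval_EAnd => [|_]; first by rewrite eval_ENot eval_EEq /= (inj_eq (@ord_inj N)); case: (i == j).
  rewrite eval_ENot.
  have -> : eval w (EIn e_matrix_entry) s3 = nth false w (n + 1 + (i * n + j)).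
    by rewrite /= sum_lt_const // ltnW.
  by case: (nth _ _ _).
by move=> v; rewrite for_tab // eval_ELt /= n2 inE.
Qed.

Lemma number_ok s : rg s vn = n ->
  rg (sem w c_number s) vo = n + 1 + n * n /\ rg (sem w c_number s) vkk = `|k|%N.
Proof.
move=> nE; rewrite /c_number !sem_seq !sem_set.
have nN : n <= N by rewrite sizeE leq_addr.
have -> : eval w (EAdd (EAdd ($vn) (EC 1)) (ESum vk (EIf (ESub ($vn) ($vk)) ($vn) (EC 0)))) s = n + 1 + n * n.
  by rewrite /= nE sum_lt_const.
set s1 := setr vpw _ _.
pose P m s' := [/\ rg s' vo = n + 1 + n * n, rg s' vpw = 2 ^ m &
  rg s' vkk = \sum_(0 <= i < m) nth false (binary `|k|) i * 2 ^ i].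
set c := CSeq _ _.
have [h1 h2 h3] : P N (sem w (CFor vv c) s1).
  apply: for_ind => [|m s' [h1 h2 h3]]; first by split=> //; rewrite big_nil.
  rewrite /c sem_seq sem_if.
  have -> : eval w (EIn (EAdd (EAdd ($vo) (EC 1)) ($vv))) (setr vv m s') = nth false (binary `|k|) m.
    by rewrite /= h1 encode_number.
  rewrite /P b2n_neq0 big_nat_recr //= -h3 sem_set.
  case: (nth _ _ _); rewrite ?sem_set; split=> //=.
  - by rewrite h2 expnS mul2n addnn.
  - by rewrite h2 mul1n.
  - by rewrite h2 expnS mul2n addnn.
  - by rewrite mul0n addn0.
split=> //; rewrite h3 big_mkord sum_binary // sizeE.
by lia.
Qed.

Lemma main_ok : induced_free P3_P1 G ->
  (rg (sem w c_main (state0 w)) 0 != 0) <-> chromatic_sum (G, k).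
Proof.
move=> free; rewrite chromatic_sum_achievable /c_main !sem_seq.
have [n1 E1 U1] := graph_ok (state0 w); set s1 := sem w c_graph _ in n1 E1 U1 *.
(* The unary prefix, its closing bit, the matrix and the sign bit already take [n * n + n + 2]
   cells. *)
have UN : #|codes| * #|codes| + #|codes| + 1 < N by rewrite card_codes sizeE; lia.
have [] := min_sum_ok co_adj_sym co_adj_irr (co_adj_paw_free free) UN E1 U1.
set s2 := sem w c_min_sum s1; set m := rg s2 vtot => ach low.
have n2 : rg s2 vn = n by rewrite /s2 sem_var.
have [o3 k3] := number_ok n2; set s3 := sem w c_number s2 in o3 k3 *.
have m3 : rg s3 vtot = m by rewrite /s3 sem_var.
have -> : rg (sem w (CSet 0 (EIf (EIn ($vo)) (EC 0) (ENot (ELt ($vkk) ($vtot))))) s3) 0 =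
    ~~ (k < 0)%R && (m <= `|k|%N).
  rewrite sem_set; set v := eval w _ s3; have -> : rg (setr 0 v s3) 0 = v by [].
  rewrite /v eval_EIf eval_ENot eval_ELt.
  have -> : eval w (EIn ($vo)) s3 = nth false w (n + 1 + n * n) by rewrite /= o3.
  have [-> ->] : eval w ($vkk) s3 = `|k|%N /\ eval w ($vtot) s3 = m by [].
  by rewrite encode_sign b2n_neq0; case: (k < 0)%R => //=; case: (leqP m).
rewrite b2n_neq0.
have -> : (exists2 s, achievable co_adj codes s & (Posz s <= k)%R) <-> (Posz m <= k)%R.
  split=> [[s /low ms sk]|mk]; last by exists m.
  by apply: Order.POrderTheory.le_trans sk; rewrite lez_nat.
case: k => [a|a] /=.
  by rewrite lez_nat.
by [].
Qed.

End Encoding.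

Theorem theorem23 :
  poly_time_solvable encode chromatic_sum
    (fun I : instance => induced_free P3_P1 (fst I)).
Proof.
(* There are 22 variables, up to [vpw], and 11 arrays, up to [aB]. *)
have [//|P [b [d PP]]] := @compile_correct 22 11 c_main isT _.
exists P, b, d => -[G k] free; have [t [tb hP acc]] := PP (encode (G, k)).
exists t; split=> //; rewrite acc; exact: main_ok.
Qed.
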